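(* Let $F$ be an algebraically closed field (of any characteristic), $X/F$ a nonsingular complete algebraic curve, $S$ a finite nonempty set of closed points of $X$, and for each $s\in S$ let $\pi_s$ be a uniformizer at $s$. Let $R_0\subset F((t))^S$ be the copy of $H^0(X\setminus S,\mathcal O_X)$ obtained by Laurent expansion in powers of the $\pi_s$. Let $N$ be a positive integer. Then $$\sum_{s\in S}\mathrm{Res}^{\mathbb W}_{\leq N}(f_s,x_s)=0$$ for all $f=(f_s)_{s\in S}\in R_0^\times\subset (F((t))^\times)^S$ and all $x=(x_s)_{s\in S}\in\mathbb W_{\leq N}(R_0)\subset\mathbb W_{\leq N}(F((t))^S)=\mathbb W_{\leq N}(F((t)))^S$, where the addition is performed in the group $\mathbb W_{\leq N}(F)$.
   Context: $A^\times$ denotes the multiplicative group of a ring $A$ with unit; $A^S$ denotes the product of copies of $A$ indexed by $S$. The curve $X$ is such that $\dim_FH^0(X,\mathcal O_X)=1$ (taken for granted). For a meromorphic function $f$ on $X$ and $s\in S$, put $f^{(s)}:=\sum_ia_it^i\in F((t))$ where $f=\sum_ia_i\pi_s^i$ ($a_i\in F$) is the Laurent expansion of $f$ in powers of $\pi_s$. Then $R_0:=\{(f^{(s)})_{s\in S}\in F((t))^S\mid f\in H^0(X\setminus S,\mathcal O_X)\}$. Witt vectors. For a commutative ring $A$ with unit, $\mathbb W_{\leq N}(A)$ is the set of vectors $x=(x_i)_{i=1}^N$ with $x_i\in A$, with the addition for which $x\mapsto\prod_{i=1}^N(1-x_i\epsilon^i)\bmod\epsilon^{N+1}$ is an isomorphism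 from $\mathbb W_{\leq N}(A)$ onto the multiplicative group of units of $A[\epsilon]/(\epsilon^{N+1})$ congruent to $1$ modulo $(\epsilon)$. The pairing. Put $k:=F[\epsilon]/(\epsilon^{N+1})$, an artinian local ring with maximal ideal $m=(\epsilon)$. The pairing $\mathrm{Res}^{\mathbb W}_{\leq N}:F((t))^\times\times\mathbb W_{\leq N}(F((t)))\to\mathbb W_{\leq N}(F)$ is defined by $$\left\langle f,\prod_{i=1}^N(1-x_i\epsilon^i)\right\rangle\equiv\prod_{i=1}^N\left(1-\epsilon^i\left(\mathrm{Res}^{\mathbb W}_{\leq N}(f,x)\right)_i\right)\bmod(\epsilon^{N+1}),$$ where $\langle\cdot,\cdot\rangle$ is the Contou-Carrère symbol on $k((t))^\times$, defined as follows. $k((t))$ is the ring obtained from $k[[t]]$ by inverting $t$. Each $f\in k((t))^\times$ has a unique presentation $$f=t^{w(f)}\cdot a_0\cdot\prod_{i=1}^\infty(1-a_{-i}t^{-i})\cdot\prod_{i=1}^\infty(1-a_it^i)$$ with $w(f)\in\mathbb Z$ (the winding number), $a_0\in k^\times$, $a_i\in k$ for $i>0$, $a_i\in m$ for $i<0$, and $a_i=0$ for $i\ll0$ (the Witt parameters of $f$). If $\{a_i\}$, $\{b_j\}$ are the Witt parameters of $f,g\in k((t))^\times$, then $$\langle f,g\rangle:=(-1)^{w(f)w(g)}\cdot\frac{a_0^{w(g)}}{b_0^{w(f)}}\cdot\frac{\prod_{i=1}^\infty\prod_{j=1}^\infty\left(1-a_i^{j/(i,j)}b_{-j}^{i/(i,j)}\right)^{(i,j)}}{\prod_{i=1}^\infty\prod_{j=1}^\infty\left(1-a_{-i}^{j/(i,j)}b_j^{i/(i,j)}\right)^{(i,j)}}\in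 k^\times,$$ where $(i,j)$ is the greatest common divisor; all but finitely many factors equal $1$. *)

(* Defs.v *)
(* MathComp, with the classical sets and finitely supported sums of
   MathComp-Analysis. *)
From HB Require Import structures.
From mathcomp Require Import all_boot all_order all_algebra qpoly finmap.
From mathcomp Require Import zify boolp classical_sets cardinality fsbigop.

Set Implicit Arguments.
Unset Strict Implicit.
Unset Printing Implicit Defensive.

Import Order.TTheory GRing.Theory Num.Theory.
Local Open Scope ring_scope.
Local Open Scope classical_set_scope.

(* A[eps]/(eps^(N+1)); the class of eps is 'qX. *)
Notation trunc N A := {poly %/ ('X^(N.+1) : {poly A})}.

Section TruncatedPolynomials.
Variables (A : comNzRingType) (N : nat).
Implicit Types u v : trunc N A.

Lemma size_trunc u : (size (polyn u) <= N.+1)%N.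
Proof.
apply: leq_trans (valP u : is_true (size _ <= _)%N) _.
by rewrite mk_monic_Xn size_polyXn.
Qed.

Lemma in_qpoly_take (p : {poly A}) :
  polyn (in_qpoly 'X^(N.+1) p) = take_poly N.+1 p.
Proof. by rewrite /= mk_monic_Xn Pdiv.RingMonic.take_poly_rmodp. Qed.

Lemma eq_trunc (p q : {poly A}) :
  (forall i, (i <= N)%N -> p`_i = q`_i) <->
  in_qpoly 'X^(N.+1) p = in_qpoly 'X^(N.+1) q.
Proof.
split=> [pq|/(congr1 (@polyn _ _))].
  apply: val_inj; rewrite /= !mk_monic_Xn -!Pdiv.RingMonic.take_poly_rmodp.
  by apply/polyP=> i; rewrite !coef_take_poly ltnS; case: leqP => // /pq.
rewrite !in_qpoly_take => /polyP pq i iN.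
by have := pq i; rewrite !coef_take_poly ltnS iN.
Qed.

Lemma in_qpolyK u : in_qpoly 'X^(N.+1) (polyn u) = u.
Proof.
by apply: val_inj; apply: etrans (in_qpoly_take _) _; rewrite take_poly_id // size_trunc.
Qed.

Lemma coef0_truncM u v :
  (polyn (u * v))`_0 = (polyn u)`_0 * (polyn v)`_0.
Proof.
rewrite [polyn _]in_qpoly_take coef_take_poly /= coefM.
by rewrite big_ord_recl big_ord0 addr0.
Qed.

Lemma coef0_trunc1 : (polyn (1 : trunc N A))`_0 = 1.
Proof. by rewrite /= coefC. Qed.

Lemma trunc_nilp (w : trunc N A) : (polyn w)`_0 = 0 -> w ^+ N.+1 = 0.
Proof.
move=> w0; rewrite -[w]in_qpolyK -rmorphXn /=.
suff -> : polyn w = drop_poly 1 (polyn w) * 'X.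
  rewrite exprMn; apply: val_inj; apply: etrans (in_qpoly_take _) _.
  by rewrite take_polyMXn_0.
rewrite -[LHS](poly_take_drop 1) expr1.
suff -> : take_poly 1 (polyn w) = 0 by rewrite add0r.
by apply/polyP=> -[|i]; rewrite coef_take_poly coef0 //= w0.
Qed.

Lemma trunc_inv u : (polyn u)`_0 = 1 ->
  exists2 v, (polyn v)`_0 = 1 & v * u = 1.
Proof.
move=> u0; have [w wE] : exists w, w = 1 - u by exists (1 - u).
have w0 : (polyn w)`_0 = 0 by rewrite wE /= coefB coefC u0 subrr.
exists (\sum_(i < N.+1) w ^+ i).
  rewrite poly_of_qpoly_sum coef_sum big_ord_recl coef0_trunc1 big1 ?addr0 // => i _.
  by rewrite [w ^+ _]exprS coef0_truncM w0 mul0r.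
have := subrX1 w N.+1; rewrite trunc_nilp // sub0r.
have -> : w - 1 = - u by rewrite wE addrC addKr.
by rewrite mulNr => /oppr_inj ->; rewrite mulrC.
Qed.

End TruncatedPolynomials.

(* The vector (x_1, ..., x_N) has x_(i+1) as its value at i : 'I_N. *)
Record witt (N : nat) (A : Type) := Witt { witt_val :> {ffun 'I_N -> A} }.

HB.instance Definition _ (N : nat) (A : Type) := [isNew for @witt_val N A].
HB.instance Definition _ (N : nat) (A : choiceType) :=
  [Choice of witt N A by <:].

Section WittVectors.
Variables (N : nat) (A : comNzRingType).
Implicit Types x y z : witt N A.

(* The addition of vectors is the one making witt_exp an isomorphism onto the
   group of elements congruent to 1 mod eps. *)
Definition witt_exp x : trunc N A :=
  \prod_(i < N) (1 - x i *: 'qX ^+ i.+1).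

Fixpoint witt_trunc (p : {poly A}) (n : nat) : {poly A} :=
  if n is n'.+1 then
    witt_trunc p n' * (1 - (witt_trunc p n' - p)`_n *: 'X^n)
  else 1.

(* The inverse of witt_exp on the u congruent to 1 mod eps: the (n+1)-st
   coordinate is the coefficient of eps^(n+1) in
   prod_(i <= n) (1 - x_i eps^i) - u. *)
Definition witt_log (u : trunc N A) : witt N A :=
  Witt [ffun i : 'I_N => (witt_trunc (polyn u) i - polyn u)`_i.+1].

Lemma coef_mul_1subXn (p : {poly A}) (c : A) n j :
  (p * (1 - c *: 'X^(n.+1)))`_j =
  p`_j - (if (j <= n)%N then 0 else c * p`_(j - n.+1)).
Proof.
rewrite mulrBr mulr1 coefB -scalerAr coefZ coefMXn ltnS.
by case: leqP; rewrite ?mulr0.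
Qed.

Lemma coef0_witt_trunc p n : (witt_trunc p n)`_0 = 1.
Proof.
elim: n => [|n IH]; first by rewrite coefC.
by rewrite coef_mul_1subXn subr0.
Qed.

Lemma coef_witt_trunc (p : {poly A}) n j :
  p`_0 = 1 -> (j <= n)%N -> (witt_trunc p n)`_j = p`_j.
Proof.
move=> p0; elim: n j => [|n IH] j; first by rewrite leqn0 => /eqP->; rewrite coefC.
rewrite leq_eqVlt coef_mul_1subXn => /orP[/eqP->|].
  by rewrite ltnn subnn coef0_witt_trunc mulr1 coefB opprB addrC subrK.
by rewrite ltnS => jn; rewrite jn subr0 IH.
Qed.

Definition witt_poly (a : nat -> A) (n : nat) : {poly A} :=
  \prod_(i < n) (1 - a i *: 'X^(i.+1)).

Lemma coef0_witt_poly a n : (witt_poly a n)`_0 = 1.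
Proof.
elim: n => [|n IH]; first by rewrite /witt_poly big_ord0 coefC.
by rewrite /witt_poly big_ord_recr coef_mul_1subXn subr0.
Qed.

Lemma coef_witt_poly a n m j :
  (j <= n <= m)%N -> (witt_poly a m)`_j = (witt_poly a n)`_j.
Proof.
case/andP=> jn; elim: m => [|m IH]; first by rewrite leqn0 => /eqP->.
rewrite leq_eqVlt => /orP[/eqP<-//|]; rewrite ltnS => nm.
by rewrite [in LHS]/witt_poly big_ord_recr coef_mul_1subXn (leq_trans jn nm) subr0 -IH.
Qed.

Lemma witt_exp_poly x (a : nat -> A) : (forall i : 'I_N, a i = x i) ->
  witt_exp x = in_qpoly 'X^(N.+1) (witt_poly a N).
Proof.
move=> ax; rewrite rmorph_prod; apply: eq_bigr => i _.
rewrite rmorphB rmorph1 -rmorphXn -ax; congr (1 - _); exact/esym/in_qpolyZ.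
Qed.

Lemma witt_ext x : exists a : nat -> A, forall i : 'I_N, a i = x i.
Proof.
exists (fun n => if insub n is Some i then x i else 0) => i.
by rewrite valK.
Qed.

Lemma coef0_witt_exp x : (polyn (witt_exp x))`_0 = 1.
Proof.
have [a ax] := witt_ext x; rewrite (witt_exp_poly ax) in_qpoly_take.
by rewrite coef_take_poly coef0_witt_poly.
Qed.

Lemma witt_logK (u : trunc N A) : (polyn u)`_0 = 1 -> witt_exp (witt_log u) = u.
Proof.
move=> u0; rewrite (@witt_exp_poly _ (fun i => (witt_trunc (polyn u) i - polyn u)`_i.+1)).
  rewrite -[RHS]in_qpolyK; apply/eq_trunc => i iN.
  rewrite -(coef_witt_trunc u0 iN); congr ((_ : {poly A})`_i).
  move: (polyn u) => p; elim: N => [|n IH]; first by rewrite /witt_poly big_ord0.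
  by rewrite /witt_poly big_ord_recr /= -IH.
by move=> i; rewrite ffunE.
Qed.

Lemma witt_expK : cancel witt_exp witt_log.
Proof.
move=> x; have [a ax] := witt_ext x; rewrite (witt_exp_poly ax).
set u := in_qpoly _ _.
have uE j : (j <= N)%N -> (polyn u)`_j = (witt_poly a N)`_j.
  by move=> jN; rewrite in_qpoly_take coef_take_poly ltnS jN.
have aE n : (n < N)%N -> witt_trunc (polyn u) n = witt_poly a n ->
    (witt_trunc (polyn u) n - polyn u)`_n.+1 = a n.
  move=> nN ->; rewrite coefB uE // (@coef_witt_poly a n.+1) ?leqnn //.
  rewrite [in X in _ - X]/witt_poly big_ord_recr coef_mul_1subXn ltnn subnn.
  by rewrite -[\prod_(i < n) _]/(witt_poly a n) coef0_witt_poly mulr1 subKr.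
have E n : (n <= N)%N -> witt_trunc (polyn u) n = witt_poly a n.
  elim: n => [_|n IH nN]; first by rewrite /witt_poly big_ord0.
  by rewrite /witt_poly big_ord_recr /= aE ?IH // ltnW.
apply: val_inj; apply/ffunP => i; rewrite ffunE aE ?ax //.
by apply: E; apply: ltnW.
Qed.

Lemma witt_exp_inj : injective witt_exp.
Proof. exact: can_inj witt_expK. Qed.

Definition witt_zero : witt N A := Witt [ffun=> 0].
Definition witt_add x y : witt N A := witt_log (witt_exp x * witt_exp y).
Definition witt_opp x : witt N A :=
  witt_log (xget 1 [set u : trunc N A | u * witt_exp x = 1]).

Lemma witt_exp0 : witt_exp witt_zero = 1.
Proof. by rewrite /witt_exp big1 // => i _; rewrite ffunE scale0r subr0. Qed.

Lemma witt_expD x y : witt_exp (witt_add x y) = witt_exp x * witt_exp y.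
Proof. by apply: witt_logK; rewrite coef0_truncM !coef0_witt_exp mulr1. Qed.

Lemma witt_expN x : witt_exp (witt_opp x) * witt_exp x = 1.
Proof.
have [v _ vx] := trunc_inv (coef0_witt_exp x); rewrite /witt_opp.
case: xgetP => [u _ ux|/(_ v)]; last by rewrite /= vx.
rewrite witt_logK //; have := congr1 (fun z : trunc N A => (polyn z)`_0) ux.
by rewrite coef0_truncM coef0_witt_exp mulr1 coef0_trunc1.
Qed.

Lemma witt_addA : associative witt_add.
Proof. by move=> x y z; apply: witt_exp_inj; rewrite !witt_expD mulrA. Qed.
Lemma witt_addC : commutative witt_add.
Proof. by move=> x y; apply: witt_exp_inj; rewrite !witt_expD mulrC. Qed.
Lemma witt_add0 : left_id witt_zero witt_add.
Proof. by move=> x; apply: witt_exp_inj; rewrite witt_expD witt_exp0 mul1r. Qed.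
Lemma witt_addN : left_inverse witt_zero witt_opp witt_add.
Proof. by move=> x; apply: witt_exp_inj; rewrite witt_expD witt_expN witt_exp0. Qed.

HB.instance Definition _ := GRing.isZmodule.Build (witt N A)
  witt_addA witt_addC witt_add0 witt_addN.

End WittVectors.

(* A((t)): the coefficient families vanishing in all sufficiently negative
   degrees, with the convolution product. *)
Record laurent (A : nzRingType) := Laurent {
  lcoef :> int -> A;
  laurent_bounded : exists m : int, forall i, i < m -> lcoef i = 0
}.

HB.instance Definition _ (A : nzRingType) := gen_eqMixin (laurent A).
HB.instance Definition _ (A : nzRingType) := gen_choiceMixin (laurent A).

Section LaurentZmodule.
Variable A : nzRingType.
Implicit Types f g h : laurent A.

Lemma laurentP f g : f =1 g -> f = g.
Proof.
case: f g => [f fb] [g gb] /= /funext fg; case: g / fg gb => gb.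
by congr Laurent; exact: Prop_irrelevance.
Qed.

Definition vanish_below (m : int) (f : int -> A) := forall i, i < m -> f i = 0.

Lemma vanish_belowW m m' (f : int -> A) :
  m' <= m -> vanish_below m f -> vanish_below m' f.
Proof. by move=> mm fm i im; apply: fm; apply: lt_le_trans im mm. Qed.

Lemma vanish_below2 f g : exists m, vanish_below m f /\ vanish_below m g.
Proof.
have [[m fm] [p gp]] := (laurent_bounded f, laurent_bounded g).
by exists (Num.min m p); split; [apply: vanish_belowW fm|apply: vanish_belowW gp];
  rewrite ge_min lexx ?orbT.
Qed.

Lemma monomial_bounded (a : A) (n : int) :
  exists m : int, vanish_below m (fun i => if i == n then a else 0).
Proof. by exists n => i; case: ltgtP. Qed.
(* a t^n *)
Definition monomial (a : A) (n : int) : laurent A :=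
  Laurent (monomial_bounded a n).

Definition laurent_zero : laurent A := monomial 0 0.

Lemma laurent_add_bounded f g : exists m, vanish_below m (fun i => f i + g i).
Proof.
by have [m [fm gm]] := vanish_below2 f g; exists m => i im; rewrite fm ?gm ?addr0.
Qed.
Definition laurent_add f g : laurent A := Laurent (laurent_add_bounded f g).

Lemma laurent_opp_bounded f : exists m, vanish_below m (fun i => - f i).
Proof. by have [m fm] := laurent_bounded f; exists m => i /fm ->; rewrite oppr0. Qed.
Definition laurent_opp f : laurent A := Laurent (laurent_opp_bounded f).

Lemma laurent_addA : associative laurent_add.
Proof. by move=> f g h; apply: laurentP => i /=; rewrite addrA. Qed.
Lemma laurent_addC : commutative laurent_add.
Proof. by move=> f g; apply: laurentP => i /=; rewrite addrC. Qed.
Lemma laurent_add0 : left_id laurent_zero laurent_add.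
Proof. by move=> f; apply: laurentP => i /=; rewrite if_same add0r. Qed.
Lemma laurent_addN : left_inverse laurent_zero laurent_opp laurent_add.
Proof. by move=> f; apply: laurentP => i /=; rewrite if_same addNr. Qed.

HB.instance Definition _ := GRing.isZmodule.Build (laurent A)
  laurent_addA laurent_addC laurent_add0 laurent_addN.

End LaurentZmodule.

Section LaurentRing.
Variable A : comNzRingType.
Implicit Types f g h : laurent A.

Definition convolution (f g : int -> A) (n : int) : A :=
  \sum_(i \in [set: int]) f i * g (n - i).

Definition window (m : int) (L : nat) (f : int -> A) : {poly A} :=
  \poly_(j < L) f (m + j%:Z).

Lemma convolutionE m p (f g : int -> A) (j : nat) :
  vanish_below m f -> vanish_below p g ->
  convolution f g (m + p + j%:Z) =
  \sum_(i < j.+1) f (m + i%:Z) * g (p + (j - i)%:Z).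
Proof.
move=> fm gp; pose r := [seq m + i%:Z | i <- iota 0 j.+1].
have ur : uniq r.
  by rewrite map_inj_uniq ?iota_uniq // => a b /addrI [].
rewrite /convolution (fsbigE r) //; last first.
  move=> i _; case: (ltP i m) => [/fm->|mi]; first by rewrite mul0r.
  case: (ltP (m + p + j%:Z - i) p) => [/gp->|pi ir]; first by rewrite mulr0.
  case/mapP: ir; exists `|i - m|%N; last by lia.
  by rewrite mem_iota; lia.
rewrite big_map big_mkcond -(big_mkord xpredT (fun i => f (m + i%:Z) * g (p + (j - i)%:Z))).
rewrite /index_iota subn0; apply: eq_big_seq => i; rewrite mem_iota => ij.
by rewrite mem_set //; congr (_ * g _); lia.
Qed.

Lemma convolution_vanish m p (f g : int -> A) :
  vanish_below m f -> vanish_below p g -> vanish_below (m + p) (convolution f g).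
Proof.
move=> fm gp n np; rewrite /convolution fsbig1 // => i _.
case: (ltP i m) => [/fm->|mi]; first by rewrite mul0r.
by rewrite gp ?mulr0 //; lia.
Qed.

Lemma laurent_mul_bounded f g : exists m, vanish_below m (convolution f g).
Proof.
have [[m fm] [p gp]] := (laurent_bounded f, laurent_bounded g).
by exists (m + p); apply: convolution_vanish.
Qed.
Definition laurent_mul f g : laurent A := Laurent (laurent_mul_bounded f g).

Lemma convolution_window m p (f g : int -> A) (L j : nat) :
  vanish_below m f -> vanish_below p g -> (j < L)%N ->
  convolution f g (m + p + j%:Z) = (window m L f * window p L g)`_j.
Proof.
move=> fm gp jL; rewrite convolutionE // coefM; apply: eq_bigr => i _.
rewrite !coef_poly (leq_ltn_trans _ jL) ?(leq_ltn_trans _ jL) ?leq_subr //.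
by rewrite -ltnS.
Qed.

Lemma eq_vanish_below m (f g : int -> A) :
  vanish_below m f -> vanish_below m g ->
  (forall j : nat, f (m + j%:Z) = g (m + j%:Z)) -> f =1 g.
Proof.
move=> fm gm fg i; case: (ltP i m) => [im|mi]; first by rewrite fm ?gm.
have -> : i = m + `|i - m|%N%:Z by lia.
exact: fg.
Qed.

Lemma window_convolution m p (f g : int -> A) L i :
  vanish_below m f -> vanish_below p g -> (i < L)%N ->
  (window (m + p) L (convolution f g))`_i = (window m L f * window p L g)`_i.
Proof. by move=> fm gp iL; rewrite coef_poly iL (@convolution_window _ _ _ _ L). Qed.

Lemma laurent_mulC : commutative laurent_mul.
Proof.
move=> f g; have [[m fm] [p gp]] := (laurent_bounded f, laurent_bounded g).
apply: laurentP; apply: (@eq_vanish_below (m + p)) => [||j].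
- exact: convolution_vanish.
- by rewrite addrC; apply: convolution_vanish.
- by rewrite /= (@convolution_window m p _ _ j.+1) // mulrC [m + p]addrC
             (@convolution_window p m _ _ j.+1).
Qed.

Lemma laurent_mulA : associative laurent_mul.
Proof.
move=> f g h; have [m fm] := laurent_bounded f.
have [[p gp] [q hq]] := (laurent_bounded g, laurent_bounded h).
apply: laurentP; apply: (@eq_vanish_below (m + (p + q))) => [||j].
- by apply: convolution_vanish => //; apply: convolution_vanish.
- by rewrite addrA; apply: convolution_vanish => //; apply: convolution_vanish.
- rewrite /= (@convolution_window _ _ _ _ j.+1) //; last exact: convolution_vanish.
  rewrite addrA (@convolution_window _ _ _ _ j.+1) //; last exact: convolution_vanish.
  set wf := window m _ _; set wg := window p j.+1 g; set wh := window q j.+1 h.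
  transitivity ((wf * (wg * wh))`_j).
    rewrite !coefM; apply: eq_bigr => i _; congr (_ * _).
    by rewrite window_convolution // ltnS leq_subr.
  rewrite mulrA !coefM; apply: eq_bigr => i _; congr (_ * _).
  by rewrite window_convolution.
Qed.

Lemma laurent_mul1 : left_id (monomial 1 0) laurent_mul.
Proof.
move=> f; have [m fm] := laurent_bounded f.
have om : vanish_below 0 (monomial (1 : A) 0) by move=> i /=; case: ltgtP.
apply: laurentP; apply: (@eq_vanish_below m) => [||j] //.
  by rewrite -[m]add0r; apply: convolution_vanish.
rewrite /= -{1}[m]add0r convolutionE // big_ord_recl /= mul1r subn0.
by rewrite big1 ?addr0 // => i _; rewrite mul0r.
Qed.

Lemma laurent_mulD : left_distributive laurent_mul +%R.
Proof.
move=> f g h; have [m [fm gm]] := vanish_below2 f g.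
have [p hp] := laurent_bounded h.
have fgm : vanish_below m (f + g) by move=> i im /=; rewrite fm ?gm ?addr0.
have fgE i : (f + g : laurent A) i = f i + g i by [].
apply: laurentP; apply: (@eq_vanish_below (m + p)) => [||j].
- exact: convolution_vanish.
- move=> i im /=; rewrite (convolution_vanish fm hp im).
  by rewrite (convolution_vanish gm hp im) addr0.
- rewrite /= !convolutionE // -big_split /=; apply: eq_bigr => i _.
  by rewrite mulrDl.
Qed.

Lemma laurent_nontrivial : monomial (1 : A) 0 != 0.
Proof.
apply/eqP => /(congr1 (fun f : laurent A => f 0)) /= /eqP.
by rewrite oner_eq0.
Qed.

HB.instance Definition _ := GRing.Zmodule_isComNzRing.Build (laurent A)
  laurent_mulA laurent_mulC laurent_mul1 laurent_mulD laurent_nontrivial.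

End LaurentRing.

Lemma map_laurent_bounded (A B : nzRingType) (phi : {rmorphism A -> B})
  (f : laurent A) : exists m, vanish_below m (fun i => phi (f i)).
Proof. by have [m fm] := laurent_bounded f; exists m => i /fm ->; rewrite rmorph0. Qed.

Definition map_laurent (A B : nzRingType) (phi : {rmorphism A -> B})
  (f : laurent A) : laurent B := Laurent (map_laurent_bounded phi f).

(* In this section k stands for an artinian local ring, whose maximal ideal is
   the set of nonunits. *)
Section ContouCarrereSymbol.
Variable k : comUnitRingType.
Implicit Types (f g : laurent k) (w : int) (a b : int -> k).

Definition params_prod w a (n : nat) : laurent k :=
  monomial 1 w * monomial (a 0) 0
  * (\prod_(1 <= i < n.+1) (1 - monomial (a (- i%:Z)) (- i%:Z)))
  * (\prod_(1 <= i < n.+1) (1 - monomial (a i%:Z) i%:Z)).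

(* The infinite product is the coefficientwise limit of its partial products,
   k being discrete. *)
Definition is_witt_params f (wa : int * (int -> k)) :=
  let: (w, a) := wa in
  [/\ a 0 \is a GRing.unit,
      forall i : int, i < 0 -> a i \isn't a GRing.unit,
      exists m : int, forall i, i < m -> a i = 0
    & forall j : int, exists n0 : nat, forall n : nat,
        (n0 <= n)%N -> params_prod w a n j = f j].

(* The default value is relevant only for f not invertible in k((t)). *)
Definition witt_params f : int * (int -> k) :=
  xget (0, fun=> 0) [set wa | is_witt_params f wa].

Definition cross_product a b : k :=
  \big[*%R/1]_(ij \in [set ij : nat * nat | (0 < ij.1)%N && (0 < ij.2)%N])
    (1 - a ij.1%:Z ^+ (ij.2 %/ gcdn ij.1 ij.2)
         * b (- ij.2%:Z) ^+ (ij.1 %/ gcdn ij.1 ij.2)) ^+ gcdn ij.1 ij.2.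

(* The denominator of the defining formula is its numerator with the roles of
   a and b, and of i and j, exchanged. *)
Definition contou_carrere f g : k :=
  let: (wf, a) := witt_params f in
  let: (wg, b) := witt_params g in
  (-1) ^ (wf * wg) * (a 0 ^ wg / b 0 ^ wf) * (cross_product a b / cross_product b a).

End ContouCarrereSymbol.

Section WittResidue.
Variables (F : fieldType) (N : nat).

Definition laurent_lift : laurent F -> laurent (trunc N F) :=
  map_laurent (qpolyC ('X^(N.+1) : {poly F})).

(* prod_i (1 - x_i eps^i), read in F[eps]/(eps^(N+1))((t)) *)
Definition witt_exp_laurent (x : witt N (laurent F)) : laurent (trunc N F) :=
  \prod_(i < N) (1 - laurent_lift (x i) * monomial ('qX ^+ i.+1) 0).

(* The symbol is congruent to 1 mod eps, so that witt_log inverts the defining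
   relation <f, prod_i (1 - x_i eps^i)> = prod_i (1 - r_i eps^i). *)
Definition witt_residue (f : laurent F) (x : witt N (laurent F)) : witt N F :=
  witt_log (contou_carrere (laurent_lift f) (witt_exp_laurent x)).

End WittResidue.

Section LocalRings.
Variables (F K : fieldType) (iota : {rmorphism F -> K}).
Implicit Types A J L M V : set K.

Definition subalgebra A :=
  [/\ range iota `<=` A,
      forall f g, A f -> A g -> A (f - g)
    & forall f g, A f -> A g -> A (f * g)].

(* F[f_1, ..., f_n] *)
Definition generated_algebra (gens : seq K) : set K :=
  smallest subalgebra [set` gens].

Definition ideal A J :=
  [/\ J `<=` A, J 0,
      forall f g, J f -> J g -> J (f + g)
    & forall f g, A f -> J g -> J (f * g)].

Definition maximal_ideal A M :=
  [/\ ideal A M, ~ M 1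
    & forall J, ideal A J -> ~ J 1 -> M `<=` J -> J = M].

Definition localization A M : set K :=
  [set h | exists f g, [/\ A f, A g, ~ M g & h = f / g]].

Definition has_fraction_field A :=
  forall h : K, exists f g, [/\ A f, A g, g != 0 & h = f / g].

Definition nonunits L : set K := [set f | L f /\ ~ exists2 g, L g & f * g = 1].

Definition valuation_ring V := subalgebra V /\ forall f : K, V f \/ V f^-1.

Definition dominates V L := L `<=` V /\ nonunits L `<=` nonunits V.

Definition trdeg1 :=
  exists2 x : K, ~ algebraicOver iota x
    & forall y : K, exists2 P : {poly {poly F}}, P != 0
        & root (map_poly (fun c : {poly F} => (map_poly iota c).[x]) P) y.

End LocalRings.

(* Irreducible curves over F, as abstract varieties in the sense of Chevalley
   and Zariski: a variety is given by its function field and the local rings of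
   its closed points inside it.  The local rings are those of finitely many
   affine varieties with this function field, glued into a separated variety:
   a valuation ring has at most one center. *)
Record curve (F : fieldType) := Curve {
  function_field : fieldType;
  constants : {rmorphism F -> function_field};
  closed_point :> choiceType;
  local_ring : closed_point -> set function_field;
  curve_dim1 : trdeg1 constants;
  curve_affine_cover : exists2 charts : seq (seq function_field),
    forall gens, gens \in charts ->
      has_fraction_field (generated_algebra constants gens)
    & range local_ring = \bigcup_(gens in [set` charts])
        [set localization (generated_algebra constants gens) M
          | M in maximal_ideal (generated_algebra constants gens)];
  curve_separated : forall (V : set function_field) (x y : closed_point),
    valuation_ring constants V ->
    dominates V (local_ring x) -> dominates V (local_ring y) -> x = y
}.

Section Curves.
Variables (F : fieldType) (X : curve F).
Local Notation K := (function_field X).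

Definition complete := forall V : set K,
  valuation_ring (constants X) V -> V <> setT ->
  exists x : X, dominates V (local_ring x).

Definition uniformizer (x : X) (pi : K) :=
  nonunits (local_ring x) = [set pi * g | g in local_ring x].

(* A local ring of dimension 1 is regular iff its maximal ideal is generated by
   one element. *)
Definition nonsingular := forall x : X, exists pi : K, uniformizer x pi.

(* H^0(X \ S, O_X) *)
Definition regular_away (S : {fset X}) : set K :=
  [set f | forall x : X, x \notin S -> local_ring x f].

(* f = sum_i a_i pi^i, in the topology of the local ring at x *)
Definition laurent_expansion (x : X) (pi f : K) (a : laurent F) :=
  forall n : int, exists2 g, local_ring x g
    & f - \sum_(i \in [set i : int | i < n]) constants X (a i) * pi ^ i
      = pi ^ n * g.

Definition laurent_image (S : {fset X}) (pi : S -> K) : set (S -> laurent F) :=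
  [set a | exists2 f, regular_away S f
     & forall s : S, laurent_expansion (val s) (pi s) f (a s)].

End Curves.

Definition ring_units (I : Type) (A : comNzRingType) (R0 : set (I -> A)) :
    set (I -> A) :=
  [set f | R0 f /\ exists2 g, R0 g & forall s, f s * g s = 1].

(* Main.v *)
From HB Require Import structures.
Require Import Defs.
From mathcomp Require Import all_boot all_order all_algebra qpoly polyXY finmap.
From mathcomp Require Import zify ring boolp classical_sets cardinality fsbigop.
Set Implicit Arguments.
Unset Strict Implicit.
Unset Printing Implicit Defensive.
Import Order.TTheory GRing.Theory Num.Theory.
Local Open Scope ring_scope.
Local Open Scope classical_set_scope.

(** Under the isomorphism between Witt vectors and truncated series, the theorem
    says that for k = F[eps]/(eps^(N+1)) the product over s in S of the
    Contou-Carrere symbols of f and g = prod (1 - x_i eps^i) is 1. This is a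
    Weil reciprocity law with coefficients in k, and the proof follows the
    classical one through norms to the projective line.

    The symbol is multiplicative in g (symbolM). By induction on powers of eps
    (reciprocity) the general case follows from that of g = 1 - delta x, where
    delta is a power of eps and x a function in R, the ring of functions regular
    away from S, with a pole at every place under consideration. These are the
    places at which R has poles; at the others the symbol is trivial
    (symbol_regular, curve_reciprocity).

    Such an x is a map to the projective line with S over infinity, and X = 1/x
    is a coordinate at infinity. The zeros of 1 - delta x lie infinitely near to
    infinity, at X = delta. Accordingly, let d_s in F((X)) be the determinant of
    the multiplication by f on the completion at s, a vector space over F((X)):
    the symbol of f and 1 - delta x at s is the quotient of d_s by its term of
    lowest degree, evaluated at X = delta (local_symbol). This comes from two
    computations. When f has coefficients in F, the symbol of f and g is, up to
    a power of the Witt parameter b_0 of g, the product of the values, at the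
    zeros of f, of the polynomial in 1/t that occurs in the Witt presentation of
    g (contou_carrere_triang). When g = 1 - delta x, this polynomial is the
    reversed characteristic polynomial of t over F[[X]], specialized at X =
    delta (weierstrass_triang).

    The product over s of the local determinants is the norm of f for the map x
    (adapted_det). It can be computed in a basis of R over F[x], chosen so that
    it is also a basis at infinity up to powers of x (R_basis); as f is a unit
    of R, its norm is a unit of F[x], that is, a constant, and in such a basis
    the determinant of f is a monomial c X^a (R_unit_det). A monomial is its own
    term of lowest degree, so the symbols have product 1 (symbol_product).

    That Laurent expansion is an embedding of the function field into F((t))
    with the expected local rings has to be derived from the description of the
    curve by local rings. It rests on transcendence degree one: every function
    is algebraic over F(pi) for a uniformizer pi, which bounds orders and shows
    that the residue field is F (place_exists). *)

(** * Laurent series *)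

Arguments lcoef {A} _ _ : simpl never.

Section LaurentBasics.
Variable A : comNzRingType.
Implicit Types f g h : laurent A.

Lemma lcoefD f g i : (f + g) i = f i + g i. Proof. by []. Qed.
Lemma lcoefN f i : (- f) i = - f i. Proof. by []. Qed.
Lemma lcoefB f g i : (f - g) i = f i - g i. Proof. by []. Qed.
Lemma lcoef0 i : (0 : laurent A) i = 0.
Proof. exact: if_same. Qed.
Lemma lcoef_sum I (r : seq I) (P : pred I) (E : I -> laurent A) i :
  (\sum_(j <- r | P j) E j) i = \sum_(j <- r | P j) E j i.
Proof. exact: (big_morph (fun f : laurent A => f i) (fun f g => lcoefD f g i) (lcoef0 i)). Qed.

Lemma lcoef_monomialE (a : A) n i : monomial a n i = if i == n then a else 0.
Proof. by []. Qed.

Lemma vanish_below0 m : vanish_below m (0 : laurent A).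
Proof. by move=> i _; rewrite lcoef0. Qed.
Lemma vanish_belowD m f g : vanish_below m f -> vanish_below m g -> vanish_below m (f + g).
Proof. by move=> fm gm i im; rewrite lcoefD fm ?gm ?addr0. Qed.
Lemma vanish_belowN m f : vanish_below m f -> vanish_below m (- f).
Proof. by move=> fm i im; rewrite lcoefN fm ?oppr0. Qed.
Lemma vanish_belowB m f g : vanish_below m f -> vanish_below m g -> vanish_below m (f - g).
Proof. by move=> fm gm; apply: vanish_belowD => //; apply: vanish_belowN. Qed.
Lemma vanish_below_sum m I (r : seq I) (P : pred I) (E : I -> laurent A) :
  (forall j, P j -> vanish_below m (E j)) -> vanish_below m (\sum_(j <- r | P j) E j).
Proof.
by move=> Em; elim/big_rec: _ => [|j f Pj fm]; [apply: vanish_below0|apply: vanish_belowD; auto].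
Qed.
Lemma vanish_below_monomial (a : A) n m : (a != 0 -> m <= n) -> vanish_below m (monomial a n).
Proof.
move=> an i im; rewrite lcoef_monomialE; case: eqP => // e; apply/eqP; apply/negPn/negP => /an; lia.
Qed.
Lemma vanish_belowM m p f g : vanish_below m f -> vanish_below p g -> vanish_below (m + p) (f * g).
Proof. exact: convolution_vanish. Qed.
Lemma vanish_belowM0 f g : vanish_below 0 f -> vanish_below 0 g -> vanish_below 0 (f * g).
Proof. by move=> f0 g0; rewrite -[0]addr0; apply: vanish_belowM. Qed.
Lemma vanish_below1 : vanish_below 0 (1 : laurent A).
Proof. by apply: vanish_below_monomial. Qed.
Lemma vanish_belowX m f n : vanish_below m f -> vanish_below (m *+ n) (f ^+ n).
Proof.
move=> fm; elim: n => [|n IH]; first by rewrite expr0; apply: vanish_below1.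
by rewrite exprS mulrS; apply: vanish_belowM.
Qed.

Lemma lcoefM f g m p (j : nat) : vanish_below m f -> vanish_below p g ->
  (f * g) (m + p + j%:Z) = \sum_(i < j.+1) f (m + i%:Z) * g (p + (j - i)%:Z).
Proof. exact: convolutionE. Qed.

Lemma lcoefM_lead f g m p : vanish_below m f -> vanish_below p g -> (f * g) (m + p) = f m * g p.
Proof.
move=> fm gp; have := lcoefM 0 fm gp.
by rewrite big_ord1 /= subnn !addr0.
Qed.

Lemma lcoef_monomialM (a : A) n f i : (monomial a n * f) i = a * f (i - n).
Proof.
have [m fm] := laurent_bounded f.
have am : vanish_below n (monomial a n) by apply: vanish_below_monomial.
case: (ltP i (n + m)) => im.
  by rewrite (vanish_belowM am fm) // fm ?mulr0 //; lia.
have [j ->] : exists j : nat, i = n + m + j%:Z by exists `|i - (n + m)%R|%N; lia.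
rewrite lcoefM // big_ord_recl /= addr0 lcoef_monomialE eqxx subn0 big1 ?addr0.
  by congr (_ * f _); lia.
move=> l _; rewrite lcoef_monomialE; case: eqP => [|_]; last by rewrite mul0r.
by rewrite /bump; lia.
Qed.

Lemma monomialM (a b : A) n m : monomial a n * monomial b m = monomial (a * b) (n + m).
Proof.
apply: laurentP => i; rewrite lcoef_monomialM !lcoef_monomialE.
have -> : (i - n == m) = (i == n + m) by lia.
by case: ifP; rewrite ?mulr0.
Qed.
Lemma monomial1E : monomial 1 0 = 1 :> laurent A. Proof. by []. Qed.
Lemma monomial0 n : monomial 0 n = 0 :> laurent A.
Proof. by apply: laurentP => i; rewrite lcoef_monomialE lcoef0 if_same. Qed.
Lemma monomialX (a : A) n k : monomial a n ^+ k = monomial (a ^+ k) (n *+ k).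
Proof.
elim: k => [|k IH]; first by rewrite !expr0 mulr0n.
by rewrite !exprS IH monomialM mulrS.
Qed.

Definition lcst (a : A) : laurent A := monomial a 0.
Lemma lcst_is_zmod_morphism : zmod_morphism lcst.
Proof. by move=> a b; apply: laurentP => i; rewrite lcoefB !lcoef_monomialE; case: ifP; rewrite ?subr0. Qed.
Lemma lcst_is_monoid_morphism : monoid_morphism lcst.
Proof. by split=> // a b; rewrite /lcst monomialM addr0. Qed.
HB.instance Definition _ := GRing.isZmodMorphism.Build A (laurent A) lcst lcst_is_zmod_morphism.
HB.instance Definition _ := GRing.isMonoidMorphism.Build A (laurent A) lcst lcst_is_monoid_morphism.

Lemma lcoef_cstM (a : A) f i : (lcst a * f) i = a * f i.
Proof. by rewrite lcoef_monomialM subr0. Qed.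

Definition tpow (n : int) : laurent A := monomial 1 n.
Lemma tpowD m n : tpow m * tpow n = tpow (m + n).
Proof. by rewrite /tpow monomialM mulr1. Qed.
Lemma tpow0 : tpow 0 = 1. Proof. by []. Qed.
Lemma tpowX n k : tpow n ^+ k = tpow (n *+ k).
Proof. by rewrite /tpow monomialX expr1n. Qed.
Lemma lcoef_tpowM n f i : (tpow n * f) i = f (i - n).
Proof. by rewrite lcoef_monomialM mul1r. Qed.
Lemma monomialE (a : A) n : monomial a n = lcst a * tpow n.
Proof. by rewrite /lcst monomialM mulr1 add0r. Qed.
Lemma tpowK n f : tpow (- n) * (tpow n * f) = f.
Proof. by rewrite mulrA tpowD addNr mul1r. Qed.
Lemma tpow_inj n : injective ( *%R (tpow n)).
Proof. by move=> f g /(congr1 ( *%R (tpow (- n)))); rewrite !tpowK. Qed.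
Lemma vanish_below_tpow n : vanish_below n (tpow n).
Proof. exact: vanish_below_monomial. Qed.
Lemma vanish_below_tpowM n m f : vanish_below (m - n) f -> vanish_below m (tpow n * f).
Proof. by move=> fm i im; rewrite lcoef_tpowM fm //; lia. Qed.
Lemma vanish_below_cst (a : A) : vanish_below 0 (lcst a).
Proof. exact: vanish_below_monomial. Qed.
Lemma vanish_below_cstM (a : A) m f : vanish_below m f -> vanish_below m (lcst a * f).
Proof. by move=> fm i im; rewrite lcoef_cstM fm ?mulr0. Qed.

Lemma lead_coef_exists f : f <> 0 -> exists2 m, vanish_below m f & f m != 0.
Proof.
move=> f0; have [m fm] := laurent_bounded f.
have [j fj] : exists j : nat, f (m + j%:Z) != 0.
  apply: contrapT => H; apply: f0; apply: laurentP; apply: (@eq_vanish_below _ m) => //.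
    exact: vanish_below0.
  by move=> j; rewrite lcoef0; apply/eqP/negPn/negP => fj; apply: H; exists j.
case: (@ex_minnP (fun j => f (m + j%:Z) != 0)); first by exists j.
move=> j0 fj0 jmin; exists (m + j0%:Z) => // i ij.
case: (ltP i m) => [/fm//|mi].
apply/eqP/negPn/negP => fi; have := jmin `|i - m|%N.
have -> : m + `|i - m|%N%:Z = i by lia.
by move=> /(_ fi); lia.
Qed.

End LaurentBasics.

Arguments lcst {A} a.
Arguments tpow A n : clear implicits.

Section MapLaurent.
Variables (A B : comNzRingType) (phi : {rmorphism A -> B}).

Lemma map_laurent_is_zmod_morphism : zmod_morphism (map_laurent phi : laurent A -> laurent B).
Proof. by move=> f g; apply: laurentP => i; exact: rmorphB. Qed.
Lemma map_laurent_is_monoid_morphism :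
  monoid_morphism (map_laurent phi : laurent A -> laurent B).
Proof.
split; first by apply: laurentP => i; change (phi (monomial 1 0 i) = monomial 1 0 i); rewrite !lcoef_monomialE; case: ifP => _; rewrite ?rmorph1 ?rmorph0.
move=> f g; have [[m fm] [p gp]] := (laurent_bounded f, laurent_bounded g).
have fm' : vanish_below m (map_laurent phi f) by move=> i im; rewrite /lcoef /= fm ?rmorph0.
have gp' : vanish_below p (map_laurent phi g) by move=> i im; rewrite /lcoef /= gp ?rmorph0.
apply: laurentP; apply: (@eq_vanish_below _ (m + p)) => [||j].
- by move=> i im; change (phi ((f * g) i) = 0); rewrite (vanish_belowM fm gp im) rmorph0.
- exact: (vanish_belowM fm' gp').
- rewrite lcoefM //; change (phi ((f * g) (m + p + j%:Z)) = \sum_(i < j.+1) phi (f (m + i%:Z)) * phi (g (p + (j - i)%:Z))).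
  by rewrite lcoefM // rmorph_sum; apply: eq_bigr => i _; rewrite rmorphM.
Qed.
HB.instance Definition _ := GRing.isZmodMorphism.Build (laurent A) (laurent B) (map_laurent phi)
  map_laurent_is_zmod_morphism.
HB.instance Definition _ := GRing.isMonoidMorphism.Build (laurent A) (laurent B) (map_laurent phi)
  map_laurent_is_monoid_morphism.

Lemma map_laurentE f i : map_laurent phi f i = phi (f i). Proof. by []. Qed.
Lemma map_monomial (a : A) n : map_laurent phi (monomial a n) = monomial (phi a) n.
Proof. by apply: laurentP => i; rewrite map_laurentE !lcoef_monomialE; case: ifP => _; rewrite ?rmorph0. Qed.
Lemma map_lcst (a : A) : map_laurent phi (lcst a) = lcst (phi a).
Proof. exact: map_monomial. Qed.
Lemma map_tpow n : map_laurent phi (tpow A n) = tpow B n.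
Proof. by rewrite /tpow map_monomial rmorph1. Qed.
Lemma vanish_below_map m (f : laurent A) : vanish_below m f -> vanish_below m (map_laurent phi f).
Proof. by move=> fm i im; rewrite map_laurentE fm ?rmorph0. Qed.
End MapLaurent.

Section LaurentField.
Variable F : fieldType.
Implicit Types f g : laurent F.

End LaurentField.

(** * Polynomials in t and in 1/t, triangular decompositions *)

Section PolyInLaurent.
Variable A : comNzRingType.
Implicit Types (p q : {poly A}) (z : laurent A).

(** The value p(z), used for z = t and z = 1/t. *)
Definition pev z : {poly A} -> laurent A := horner_eval z \o map_poly (@lcst A).
HB.instance Definition _ z := GRing.RMorphism.on (pev z).

Lemma pevC z a : pev z a%:P = lcst a.
Proof. by rewrite /pev /= map_polyC /horner_eval hornerC. Qed.
Lemma pevX z : pev z 'X = z.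
Proof. by rewrite /pev /= map_polyX /horner_eval hornerX. Qed.
Lemma pevZ z a p : pev z (a *: p) = lcst a * pev z p.
Proof. by rewrite -mul_polyC rmorphM /= pevC. Qed.
Lemma pevXn z n : pev z 'X^n = z ^+ n.
Proof. by rewrite rmorphXn /= pevX. Qed.
Lemma pevE z p : pev z p = \sum_(i < size p) lcst p`_i * z ^+ i.
Proof.
rewrite -[p in LHS]coefK poly_def rmorph_sum /=; apply: eq_bigr => i _.
by rewrite pevZ pevXn.
Qed.

Lemma lcoef_pev_t p (i : nat) : pev (tpow A 1) p i%:Z = p`_i.
Proof.
rewrite pevE lcoef_sum; case: (ltnP i (size p)) => ip.
  rewrite (bigD1 (Ordinal ip)) //= lcoef_cstM tpowX lcoef_monomialE natz eqxx mulr1 big1 ?addr0 // => j ji.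
  rewrite lcoef_cstM tpowX lcoef_monomialE natz ifN ?mulr0 //.
  by apply: contra ji => /eqP [e]; apply/eqP/val_inj.
rewrite nth_default // big1 // => j _; rewrite lcoef_cstM tpowX lcoef_monomialE natz.
by case: eqP => [[e]|]; rewrite ?mulr0 //; have := ltn_ord j; rewrite -e ltnNge ip.
Qed.
Lemma vanish_below_pev_t p : vanish_below 0 (pev (tpow A 1) p).
Proof.
rewrite pevE; apply: vanish_below_sum => i _; apply: vanish_below_cstM.
by rewrite tpowX; apply: (@vanish_belowW _ _ 0); last exact: vanish_below_tpow; lia.
Qed.

Lemma int_le0P (i : int) : i <= 0 -> exists j : nat, i = - j%:Z.
Proof. by move=> i0; exists `|i|%N; lia. Qed.

Lemma lcoef_pev_u p (i : nat) : pev (tpow A (-1)) p (- i%:Z) = p`_i.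
Proof.
rewrite pevE lcoef_sum; case: (ltnP i (size p)) => ip.
  rewrite (bigD1 (Ordinal ip)) //= lcoef_cstM tpowX lcoef_monomialE mulNrn natz eqxx mulr1 big1 ?addr0 // => j ji.
  rewrite lcoef_cstM tpowX lcoef_monomialE mulNrn natz ifN ?mulr0 //.
  by apply: contra ji => /eqP /oppr_inj [e]; apply/eqP/val_inj.
rewrite nth_default // big1 // => j _; rewrite lcoef_cstM tpowX lcoef_monomialE mulNrn natz.
by case: eqP => [/oppr_inj [e]|]; rewrite ?mulr0 //; have := ltn_ord j; rewrite -e ltnNge ip.
Qed.
Lemma lcoef_pev_u_pos p (i : int) : 0 < i -> pev (tpow A (-1)) p i = 0.
Proof.
move=> i0; rewrite pevE lcoef_sum big1 // => j _.
by rewrite lcoef_cstM tpowX lcoef_monomialE mulNrn natz ifN ?mulr0 //; lia.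
Qed.
Lemma vanish_below_pev_u p m : (size p <= m.+1)%N -> vanish_below (- m%:Z) (pev (tpow A (-1)) p).
Proof.
move=> pm i im; have [|j ij] := @int_le0P i; first by lia.
rewrite ij lcoef_pev_u nth_default //; move: im; rewrite ij ltrN2 ltz_nat => mj; exact: leq_trans pm mj.
Qed.

Lemma polar_poly (f : laurent A) : (forall i : int, 0 < i -> f i = 0) ->
  exists p, f = pev (tpow A (-1)) p.
Proof.
move=> fp; have [m fm] := laurent_bounded f.
exists (\poly_(i < `|m|%N.+1) f (- i%:Z)); apply: laurentP => i.
case: (ltP 0 i) => [i0|i0]; first by rewrite fp ?lcoef_pev_u_pos.
have [j ->] := int_le0P i0.
rewrite lcoef_pev_u coef_poly; case: ltnP => // jm; apply: fm; lia.
Qed.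
End PolyInLaurent.

Lemma geometric_inv (A : comNzRingType) (z : A) n : z ^+ n = 0 ->
  (1 - z) * \sum_(i < n) z ^+ i = 1.
Proof. by move=> zn; have := subrX1 z n; rewrite zn sub0r -opprB mulNr => /oppr_inj <-. Qed.

Section Triangular.
(* k stands for F[eps]/(eps^n): lam is the inclusion of F, rho the residue map, and
   eps generates the kernel of rho. *)
Variables (F : fieldType) (k : comUnitRingType) (lam : {rmorphism F -> k})
  (rho : {rmorphism k -> F}) (eps : k) (n : nat).
Hypotheses (lamK : cancel lam rho) (eps_nil : eps ^+ n = 0)
  (rho_ker : forall x, rho x = 0 -> exists y, x = eps * y).

Lemma rho_eps : rho eps = 0.
Proof. by apply/eqP; have := congr1 rho eps_nil; rewrite rmorphXn rmorph0 => /eqP; rewrite expf_eq0 => /andP[]. Qed.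

(** If x has the nonzero residue a, then x / a = 1 - eps y, which a finite
    geometric series inverts. *)
Lemma unit_rho x : (x \is a GRing.unit) = (rho x != 0).
Proof.
apply/idP/idP => [xu|x0]; first by rewrite -unitfE rmorph_unit.
have [y xy] : exists y, 1 - lam (rho x)^-1 * x = eps * y.
  by apply: rho_ker; rewrite rmorphB rmorphM rmorph1 lamK mulVf ?subrr.
have e : lam (rho x)^-1 * x = 1 - eps * y by rewrite -xy opprB addrC subrK.
have := @geometric_inv _ (eps * y) n; rewrite exprMn eps_nil mul0r -e => /(_ erefl) H.
apply/unitrPr; exists (lam (rho x)^-1 * (\sum_(i < n) (eps * y) ^+ i)).
by rewrite mulrA (mulrC x).
Qed.

(** The polynomials in u = 1/t congruent to 1 modulo the maximal ideal of k and
    with constant term 1: the products of the factors 1 - a_(-i) t^(-i) of the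
    Witt presentation. *)
Definition polar (q : {poly k}) := q`_0 = 1 /\ forall i, (0 < i)%N -> rho q`_i = 0.

Lemma polar1 : polar 1.
Proof. by split=> [|[|i]//]; rewrite coefC // rmorph0. Qed.

Lemma polarP (q : {poly k}) : q`_0 = 1 -> (polar q <-> map_poly rho q = 1).
Proof.
move=> q0; split=> [[_ H]|H].
  apply/polyP => -[|i]; rewrite coef_map coefC /=; first by rewrite q0 rmorph1.
  by rewrite H.
by split=> // -[//|i] _; have := congr1 (fun p : {poly F} => p`_i.+1) H; rewrite coef_map coefC.
Qed.

Lemma polarM p q : polar p -> polar q -> polar (p * q).
Proof.
move=> pp pq; have p0 := pp.1; have q0 := pq.1; apply/polarP.
  by rewrite coefM big_ord1 p0 q0 mulr1.
by rewrite rmorphM /= (polarP p0).1 // (polarP q0).1 // mulr1.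
Qed.

Lemma nil_poly (q : {poly k}) : map_poly rho q = 0 -> exists r, q = eps *: r.
Proof.
move=> q0; have /choice [y yE] : forall i, exists y, q`_i = eps * y.
  by move=> i; apply: rho_ker; rewrite -coef_map q0 coef0.
exists (\poly_(i < size q) y i); apply/polyP => i; rewrite coefZ coef_poly.
by case: ltnP => [_|iq]; rewrite ?yE // -yE nth_default // mulr0.
Qed.

(** 1 - q is divisible by eps, hence nilpotent. *)
Lemma polar_inv q : polar q -> exists2 r, polar r & q * r = 1.
Proof.
move=> qp; have [r qr] : exists r, 1 - q = eps *: r.
  by apply: nil_poly; rewrite rmorphB rmorph1 /= (polarP qp.1).1 // subrr.
have e : q = 1 - eps *: r by rewrite -qr opprB addrC subrK.
have := @geometric_inv _ (eps *: r) n; rewrite exprZn eps_nil scale0r -e => /(_ erefl) H.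
exists (\sum_(i < n) (eps *: r) ^+ i) => //; have := congr1 (fun p : {poly k} => p`_0) H.
rewrite coefM big_ord1 qp.1 mul1r coefC /= => r0; apply/polarP => //.
by have := congr1 (map_poly rho) H; rewrite rmorphM rmorph1 /= (polarP qp.1).1 // mul1r.
Qed.

(** The quotient B of the two polar factors is a polynomial in 1/t that
    multiplies P, whose constant term is a unit, into a power series; the
    leading coefficient of B would show in negative degree unless B is constant. *)
Lemma polar_unique q q' (P P' : laurent k) : polar q -> polar q' ->
  vanish_below 0 P -> vanish_below 0 P' -> P 0 \is a GRing.unit ->
  pev (tpow k (-1)) q * P = pev (tpow k (-1)) q' * P' -> q = q' /\ P = P'.
Proof.
move=> qp qp' P0 P0' Pu e; have [r rp qr] := polar_inv qp'.
have e2 : pev (tpow k (-1)) (q * r) * P = P'.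
  by rewrite rmorphM /= mulrAC e mulrAC -rmorphM qr rmorph1 mul1r.
have bp := polarM qp rp.
suff b1 : q * r = 1.
  have qq : q = q' by rewrite -[q]mulr1 -qr (mulrC q') mulrA b1 mul1r.
  by split=> //; rewrite -e2 b1 rmorph1 mul1r.
set B := q * r in e2 bp *.
have B0 : B != 0.
  by apply/eqP => B0; have := bp.1; rewrite B0 coef0 => /esym/eqP; rewrite oner_eq0.
case sB : (size B).-1 => [|m].
  have sB1 : (size B <= 1)%N by lia.
  by rewrite (size1_polyC sB1) bp.1.
have vB : vanish_below (- m.+1%:Z) (pev (tpow k (-1)) B) by apply: vanish_below_pev_u; rewrite -sB leqSpred.
have := lcoefM_lead vB P0; rewrite e2 addr0 P0' // lcoef_pev_u => /esym H.
have : lead_coef B == 0.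
  by rewrite -[lead_coef B](mulrK Pu) lead_coefE sB H mul0r.
by rewrite lead_coef_eq0 (negPf B0).
Qed.

(** The Witt presentation g = t^w q(1/t) P, with the factors of negative degree
    collected in q and all the others in P. *)
Definition triang (g : laurent k) (w : int) (q : {poly k}) (P : laurent k) :=
  [/\ g = tpow k w * pev (tpow k (-1)) q * P, polar q, vanish_below 0 P &
      P 0 \is a GRing.unit].

Lemma map_rho_polar q z : polar q -> map_laurent rho (pev z q) = 1.
Proof.
move=> qp; rewrite pevE rmorph_sum /=.
have := (polarP qp.1).1 qp.
case sq : (size q) => [|m].
  by move: sq => /eqP; rewrite size_poly_eq0 => /eqP->; rewrite rmorph0 => /esym/eqP; rewrite oner_eq0.
rewrite big_ord_recl big1 ?addr0 /= => [_|i _].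
  by rewrite expr0 mulr1 qp.1 !rmorph1.
by rewrite rmorphM /= map_lcst qp.2 // /lcst monomial0 mul0r.
Qed.

(** Reduction modulo the maximal ideal turns q into 1 and thus reads off w as
    the order of g; polar_unique does the rest. *)
Lemma triang_unique g w q P w' q' P' : triang g w q P -> triang g w' q' P' ->
  [/\ w = w', q = q' & P = P'].
Proof.
move=> [gE qp P0 Pu] [gE' qp' P0' Pu'].
suff ww : w = w'.
  rewrite -ww gE -!mulrA in gE'; have /tpow_inj e := gE'.
  by have [-> ->] := polar_unique qp qp' P0 P0' Pu e.
have H v Q R : g = tpow k v * pev (tpow k (-1)) Q * R -> polar Q -> vanish_below 0 R ->
   R 0 \is a GRing.unit -> vanish_below v (map_laurent rho g) /\ (map_laurent rho g) v != 0.
  move=> -> Qp R0 Ru; rewrite !rmorphM /= map_tpow map_rho_polar // mulr1; split.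
    by apply: vanish_below_tpowM; rewrite subrr; apply: vanish_below_map.
  by rewrite lcoef_tpowM subrr map_laurentE -unit_rho.
have [v1 n1] := H _ _ _ gE qp P0 Pu; have [v2 n2] := H _ _ _ gE' qp' P0' Pu'.
by case: (ltgtP w w') => // [/v2/eqP|/v1/eqP]; rewrite ?(negPf n1) ?(negPf n2).
Qed.

Lemma triangM g w q P g' w' q' P' : triang g w q P -> triang g' w' q' P' ->
  triang (g * g') (w + w') (q * q') (P * P').
Proof.
move=> [-> qp P0 Pu] [-> qp' P0' Pu']; split.
- by rewrite -tpowD rmorphM /=; ring.
- exact: polarM.
- exact: vanish_belowM0.
- by rewrite -[0]addr0 lcoefM_lead // unitrM Pu.
Qed.

End Triangular.

(** * Existence of triangular decompositions *)

Lemma poly_head (R : nzRingType) (p : {poly R}) : p = (p`_0)%:P + 'X * drop_poly 1 p.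
Proof.
apply/polyP => -[|i]; rewrite coefD coefC coefXM ?addr0 //=.
by rewrite add0r coef_drop_poly addn1.
Qed.

Section NonnegPart.
Variable A : comNzRingType.
Lemma lpos_bounded (f : laurent A) :
  exists m : int, vanish_below m (fun i => if 0 <= i then f i else 0).
Proof. by exists 0 => i i0; rewrite lt_geF. Qed.
Definition lpos f : laurent A := Laurent (lpos_bounded f).
Lemma lposE f i : lpos f i = if 0 <= i then f i else 0. Proof. by []. Qed.
End NonnegPart.

Section TriangularExists.
Variables (F : fieldType) (k : comUnitRingType) (lam : {rmorphism F -> k})
  (rho : {rmorphism k -> F}) (eps : k) (n : nat).
Hypotheses (lamK : cancel lam rho) (eps_nil : eps ^+ n = 0)
  (rho_ker : forall x, rho x = 0 -> exists y, x = eps * y).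

(** F((t))[X] -> k((t)), sending X to eps. The series to which the symbol is
    applied are images of polynomials G with G(0) = 1. *)
Definition epoly : {poly laurent F} -> laurent k :=
  horner_eval (lcst eps) \o map_poly (map_laurent lam).
HB.instance Definition _ := GRing.RMorphism.on epoly.

Lemma epolyC a : epoly a%:P = map_laurent lam a.
Proof. by rewrite /epoly /= map_polyC /horner_eval hornerC. Qed.
Lemma epolyX : epoly 'X = lcst eps.
Proof. by rewrite /epoly /= map_polyX /horner_eval hornerX. Qed.
Lemma epolyXn m : epoly 'X^m = lcst (eps ^+ m).
Proof. by rewrite rmorphXn /= epolyX rmorphXn. Qed.

Lemma map_rho_lam (f : laurent F) : map_laurent rho (map_laurent lam f) = f.
Proof. by apply: laurentP => i; rewrite !map_laurentE lamK. Qed.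

Lemma map_rho_epoly G : map_laurent rho (epoly G) = G`_0.
Proof.
rewrite [G in LHS]poly_head; set d := drop_poly _ _.
rewrite rmorphD rmorphD /= rmorphM rmorphM /= epolyX map_lcst.
by rewrite (rho_eps rho eps_nil) [lcst 0]rmorph0 mul0r addr0 epolyC map_rho_lam.
Qed.

(** Descending induction on the exponent m. The coefficient c of X^m in G splits
    into its polar part cm and its regular part cp; multiplication by (1 - cm
    X^m) (1 - cp X^m), a polar polynomial times a power series, cancels c and
    leads to a G congruent to 1 modulo X^(m+1). *)
Lemma triang_exists_level d m (G H : {poly laurent F}) : (m + d)%N = n -> (0 < m)%N -> G = 1 + 'X^m * H ->
  exists q P, triang rho (epoly G) 0 q P.
Proof.
elim: d m G H => [|d IH] m G H md m0 GE.
  exists 1, 1; split; [|exact: polar1|exact: vanish_below1|exact: unitr1].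
  have -> : epoly G = 1.
    rewrite GE rmorphD rmorphM /= epolyXn.
    by move: md; rewrite addn0 => ->; rewrite eps_nil [lcst 0]rmorph0 mul0r rmorph1 addr0.
  by rewrite tpow0 rmorph1 !mul1r.
pose c := (H : {poly laurent F})`_0; pose cp := lpos c; pose cm := c - cp.
have [H1 HE] : exists H1 : {poly laurent F}, H = c%:P + 'X * H1.
  by exists (drop_poly 1 H); apply: poly_head.
have [H' GE'] : exists H' : {poly laurent F}, G * (1 - 'X^m * cm%:P) * (1 - 'X^m * cp%:P) = 1 + 'X^(m.+1) * H'.
  case: m m0 GE {md} => [//|m'] _ ->.
  have cE : c = cm + cp by rewrite subrK.
  exists (H1 + 'X^m' * (- c%:P * (c%:P + 'X * H1) + cm%:P * cp%:P * (1 + 'X^(m'.+1) * (c%:P + 'X * H1)))).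
  by rewrite HE cE rmorphD /= !exprS; ring.
have [|//|q [P T]] := IH m.+1 _ _ _ _ GE'; first by rewrite -md addSnnS.
have [r cmE] : exists r, map_laurent lam cm = pev (tpow k (-1)) r.
  apply: polar_poly => i i0; rewrite map_laurentE lcoefB lposE ltW // subrr.
  by rewrite rmorph0.
have r0 : r`_0 = 0.
  by rewrite -lcoef_pev_u -cmE oppr0 map_laurentE lcoefB lposE lexx subrr rmorph0.
have qp1 : polar rho (1 - eps ^+ m *: r).
  split=> [|i i0]; rewrite coefB coefZ coefC ?r0 ?mulr0 ?subr0 //.
  rewrite rmorphB rmorphM rmorphXn (rho_eps rho eps_nil) expr0n.
  by rewrite (gtn_eqF m0) (gtn_eqF i0) mul0r rmorph0 subr0.
have [r1 rp1 rr1] := polar_inv eps_nil rho_ker qp1.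
have znil : (epoly ('X^m * cp%:P)) ^+ n = 0.
  rewrite rmorphM exprMn /= epolyXn -rmorphXn /= -exprM mulnC exprM eps_nil expr0n.
  by rewrite gtn_eqF // [lcst 0]rmorph0 mul0r.
have := geometric_inv znil; set z := epoly _ in znil *; set z' := \sum_(i < n) _ => zz'.
have z0 : vanish_below 0 z.
  rewrite /z rmorphM /= epolyXn epolyC; apply: vanish_below_cstM; apply: vanish_below_map.
  by move=> i i0; rewrite lposE lt_geF.
have z'0 : vanish_below 0 z'.
  by apply: vanish_below_sum => i _; rewrite -(mul0rn _ i); apply: vanish_belowX.
have z1 : vanish_below 0 (1 - z) by apply: vanish_belowB => //; apply: vanish_below1.
have u : z' 0 \is a GRing.unit.
  apply/unitrPr; exists ((1 - z) 0); rewrite mulrC -lcoefM_lead // addr0 zz'.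
  by rewrite -monomial1E lcoef_monomialE.
have gE : epoly G = epoly (1 + 'X^(m.+1) * H') * (tpow k 0 * pev (tpow k (-1)) r1 * z').
  rewrite -GE' !rmorphM /= tpow0 mul1r.
  have -> : epoly (1 - 'X^m * cm%:P) = pev (tpow k (-1)) (1 - eps ^+ m *: r).
    by rewrite rmorphB [in RHS]rmorphB !rmorph1 rmorphM /= epolyXn epolyC cmE pevZ.
  have -> : epoly (1 - 'X^m * cp%:P) = 1 - z by rewrite rmorphB rmorph1.
  have ar : pev (tpow k (-1)) (1 - eps ^+ m *: r) * pev (tpow k (-1)) r1 = 1.
    by rewrite -rmorphM rr1 rmorph1.
  have e (g a s b zz : laurent k) : a * s = 1 -> b * zz = 1 -> g = g * a * b * (s * zz).
    by move=> ar1 bz1; rewrite mulrACA -(mulrA g) ar1 bz1 !mulr1.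
  by rewrite -(e _ _ _ _ _ ar zz').
exists (q * r1), (P * z'); rewrite gE.
have T' : triang rho (tpow k 0 * pev (tpow k (-1)) r1 * z') 0 r1 z' by split.
by have := triangM T T'; rewrite addr0 GE'.
Qed.

Lemma triang_exists (G : {poly laurent F}) : (0 < n)%N -> G`_0 = 1 -> exists q P, 
  [/\ triang rho (epoly G) 0 q P & rho (P 0) = 1].
Proof.
move=> n0 G0.
have [q [P T]] : exists q P, triang rho (epoly G) 0 q P.
  apply: (@triang_exists_level n.-1 1 G (drop_poly 1 G)) => //; first lia.
  by rewrite expr1 {1}(poly_head G) G0.
exists q, P; split=> //; case: T => gE qp P0 _.
have := map_rho_epoly G; rewrite G0 gE tpow0 mul1r rmorphM /= (map_rho_polar _ qp) mul1r.
by move/(congr1 (fun f : laurent F => f 0)); rewrite map_laurentE -monomial1E lcoef_monomialE.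
Qed.

End TriangularExists.

(** * Witt parameters *)

Section WittPoly.
Variable A : comNzRingType.
Implicit Types (a b : nat -> A) (p : {poly A}).

Lemma witt_polyS a n : witt_poly a n.+1 = witt_poly a n * (1 - a n *: 'X^(n.+1)).
Proof. by rewrite /witt_poly big_ord_recr. Qed.

Lemma coef_witt_polyS a n : (witt_poly a n.+1)`_n.+1 = (witt_poly a n)`_n.+1 - a n.
Proof. by rewrite witt_polyS coef_mul_1subXn ltnn subnn coef0_witt_poly mulr1. Qed.

Lemma eq_witt_poly a b n : (forall i, (i < n)%N -> a i = b i) -> witt_poly a n = witt_poly b n.
Proof. by move=> ab; apply: eq_bigr => i _; rewrite ab. Qed.

(** The i-th factor is determined by the coefficient of X^(i+1) once the
    preceding factors are known. *)
Lemma witt_poly_inj a b n : (forall j, (j <= n)%N -> (witt_poly a n)`_j = (witt_poly b n)`_j) ->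
  forall i, (i < n)%N -> a i = b i.
Proof.
elim: n => [//|n IH] H i; have {}IH : forall j, (j < n)%N -> a j = b j.
  apply: IH => j jn; have := H j (leqW jn).
  by rewrite (@coef_witt_poly _ a n n.+1) ?jn ?leqnSn // (@coef_witt_poly _ b n n.+1) ?jn ?leqnSn.
rewrite ltnS leq_eqVlt => /orP[/eqP->|]; last exact: IH.
by have := H n.+1 (leqnn _); rewrite !coef_witt_polyS (eq_witt_poly IH) => /addrI /oppr_inj.
Qed.

(** Every power series with constant term 1 is an infinite product of factors 1
    - a_i X^(i+1). *)
Lemma series_witt (p : nat -> A) : p 0 = 1 ->
  exists a, forall n j, (j <= n)%N -> (witt_poly a n)`_j = p j.
Proof.
move=> p0.
pose P n : {poly A} := \poly_(j < n.+1) p j.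
pose a i := (witt_trunc (P i.+1) i - P i.+1)`_i.+1.
have WE n L : (n <= L)%N -> witt_trunc (P L) n = witt_poly a n.
  elim: n L => [|n IH] L nL; first by rewrite /witt_poly big_ord0.
  rewrite witt_polyS /= IH; last exact: ltnW.
  congr (_ * (1 - _ *: _)); rewrite /a !coefB !coef_poly ltnS nL ltnS leqnn.
  by rewrite IH ?leqnSn.
exists a => n j jn; rewrite -(WE _ _ (leqnn n)) coef_witt_trunc //.
  by rewrite coef_poly ltnS jn.
by rewrite coef_poly p0.
Qed.

Lemma witt_poly_stable a n m : (n <= m)%N -> (forall i, (n <= i)%N -> a i = 0) ->
  witt_poly a m = witt_poly a n.
Proof.
elim: m => [|m IH]; first by rewrite leqn0 => /eqP->.
rewrite leq_eqVlt => /orP[/eqP->//|nm] H.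
by rewrite witt_polyS H // scale0r subr0 mulr1 IH.
Qed.
End WittPoly.

Lemma pev_t_prod (A : comNzRingType) (a : int -> A) n :
  \prod_(1 <= i < n.+1) (1 - monomial (a i%:Z) i%:Z) =
  pev (tpow A 1) (witt_poly (fun i => a i.+1%:Z) n).
Proof.
rewrite big_add1 big_mkord rmorph_prod; apply: eq_bigr => i _.
by rewrite rmorphB rmorph1 /= pevZ pevXn tpowX natz -monomialE.
Qed.
Lemma pev_u_prod (A : comNzRingType) (a : int -> A) n :
  \prod_(1 <= i < n.+1) (1 - monomial (a (- i%:Z)) (- i%:Z)) =
  pev (tpow A (-1)) (witt_poly (fun i => a (- i.+1%:Z)) n).
Proof.
rewrite big_add1 big_mkord rmorph_prod; apply: eq_bigr => i _.
by rewrite rmorphB rmorph1 /= pevZ pevXn tpowX mulNrn natz -monomialE.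
Qed.

Section Params.
Variables (F : fieldType) (k : comUnitRingType) (lam : {rmorphism F -> k})
  (rho : {rmorphism k -> F}) (eps : k) (n : nat).
Hypotheses (lamK : cancel lam rho) (eps_nil : eps ^+ n = 0)
  (rho_ker : forall x, rho x = 0 -> exists y, x = eps * y).

(** The infinite Witt product of the polynomial q is finite. If q has at most D
    coefficients, then eps^ceil(j/D) divides the coefficient of X^j in q, since
    eps divides all coefficients but the constant one; this weighted
    divisibility is inherited by the Witt coefficients, which are therefore 0 as
    soon as the power of eps is. *)
Lemma polar_witt (q : {poly k}) : polar rho q -> exists b J,
  [/\ q = witt_poly b J, forall i, rho (b i) = 0 & forall i, (J <= i)%N -> b i = 0].
Proof.
move=> qp; have [b bE] := @series_witt _ (fun j => q`_j) qp.1.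
(* e j is j / D, rounded up *)
pose D := size q; pose e j := ((j + D.-1) %/ D)%N.
have D0 : (0 < D)%N.
  rewrite size_poly_gt0; apply/eqP => q0; have := qp.1.
  by rewrite q0 coef0 => /esym/eqP; rewrite oner_eq0.
have eP j l : (e j <= l)%N = (j <= D * l)%N.
  by rewrite -ltnS ltn_divLR // mulSn mulnC; lia.
have eD i j : (e (i + j) <= e i + e j)%N.
  rewrite eP mulnDr; have := eP i (e i); have := eP j (e j); rewrite !leqnn.
  by move=> /esym ? /esym ?; apply: leq_add.
have e0 : e 0 = 0%N by apply/eqP; rewrite -leqn0 eP.
pose dv j (x : k) := exists y, x = eps ^+ e j * y.
have dvD j x y : dv j x -> dv j y -> dv j (x + y).
  by move=> [x' ->] [y' ->]; exists (x' + y'); rewrite mulrDr.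
have dvN j x : dv j x -> dv j (- x).
  by move=> [x' ->]; exists (- x'); rewrite mulrN.
have dvM i j x y : dv i x -> dv j y -> dv (i + j)%N (x * y).
  move=> [x' ->] [y' ->]; exists (eps ^+ (e i + e j - e (i + j)) * (x' * y')).
  by rewrite [RHS]mulrA -exprD subnKC // exprD mulrACA.
have dvZ j : dv j 0 by exists 0; rewrite mulr0.
have dvq j : dv j q`_j.
  case: j => [|j].
    by exists 1; rewrite ?qp.1 e0 expr0 mulr1.
  case: (ltnP j.+1 (D.+1)) => jD; last by rewrite nth_default //; exact: ltnW.
  have [y ->] := rho_ker (qp.2 _ (ltn0Sn j)); exists y.
  have e1 : (e j.+1 <= 1)%N by rewrite eP muln1.
  have e2 : (0 < e j.+1)%N by rewrite ltnNge eP muln0.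
  by have -> : e j.+1 = 1%N by lia.
have W m : (forall j, dv j (witt_poly b m)`_j) /\ (forall i, (i < m)%N -> dv i.+1 (b i)).
  elim: m => [|m [IH1 IH2]].
    split=> // j; rewrite /witt_poly big_ord0 coefC; case: eqP => [->|_]; last exact: dvZ.
    by exists 1; rewrite ?qp.1 e0 expr0 mulr1.
  have bm : dv m.+1 (b m).
    have -> : b m = (witt_poly b m)`_m.+1 - q`_m.+1.
      by rewrite -(bE m.+1 m.+1) // coef_witt_polyS; ring.
    by apply: dvD; [apply: IH1|apply: dvN].
  split=> [j|i]; last first.
    by rewrite ltnS leq_eqVlt => /orP[/eqP->//|/IH2].
  rewrite witt_polyS coef_mul_1subXn; apply: dvD => //; apply: dvN.
  case: leqP => jm; first exact: dvZ.
  by have := dvM m.+1 (j - m.+1)%N _ _ bm (IH1 _); rewrite subnKC.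
have dvb i : dv i.+1 (b i) by apply: (W i.+1).2.
have b0 i : (D * n <= i)%N -> b i = 0.
  move=> Di; have [y ->] := dvb i.
  have ni : (n <= e i.+1)%N.
    rewrite leqNgt; apply/negP => en; have := eP i.+1 n.
    by rewrite (ltnW en) => /esym iD; have := leq_trans iD Di; rewrite ltnn.
  by rewrite -(subnK ni) exprD eps_nil mulr0 mul0r.
exists b, (D * n)%N; split=> // [|i].
  apply/polyP => j; rewrite -(bE (maxn j (D * n)) j) ?leq_maxl //.
  by rewrite (@witt_poly_stable _ b (D * n)) ?leq_maxr.
have [y ->] := dvb i; have e2 : (0 < e i.+1)%N by rewrite ltnNge eP muln0.
by rewrite rmorphM rmorphXn (rho_eps rho eps_nil) expr0n gtn_eqF // mul0r.
Qed.

End Params.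

(** The factors of negative degree become constant from the rank J on, and the
    truncation at rank m of the other product agrees with P in degrees at most
    m: the coefficient of degree j no longer changes once m is large. *)
Lemma params_prod_lim (k : comUnitRingType) w (a : int -> k) J (P : laurent k) :
  (forall i, (J <= i)%N -> a (- i.+1%:Z) = 0) -> vanish_below 0 P ->
  (forall m j : nat, (j <= m)%N -> P j%:Z = a 0 * (witt_poly (fun i => a i.+1%:Z) m)`_j) ->
  forall j : int, exists n0 : nat, forall m : nat, (n0 <= m)%N ->
    params_prod w a m j =
    (tpow k w * pev (tpow k (-1)) (witt_poly (fun i => a (- i.+1%:Z)) J) * P) j.
Proof.
move=> aJ P0 PE j; set q := witt_poly _ J; pose j' := `|j - w|%N.+1.
exists (J + j' + size q)%N => m mJ; rewrite /params_prod pev_u_prod pev_t_prod.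
rewrite (@witt_poly_stable _ _ J m) //; last by lia.
rewrite -/q -/(tpow k w) -/(lcst (a 0)); set Q := pev _ q; set R := pev _ _.
have -> : tpow k w * lcst (a 0) * Q * R = tpow k w * (Q * (lcst (a 0) * R)) by ring.
rewrite -(mulrA (tpow k w)) (lcoef_tpowM w (Q * (lcst (a 0) * R))) (lcoef_tpowM w (Q * P)).
apply/eqP; rewrite -subr_eq0 -lcoefB -mulrBr; apply/eqP.
have vq : vanish_below (- (size q)%:Z) Q by apply: vanish_below_pev_u.
have vP : vanish_below m.+1 (lcst (a 0) * R - P).
  move=> i im; rewrite lcoefB (lcoef_cstM (a 0) R); case: (ltP i 0) => i0.
    by rewrite P0 // vanish_below_pev_t // mulr0 subr0.
  have [i' i'E] : exists i' : nat, i = i'%:Z by exists `|i|%N; lia.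
  by rewrite i'E in im *; rewrite /R lcoef_pev_t (PE m) ?subrr //; lia.
by apply: (vanish_belowM vq vP); lia.
Qed.

Section ParamsTriangular.
Variables (F : fieldType) (k : comUnitRingType) (lam : {rmorphism F -> k})
  (rho : {rmorphism k -> F}) (eps : k) (n : nat).
Hypotheses (lamK : cancel lam rho) (eps_nil : eps ^+ n = 0)
  (rho_ker : forall x, rho x = 0 -> exists y, x = eps * y).

Lemma triang_params g w q P : triang rho g w q P -> exists a, is_witt_params g (w, a).
Proof.
move=> [gE qp P0 Pu]; have [b [J [qE bm bJ]]] := polar_witt eps_nil rho_ker qp.
have [|c cE] := @series_witt _ (fun j : nat => P j%:Z / P 0); first by rewrite divrr.
pose a (i : int) := match i with Posz 0 => P 0 | Posz i.+1 => c i | Negz i => b i end.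
have ap i : a i.+1%:Z = c i by [].
have an i : a (- i.+1%:Z) = b i by rewrite -NegzE.
exists a; split=> //.
- case=> [//|i] _ /=; rewrite (unit_rho lamK eps_nil rho_ker) bm eqxx //.
- by exists (- J%:Z); case=> i iJ; [exfalso; lia|apply: bJ; lia].
- move=> j; have [||m i im|n0 H] := @params_prod_lim _ w a J P _ _ _ j => //.
    by rewrite (eq_witt_poly (b := c)) // cE // mulrC divrK.
  exists n0 => m nm; rewrite H // gE qE; congr ((_ * pev _ _ * _ : laurent k) j).
Qed.

(** Conversely the Witt parameters give a triangular decomposition, so that
    triang_unique makes the parameters chosen in the definition of the symbol
    computable from any decomposition. *)
Lemma params_triang g w a : is_witt_params g (w, a) -> exists J P,
  [/\ forall i, (J <= i)%N -> a (- i.+1%:Z) = 0,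
      triang rho g w (witt_poly (fun i => a (- i.+1%:Z)) J) P &
      forall m j : nat, (j <= m)%N -> P j%:Z = a 0 * (witt_poly (fun i => a i.+1%:Z) m)`_j].
Proof.
move=> [a0 an [m am] lim].
pose J := `|m|%N; have aJ i : (J <= i)%N -> a (- i.+1%:Z) = 0 by move=> Ji; apply: am; lia.
pose c (i : int) := if 0 <= i then a 0 * (witt_poly (fun i => a i.+1%:Z) `|i|%N)`_`|i|%N else 0.
have cb : exists m : int, vanish_below m c by exists 0 => i i0; rewrite /c lt_geF.
pose P := Laurent cb.
have P0 : vanish_below 0 P by move=> i i0; rewrite -[P i]/(c i) /c lt_geF.
have PE l j : (j <= l)%N -> P j%:Z = a 0 * (witt_poly (fun i => a i.+1%:Z) l)`_j.
  move=> jl; rewrite -[P _]/(c _) /c /=; congr (_ * _).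
  by rewrite (@coef_witt_poly _ _ j l) // leqnn jl.
exists J, P; split=> //; split=> //.
- apply: laurentP => j; have [n0 H0] := lim j.
  have [n1 H1] := params_prod_lim w aJ P0 PE j.
  by rewrite -(H0 (maxn n0 n1)) ?leq_maxl // H1 // leq_maxr.
- split=> [|[//|i] _]; first exact: coef0_witt_poly.
  have {}am l : rho (a (- l.+1%:Z)) = 0.
    have := an (- l.+1%:Z); rewrite (unit_rho lamK eps_nil rho_ker) negbK => /(_ _)/eqP; apply.
    by lia.
  rewrite -coef_map rmorph_prod big1 ?coefC // => l _.
  by rewrite rmorphB rmorph1 /= map_polyZ /= am scale0r subr0.
- by rewrite (PE 0%N 0%N) // coef0_witt_poly mulr1.
Qed.
End ParamsTriangular.

(** * Radicals in an algebraically closed field *)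

Section ClosedFieldRoots.
Variable F : closedFieldType.

(** An algebraically closed field is infinite. *)
Lemma closed_poly_ext (p q : {poly F}) : (forall x, p.[x] = q.[x]) -> p = q.
Proof.
move=> pq; apply/eqP; rewrite -subr_eq0; apply/negPn/negP => d0.
have H x : (p - q).[x] = 0 by rewrite hornerD hornerN pq subrr.
have : size (p - q - 1) != 1%N.
  apply/eqP => s1; have := H 0; have := @size1_polyC _ (p - q - 1).
  rewrite s1 => /(_ isT) e.
  have e2 : p - q = ((p - q - 1)`_0 + 1)%:P by rewrite polyCD -e subrK.
  rewrite e2 hornerC => c0; move: d0; rewrite e2 c0 eqxx //.
by move/closed_rootP => [x]; rewrite rootE hornerD hornerN hornerC H sub0r oppr_eq0 oner_eq0.
Qed.

(** The i roots of T^i - a, with multiplicity: the characteristic may divide i.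
    They give 1 - a T^i = prod (1 - y T). *)
Definition radicals (i : nat) (a : F) : seq F :=
  sval (closed_field_poly_normal ('X^i - a%:P)).

Lemma radicalsP i a : (0 < i)%N -> 'X^i - a%:P = \prod_(y <- radicals i a) ('X - y%:P).
Proof.
move=> i0; rewrite /radicals; case: closed_field_poly_normal => s /= sE.
by rewrite {1}sE lead_coefDl ?lead_coefXn ?scale1r // size_polyXn size_polyN size_polyC; case: (a != 0).
Qed.
Lemma size_radicals i a : (0 < i)%N -> size (radicals i a) = i.
Proof.
move=> i0; have := congr1 (fun p : {poly F} => size p) (radicalsP a i0).
rewrite size_prod_XsubC size_polyDl ?size_polyXn; first by case.
by rewrite size_polyN size_polyC; case: (a != 0).
Qed.
Lemma radicals_exp i a y : (0 < i)%N -> y \in radicals i a -> y ^+ i = a.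
Proof.
move=> i0 ys; have /eqP : ('X^i - a%:P).[y] = 0.
  by apply/rootP; rewrite radicalsP // root_prod_XsubC.
by rewrite hornerD hornerXn hornerN hornerC subr_eq0 => /eqP.
Qed.
Lemma prod_radicals i a x : (0 < i)%N -> \prod_(y <- radicals i a) (1 - y * x) = 1 - a * x ^+ i.
Proof.
move=> i0; have [->|x0] := eqVneq x 0.
  by rewrite expr0n gtn_eqF // mulr0 subr0 big1 // => y _; rewrite mulr0 subr0.
transitivity (\prod_(y <- radicals i a) (x * (x^-1 - y))).
  by apply: eq_bigr => y _; rewrite mulrBr divff // (mulrC x).
rewrite big_split /= big_const_seq count_predT size_radicals // iter_mulr_1.
have := congr1 (horner^~ x^-1) (radicalsP a i0) => /=.
rewrite hornerD hornerXn hornerN hornerC horner_prod.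
under [in X in _ = X -> _]eq_bigr do rewrite hornerXsubC.
by move=> <-; rewrite mulrBr -exprMn divff // expr1n (mulrC a).
Qed.

(** This is where the exponents j/(i,j), i/(i,j) and (i,j) of the symbol come
    from: its elementary factor is a product of values at radicals. The proof is
    Euclid's algorithm on (i, j): y^i = a allows to replace j by j - i with a b
    in place of b, and exchanging the products over the radicals of a and of b
    exchanges i and j. *)
Lemma prod_radicals_exp_closed i j a b : (0 < i)%N ->
  \prod_(y <- radicals i a) (1 - b * y ^+ j) =
  (1 - a ^+ (j %/ gcdn i j) * b ^+ (i %/ gcdn i j)) ^+ gcdn i j.
Proof.
have [m] := ubnP (i.*2 + j); elim: m i j a b => // m IH i j a b ijm i0.
have [->|j0] := posnP j.
  rewrite gcdn0 div0n divnn i0 expr0 mul1r expr1.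
  under eq_bigr do rewrite expr0 mulr1.
  by rewrite big_const_seq count_predT size_radicals // iter_mulr_1.
case: (leqP i j) => ij.
  transitivity (\prod_(y <- radicals i a) (1 - (a * b) * y ^+ (j - i))).
    apply: eq_big_seq => y ys; rewrite -{1}(subnK ij) exprD (radicals_exp i0 ys); congr (1 - _); ring.
  have gE : gcdn i (j - i) = gcdn i j by rewrite -{2}(subnK ij) gcdnDr.
  rewrite IH //; last by lia.
  rewrite gE; congr ((1 - _) ^+ _); rewrite exprMn mulrA -exprD; congr (a ^+ _ * _).
  have gi : (gcdn i j %| i)%N by apply: dvdn_gcdl.
  by rewrite -divnDl ?subnK // -gE dvdn_gcdr.
transitivity (\prod_(z <- radicals j b) \prod_(y <- radicals i a) (1 - z * y)).
  by rewrite exchange_big; apply: eq_bigr => y _; rewrite prod_radicals.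
transitivity (\prod_(z <- radicals j b) (1 - a * z ^+ i)).
  apply: eq_bigr => z _; rewrite -prod_radicals //; apply: eq_bigr => y _.
  by rewrite mulrC.
rewrite IH //; last by lia.
by rewrite mulrC gcdnC.
Qed.
End ClosedFieldRoots.

(** * The symbol as a product of values of a polynomial *)

(** A polynomial identity in b over F, so that b may be taken in a larger ring. *)
Lemma prod_radicals_exp (F : closedFieldType) (k : comNzRingType) (lam : {rmorphism F -> k})
    i j a (b : k) : (0 < i)%N ->
  \prod_(y <- radicals i a) (1 - b * lam y ^+ j) =
  (1 - lam a ^+ (j %/ gcdn i j) * b ^+ (i %/ gcdn i j)) ^+ gcdn i j.
Proof.
move=> i0.
have H : \prod_(y <- radicals i a) (1 - (y ^+ j) *: 'X) =
  (1 - a ^+ (j %/ gcdn i j) *: 'X ^+ (i %/ gcdn i j)) ^+ gcdn i j.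
  apply: closed_poly_ext => x; rewrite horner_prod horner_exp !hornerE.
  rewrite -prod_radicals_exp_closed //; apply: eq_bigr => y _.
  by rewrite !hornerE mulrC.
have := congr1 (horner_eval b \o map_poly lam) H.
rewrite rmorph_prod rmorphXn rmorphB rmorph1 /= map_polyZ map_polyXn /horner_eval.
rewrite hornerZ hornerXn rmorphXn => <-; apply: eq_bigr => y _.
rewrite rmorphB rmorph1 /= map_polyZ map_polyX hornerD hornerN hornerC hornerZ hornerX.
by rewrite rmorphXn mulrC.
Qed.

Lemma witt_paramsP (k : comUnitRingType) (f : laurent k) wa :
  is_witt_params f wa -> is_witt_params f (witt_params f).
Proof. by move=> H; rewrite /witt_params; case: xgetP => [y _ //|/(_ wa)]; case. Qed.

Section Symbol.
Variables (F : closedFieldType) (k : comUnitRingType) (lam : {rmorphism F -> k})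
  (rho : {rmorphism k -> F}) (eps : k) (n : nat).
Hypotheses (lamK : cancel lam rho) (eps_nil : eps ^+ n = 0)
  (rho_ker : forall x, rho x = 0 -> exists y, x = eps * y).

(** P = a0 prod (1 - alpha_i t^(i+1)), as an equality of truncations. *)
Definition witt_series (P : laurent F) (a0 : F) (alpha : nat -> F) :=
  [/\ a0 != 0, vanish_below 0 P &
   forall m j : nat, (j <= m)%N -> P j%:Z = a0 * (witt_poly alpha m)`_j].

Lemma witt_series_exists (f : laurent F) : f <> 0 ->
  exists w P a0 alpha, f = tpow F w * P /\ witt_series P a0 alpha.
Proof.
move=> f0; have [w fw fw0] := lead_coef_exists f0.
exists w, (tpow F (- w) * f), (f w).
have PE i : (tpow F (- w) * f) i = f (i + w) by rewrite lcoef_tpowM opprK.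
have [|al alE] := @series_witt _ (fun j : nat => f (j%:Z + w) / f w).
  by rewrite add0r divff.
exists al; split; first by rewrite mulrA tpowD subrr mul1r.
split=> // [|m j jm]; first by apply: vanish_below_tpowM; rewrite sub0r opprK.
by rewrite PE alE // mulrC divfK.
Qed.

Lemma lam_witt_poly (alpha : nat -> F) m :
  witt_poly (lam \o alpha) m = map_poly lam (witt_poly alpha m).
Proof.
rewrite rmorph_prod; apply: eq_bigr => i _.
by rewrite rmorphB rmorph1 /= map_polyZ map_polyXn.
Qed.

(** The product of the values of q at the inverse roots y of the factors 1 -
    alpha_i t^(i+1) of a series f over F; 1 - y t vanishes where 1/t = y, so
    these are the values of q(1/t) at the zeros of f. *)
Definition root_product (alpha : nat -> F) (L : nat) (q : {poly k}) : k :=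
  \prod_(i < L) \prod_(y <- radicals i.+1 (alpha i)) q.[lam y].

Lemma root_productM alpha L p q :
  root_product alpha L (p * q) = root_product alpha L p * root_product alpha L q.
Proof.
rewrite -big_split; apply: eq_bigr => i _; rewrite -big_split; apply: eq_bigr => y _.
exact: hornerM.
Qed.

(** As f has coefficients in F, it has no factor of negative degree, and the
    denominator of the symbol is 1. In the numerator the product over j of the
    factors attached to i is, by prod_radicals_exp, the product of the values of
    q at the radicals of alpha_i. For i at least n J these values are 1, because
    the exponent i/(i,j) of the nilpotent b_(-j) is then at least n. *)
Lemma contou_carrere_triang (w : int) (P : laurent F) a0 alpha g q Pg :
  witt_series P a0 alpha -> triang rho g 0 q Pg ->
  exists L0, forall L, (L0 <= L)%N ->
  contou_carrere (map_laurent lam (tpow F w * P)) g = (Pg 0) ^ (- w) * root_product alpha L q.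
Proof.
move=> [a0n P0 PE] T.
have Tf : triang rho (map_laurent lam (tpow F w * P)) w 1 (map_laurent lam P).
  split; [|exact: polar1|exact: vanish_below_map|].
    by rewrite rmorphM /= map_tpow rmorph1 mulr1.
  rewrite map_laurentE (unit_rho lamK eps_nil rho_ker) lamK.
  by rewrite (PE 0%N 0%N) // coef0_witt_poly mulr1.
have [af paf] := triang_params lamK eps_nil rho_ker Tf.
have [ag pag] := triang_params lamK eps_nil rho_ker T.
have pf := witt_paramsP paf; have pg := witt_paramsP pag.
rewrite /contou_carrere; case: (witt_params _) pf => wf a pf.
case: (witt_params g) pg => wg b pg.
have [Jf [Pf [aJ Tf' PfE]]] := params_triang lamK eps_nil rho_ker pf.
have [J [Pg' [bJ T' PgE]]] := params_triang lamK eps_nil rho_ker pg.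
have [ew eq1 eP] := triang_unique lamK eps_nil rho_ker Tf Tf'.
have [ew' eq2 eP'] := triang_unique lamK eps_nil rho_ker T T'.
rewrite -ew -ew' mulr0 expr0z mul1r mul1r -exprN1.
have a_neg i : a (- i.+1%:Z) = 0.
  case: (ltnP i Jf) => [iJ|/aJ//].
  apply: (@witt_poly_inj _ (fun i => a (- i.+1%:Z)) (fun=> 0) Jf _ i iJ) => j _.
  by rewrite -eq1 /witt_poly big1 // => l _; rewrite scale0r subr0.
have a0E : a 0 = lam a0.
  have := PfE 0%N 0%N (leqnn _); rewrite -eP map_laurentE (PE 0%N 0%N) //.
  by rewrite !coef0_witt_poly !mulr1.
have a_pos i : a i.+1%:Z = lam (alpha i).
  apply: (@witt_poly_inj _ (fun i => a i.+1%:Z) (lam \o alpha) i.+1) => // j ji.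
  have lu : lam a0 \is a GRing.unit by rewrite (unit_rho lamK eps_nil rho_ker) lamK.
  apply: (mulrI lu); rewrite -{1}a0E -(PfE _ _ ji) -eP map_laurentE (PE _ _ ji).
  by rewrite rmorphM lam_witt_poly coef_map.
have -> : cross_product b a = 1.
  apply: fsbig1 => -[i j] /= /andP[i0 j0].
  have -> : a (- j%:Z) = 0 by rewrite -(prednK j0) a_neg.
  have gi : (0 < i %/ gcdn i j)%N by rewrite divn_gt0 ?gcdn_gt0 ?i0 // dvdn_leq // dvdn_gcdl.
  by rewrite expr0n gtn_eqF // mulr0 subr0 expr1n.
have b_nil i : b (- i.+1%:Z) ^+ n = 0.
  have [_ bn _ _] := pg; have := bn (- i.+1%:Z).
  rewrite (unit_rho lamK eps_nil rho_ker) negbK => /(_ isT)/eqP/rho_ker[y ->].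
  by rewrite exprMn eps_nil mul0r.
exists (n * J)%N => L nL.
have -> : Pg 0 = b 0 by rewrite eP' (PgE 0%N 0%N) // coef0_witt_poly mulr1.
rewrite divr1 exprz_exp mulrN1; congr (_ * _).
pose r := [seq (i.+1, j.+1) | i <- iota 0 L, j <- iota 0 J].
rewrite /cross_product (fsbigE r).
- rewrite big_mkcond big_allpairs_dep /root_product -(big_mkord xpredT (fun i => \prod_(y <- radicals i.+1 (alpha i)) q.[lam y])).
  rewrite /index_iota subn0; apply: eq_bigr => i _.
  transitivity (\prod_(j <- iota 0 J) \prod_(y <- radicals i.+1 (alpha i)) (1 - b (- j.+1%:Z) * lam y ^+ j.+1)).
    apply: eq_bigr => j _; rewrite mem_set //= prod_radicals_exp //.
    by rewrite a_pos.
  rewrite exchange_big; apply: eq_bigr => y _.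
  rewrite eq2 /witt_poly horner_prod -(big_mkord xpredT (fun j => (1 - b (- j.+1%:Z) *: 'X^(j.+1)).[lam y])).
  rewrite /index_iota subn0; apply: eq_bigr => j _.
  by rewrite !hornerE.
- by apply: allpairs_uniq; rewrite ?iota_uniq // => -[? ?] [? ?] _ _ [-> ->].
- by move=> _ /allpairsP[[i j] [_ _ ->]].
- move=> [i j] /= /andP[i0 j0] ij.
  have H i' j' : (L <= i')%N || (J <= j')%N -> b (- j'.+1%:Z) ^+ (i'.+1 %/ gcdn i'.+1 j'.+1) = 0.
    case: (leqP J j') => [Jj _|jJ /orP[Li|//]].
      by rewrite bJ // expr0n gtn_eqF // divn_gt0 ?gcdn_gt0 // dvdn_leq // dvdn_gcdl.
    have [ni|] := leqP n (i'.+1 %/ gcdn i'.+1 j'.+1).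
      by rewrite -(subnK ni) exprD b_nil mulr0.
    have gj : (gcdn i'.+1 j'.+1 <= J)%N by apply: leq_trans jJ; rewrite dvdn_leq // dvdn_gcdr.
    rewrite ltn_divLR ?gcdn_gt0 // => /leq_trans/(_ (leq_mul (leqnn n) gj)).
    by have := leq_trans nL Li; lia.
  rewrite -(prednK i0) -(prednK j0) H ?mulr0 ?subr0 ?expr1n //.
  apply/negPn; rewrite negb_or -!ltnNge; apply: contra ij => /andP[iL jJ].
  apply/allpairsP; exists (i.-1, j.-1); rewrite !mem_iota !prednK //=; split=> //; lia.
Qed.
End Symbol.

(** * Determinants of multiplications in an adic lattice *)

(** The value p(z), with the coefficients mapped by iota. *)
Definition hev (F V : comNzRingType) (iota : {rmorphism F -> V}) (z : V) : {poly F} -> V :=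
  horner_eval z \o map_poly iota.
HB.instance Definition _ F V iota z := GRing.RMorphism.on (@hev F V iota z).

Section Hev.
Variables (F V : comNzRingType) (iota : {rmorphism F -> V}) (z : V).
Lemma hevC a : hev iota z a%:P = iota a.
Proof. by rewrite /hev /= map_polyC /horner_eval hornerC. Qed.
Lemma hevX : hev iota z 'X = z.
Proof. by rewrite /hev /= map_polyX /horner_eval hornerX. Qed.
Lemma hevXn m : hev iota z 'X^m = z ^+ m.
Proof. by rewrite rmorphXn /= hevX. Qed.
Lemma hevZ a p : hev iota z (a *: p) = iota a * hev iota z p.
Proof. by rewrite -mul_polyC rmorphM /= hevC. Qed.
Lemma hev_wide m (p : {poly F}) : (size p <= m)%N -> hev iota z p = \sum_(i < m) iota p`_i * z ^+ i.
Proof.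
move=> pm; have -> : p = \poly_(i < m) p`_i.
  by apply/polyP => i; rewrite coef_poly; case: ltnP => // mi; rewrite nth_default // (leq_trans pm).
rewrite poly_def rmorph_sum; apply: eq_bigr => i _; rewrite /= hevZ hevXn; congr (iota _ * _).
by rewrite -poly_def coef_poly ltn_ord.
Qed.
Lemma hev_head p : hev iota z p = iota p`_0 + z * hev iota z (drop_poly 1 p).
Proof. by rewrite {1}(poly_head p) rmorphD rmorphM /= hevC hevX. Qed.
End Hev.

(** O is an F-algebra and sg a regular element of it: O / sg^(L+1) O is studied
    as a module over F[sg] / sg^(L+1). *)
Definition adic_lattice (F : fieldType) (V : comNzRingType) (iota : {rmorphism F -> V}) (sg : V)
    (O : set V) :=
  [/\ forall u v, O u -> O v -> O (u - v), forall u v, O u -> O v -> O (u * v),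
      forall a, O (iota a), O sg & injective ( *%R sg)].

Section AdicBasis.
Variables (F : fieldType) (V : comNzRingType) (iota : {rmorphism F -> V}) (sg : V) (O : set V).
Hypothesis ad : adic_lattice iota sg O.

Let OB u v : O u -> O v -> O (u - v). Proof. by have [H _ _ _ _] := ad; apply: H. Qed.
Let OM u v : O u -> O v -> O (u * v). Proof. by have [_ H _ _ _] := ad; apply: H. Qed.
Let Ocst a : O (iota a). Proof. by have [_ _ H _ _] := ad. Qed.
Let Osg : O sg. Proof. by have [_ _ _ H _] := ad. Qed.
Let sgI : injective ( *%R sg). Proof. by have [_ _ _ _ H] := ad. Qed.

Lemma adic0 : O 0. Proof. by rewrite -(rmorph0 iota). Qed.
Lemma adic1 : O 1. Proof. by rewrite -(rmorph1 iota). Qed.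
Lemma adicN u : O u -> O (- u). Proof. by rewrite -sub0r; apply: OB adic0. Qed.
Lemma adicD u v : O u -> O v -> O (u + v).
Proof. by move=> Ou Ov; rewrite -[v]opprK; apply: OB => //; apply: adicN. Qed.
Lemma adic_sum I (r : seq I) (P : pred I) (E : I -> V) :
  (forall j, P j -> O (E j)) -> O (\sum_(j <- r | P j) E j).
Proof. by move=> H; elim/big_rec: _ => [|j v Pj Ov]; [exact: adic0|apply: adicD; auto]. Qed.
Lemma adicX u m : O u -> O (u ^+ m).
Proof. by move=> Ou; elim: m => [|m IH]; [exact: adic1|rewrite exprS; apply: OM]. Qed.
Lemma adic_hev p : O (hev iota sg p).
Proof.
elim/poly_ind: p => [|p c IH]; first by rewrite rmorph0; exact: adic0.
by rewrite rmorphD rmorphM /= hevX hevC; apply: adicD => //; apply: OM.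
Qed.

(** The family tau is a basis of the F-vector space O / sg O, and hence of O /
    sg^(L+1) O over F[sg] / sg^(L+1) for all L. *)
Definition adic_basis n (tau : 'I_n -> V) :=
  [/\ forall j, O (tau j),
      forall h, O h -> exists a : 'I_n -> F, exists2 h', O h' & h = \sum_j iota (a j) * tau j + sg * h'
    & forall (a : 'I_n -> F) h', O h' -> \sum_j iota (a j) * tau j = sg * h' -> forall j, a j = 0].

(** Congruence modulo sg^L O. *)
Definition eqL L u v := exists2 h, O h & u - v = sg ^+ L * h.

Section Cong.
Variable L : nat.
Notation "u == v" := (eqL L u v).
Lemma eqL_refl u : u == u.
Proof. by exists 0; [exact: adic0|rewrite subrr mulr0]. Qed.
Lemma eqL_sym u v : u == v -> v == u.
Proof. by move=> [h Oh e]; exists (- h); [exact: adicN|rewrite mulrN -e opprB]. Qed.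
Lemma eqL_trans u v w : u == v -> v == w -> u == w.
Proof.
move=> [h Oh e] [h' Oh' e']; exists (h + h'); first exact: adicD.
by rewrite mulrDr -e -e'; ring.
Qed.
Lemma eqLD u v u' v' : u == v -> u' == v' -> u + u' == v + v'.
Proof.
move=> [h Oh e] [h' Oh' e']; exists (h + h'); first exact: adicD.
by rewrite mulrDr -e -e'; ring.
Qed.
Lemma eqLB u v u' v' : u == v -> u' == v' -> u - u' == v - v'.
Proof.
move=> [h Oh e] [h' Oh' e']; exists (h - h'); first exact: OB.
by rewrite mulrBr -e -e'; ring.
Qed.
Lemma eqLM w u v : O w -> u == v -> w * u == w * v.
Proof. by move=> Ow [h Oh e]; exists (w * h); [exact: OM|rewrite -mulrBr e; ring]. Qed.
Lemma eqL_sum I (r : seq I) (P : pred I) (E E' : I -> V) :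
  (forall j, P j -> E j == E' j) -> \sum_(j <- r | P j) E j == \sum_(j <- r | P j) E' j.
Proof.
by move=> H; elim/big_rec2: _ => [|j u v Pj uv]; [exact: eqL_refl|apply: eqLD; auto].
Qed.
End Cong.

Section Basis.
Variables (n : nat) (tau : 'I_n -> V).
Hypothesis tauP : adic_basis tau.

(** Successive approximation modulo the powers of sg. *)
Lemma adic_expansion L h : O h -> exists c : 'I_n -> {poly F},
  eqL L h (\sum_j hev iota sg (c j) * tau j).
Proof.
have [Ot ex _] := tauP; elim: L h => [|L IH] h Oh.
  exists (fun=> 0); exists h => //; rewrite big1 ?subr0 ?mul1r // => j _.
  by rewrite rmorph0 mul0r.
have [a [h' Oh' ->]] := ex _ Oh; have [c [r Or e]] := IH _ Oh'.
exists (fun j => (a j)%:P + 'X * c j); exists r => //.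
have -> : \sum_j hev iota sg ((a j)%:P + 'X * c j) * tau j =
    \sum_j iota (a j) * tau j + \sum_j sg * (hev iota sg (c j) * tau j).
  rewrite -big_split; apply: eq_bigr => j _.
  by rewrite rmorphD rmorphM /= hevC hevX mulrDl mulrA.
by rewrite exprS -mulrA -e mulrBr mulr_sumr opprD addrACA subrr add0r.
Qed.

Lemma adic_expansion0 L (c : 'I_n -> {poly F}) :
  eqL L (\sum_j hev iota sg (c j) * tau j) 0 -> forall j i, (i < L)%N -> (c j)`_i = 0.
Proof.
have [Ot _ indep] := tauP; elim: L c => [//|L IH] c [r Or]; rewrite subr0 => e.
have sE : \sum_j hev iota sg (c j) * tau j = \sum_j iota (c j)`_0 * tau j +
    sg * \sum_j hev iota sg (drop_poly 1 (c j)) * tau j.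
  by rewrite mulr_sumr -big_split; apply: eq_bigr => j _; rewrite hev_head mulrDl mulrA.
have c0 j : (c j)`_0 = 0.
  apply: (indep (fun j => (c j)`_0) (sg ^+ L * r - \sum_j hev iota sg (drop_poly 1 (c j)) * tau j)).
    apply: OB; first by apply: OM => //; apply: adicX.
    by apply: adic_sum => i _; apply: OM => //; apply: adic_hev.
  by rewrite mulrBr mulrA -exprS -e sE addrK.
move=> j [|i] iL; first exact: c0.
rewrite -addn1 -coef_drop_poly; apply: (IH (fun j => drop_poly 1 (c j))) => //.
have s0 : \sum_j iota (c j)`_0 * tau j = 0.
  by rewrite big1 // => l _; rewrite c0 rmorph0 mul0r.
by exists r => //; rewrite subr0; apply: sgI; rewrite mulrA -exprS -e sE s0 add0r.
Qed.

Variable L : nat.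
Local Notation A := (trunc L F).
Local Notation red := (in_qpoly ('X^(L.+1) : {poly F})).

Lemma adic_unique (c c' : 'I_n -> {poly F}) :
  eqL L.+1 (\sum_j hev iota sg (c j) * tau j) (\sum_j hev iota sg (c' j) * tau j) ->
  forall j, red (c j) = red (c' j).
Proof.
move=> H j; apply/eq_trunc => i iL; apply/eqP; rewrite -subr_eq0 -coefB; apply/eqP.
apply: (@adic_expansion0 L.+1 (fun j => c j - c' j)) => //.
rewrite (_ : \sum_j _ = \sum_j hev iota sg (c j) * tau j - \sum_j hev iota sg (c' j) * tau j).
  by case: H => h Oh e; exists h; rewrite ?subr0.
by rewrite -sumrB; apply: eq_bigr => l _; rewrite rmorphB mulrBl.
Qed.

(** M is the matrix of the family u in the basis tau, modulo sg^(L+1). *)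
Definition is_mx m (u : 'I_m -> V) (M : 'M[{poly F}]_(m, n)) :=
  forall i, eqL L.+1 (u i) (\sum_j hev iota sg (M i j) * tau j).

Lemma is_mx_exists m (u : 'I_m -> V) : (forall i, O (u i)) -> exists M, is_mx u M.
Proof.
move=> Ou; have /choice [c cE] := fun i => adic_expansion L.+1 (Ou i).
by exists (\matrix_(i, j) c i j) => i; under eq_bigr do rewrite mxE.
Qed.

Lemma is_mx_unique m (u : 'I_m -> V) (M N : 'M[{poly F}]_(m, n)) :
  is_mx u M -> is_mx u N -> map_mx red M = map_mx red N.
Proof.
move=> uM uN; apply/matrixP => i j; rewrite !mxE.
by apply: (adic_unique (c := fun j => M i j) (c' := fun j => N i j)); apply: eqL_trans (eqL_sym _) _.
Qed.

Lemma is_mx_eqL m (u v : 'I_m -> V) M : (forall i, eqL L.+1 (u i) (v i)) -> is_mx u M -> is_mx v M.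
Proof. by move=> uv uM i; apply: eqL_trans (eqL_sym (uv i)) _. Qed.

Lemma is_mx_id : is_mx tau 1%:M.
Proof.
move=> i; rewrite (bigD1 i) //= big1 ?addr0 => [|j ji]; rewrite mxE.
  by rewrite eqxx rmorph1 mul1r; apply: eqL_refl.
by rewrite eq_sym (negPf ji) rmorph0 mul0r.
Qed.

Lemma is_mx_lin m l (u : 'I_m -> V) (B : 'M[{poly F}]_(m, n)) (M : 'M[{poly F}]_(l, m)) (v : 'I_l -> V) :
  is_mx u B -> (forall i, eqL L.+1 (v i) (\sum_j hev iota sg (M i j) * u j)) -> is_mx v (M *m B).
Proof.
move=> uB vM i; apply: eqL_trans (vM i) _.
have -> : \sum_j hev iota sg ((M *m B) i j) * tau j =
   \sum_j hev iota sg (M i j) * \sum_l hev iota sg (B j l) * tau l.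
  under eq_bigr => j _ do rewrite mxE rmorph_sum mulr_suml.
  rewrite exchange_big /=; apply: eq_bigr => j _; rewrite mulr_sumr; apply: eq_bigr => k _.
  by rewrite rmorphM mulrA.
by apply: eqL_sum => j _; apply: eqLM => //; apply: adic_hev.
Qed.

(** Row i of M gives h tau_i; products are therefore reversed. *)
Definition mul_mx h (M : 'M[{poly F}]_n) := is_mx (fun i => h * tau i) M.

Lemma mul_mx_unique h M N : mul_mx h M -> mul_mx h N -> map_mx red M = map_mx red N.
Proof. exact: is_mx_unique. Qed.
Lemma mul_mxM h h' M N : O h -> mul_mx h M -> mul_mx h' N -> mul_mx (h * h') (N *m M).
Proof.
move=> Oh hM hN; apply: (is_mx_lin (u := fun i => h * tau i)) => // i.
rewrite -mulrA; have [Ot _ _] := tauP.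
apply: eqL_trans (eqLM Oh (hN i)) _; rewrite mulr_sumr.
by apply: eqL_sum => j _; rewrite mulrCA; apply: eqL_refl.
Qed.
Lemma mul_mx_hev p : mul_mx (hev iota sg p) p%:M.
Proof.
move=> i; rewrite (bigD1 i) //= big1 ?addr0 => [|j ji]; rewrite mxE.
  by rewrite eqxx mulr1n; apply: eqL_refl.
by rewrite eq_sym (negPf ji) rmorph0 mul0r.
Qed.
Lemma mul_mxB h h' M N : mul_mx h M -> mul_mx h' N -> mul_mx (h - h') (M - N).
Proof.
move=> hM hN i; rewrite mulrBl; under eq_bigr => j _ do rewrite !mxE rmorphB mulrBl.
by rewrite sumrB; apply: eqLB.
Qed.
Lemma mul_mx_eqL h h' M : eqL L.+1 h h' -> mul_mx h M -> mul_mx h' M.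
Proof.
move=> hh; apply: is_mx_eqL => i; have [Ot _ _] := tauP.
by rewrite ![_ * tau i]mulrC; apply: eqLM.
Qed.
End Basis.

(** The change of basis B is invertible modulo X^(L+1), and M B = B N. *)
Lemma mul_mx_det n (tau v : 'I_n -> V) L h M N :
  adic_basis tau -> adic_basis v -> O h ->
  mul_mx tau L h N -> mul_mx v L h M ->
  in_qpoly ('X^(L.+1) : {poly F}) (\det M) = in_qpoly 'X^(L.+1) (\det N).
Proof.
move=> tb vb Oh hN hM; set red := in_qpoly _.
have [Ot _ _] := tb; have [Ov _ _] := vb.
have [B vB] := is_mx_exists tb L Ov; have [B' tB'] := is_mx_exists vb L Ot.
have e1 : map_mx red (M *m B) = map_mx red (B *m N).
  apply: (is_mx_unique tb (u := fun i => h * v i)); first exact: (is_mx_lin vB).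
  apply: (is_mx_lin (u := fun i => h * tau i)) => // i.
  apply: eqL_trans (eqLM Oh (vB i)) _; rewrite mulr_sumr.
  by apply: eqL_sum => j _; rewrite mulrCA; apply: eqL_refl.
have e2 : map_mx red (B' *m B) = map_mx red 1%:M.
  by apply: (is_mx_unique tb (u := tau)); [exact: (is_mx_lin vB)|exact: is_mx_id].
have := congr1 determinant e2; rewrite !det_map_mx det_mulmx det1 rmorph1 rmorphM => uB.
have := congr1 determinant e1; rewrite !det_map_mx !det_mulmx !rmorphM => e.
have := congr1 ( *%R (red (\det B'))) e.
by rewrite mulrCA uB mulr1 mulrA uB mul1r.
Qed.

Section HasDet.
Variables (n : nat) (tau : 'I_n -> V) (L : nat).
Hypothesis tauP : adic_basis tau.
Local Notation red := (in_qpoly ('X^(L.+1) : {poly F})).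

(** The multiplication by h on O / sg^(L+1) O has the determinant d modulo
    X^(L+1), where X stands for sg. *)
Definition has_det h (d : {poly F}) :=
  O h /\ exists2 M, mul_mx tau L h M & red (\det M) = red d.

Lemma has_det_exists h : O h -> exists d, has_det h d.
Proof.
move=> Oh; have [Ot _ _] := tauP.
have [M hM] := is_mx_exists tauP L (fun i => OM Oh (Ot i)).
by exists (\det M); split=> //; exists M.
Qed.
Lemma has_det_mx h M : O h -> mul_mx tau L h M -> has_det h (\det M).
Proof. by move=> Oh hM; split=> //; exists M. Qed.
Lemma has_detM h h' d d' : has_det h d -> has_det h' d' -> has_det (h * h') (d * d').
Proof.
move=> [Oh [M hM Md]] [Oh' [M' hM' Md']]; split; first exact: OM.
exists (M' *m M); first exact: mul_mxM.
by rewrite det_mulmx mulrC !rmorphM /= Md Md'.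
Qed.
Lemma has_det_hev p : has_det (hev iota sg p) (p ^+ n).
Proof.
split; first exact: adic_hev.
by exists p%:M; [exact: mul_mx_hev|rewrite det_scalar].
Qed.
Lemma has_det1 : has_det 1 1.
Proof. by have := has_det_hev 1; rewrite rmorph1 expr1n. Qed.
Lemma has_detX h d m : has_det h d -> has_det (h ^+ m) (d ^+ m).
Proof.
by move=> hd; elim: m => [|m IH]; [exact: has_det1|rewrite !exprS; apply: has_detM].
Qed.
Lemma has_det_prod I (r : seq I) (P : pred I) (E : I -> V) (D : I -> {poly F}) :
  (forall i, P i -> has_det (E i) (D i)) ->
  has_det (\prod_(i <- r | P i) E i) (\prod_(i <- r | P i) D i).
Proof.
by move=> H; elim/big_rec2: _ => [|i h d Pi]; [exact: has_det1|apply: has_detM; auto].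
Qed.
Lemma has_det_unique h h' d d' : eqL L.+1 h h' -> has_det h d -> has_det h' d' -> red d = red d'.
Proof.
move=> hh [_ [M hM <-]] [_ [M' hM' <-]].
have := mul_mx_unique tauP (mul_mx_eqL tauP hh hM) hM'.
by move/(congr1 determinant); rewrite !det_map_mx.
Qed.
End HasDet.

Lemma has_det_basis n (tau v : 'I_n -> V) L h d d' : adic_basis tau -> adic_basis v ->
  has_det tau L h d -> has_det v L h d' -> in_qpoly ('X^(L.+1) : {poly F}) d = in_qpoly 'X^(L.+1) d'.
Proof.
move=> tb vb [Oh [M hM <-]] [_ [M' hM' <-]].
by rewrite (mul_mx_det tb vb Oh hM hM').
Qed.

End AdicBasis.

(** * Companion matrices *)

Section Companion.
Variables (R : comNzRingType) (e : nat) (c : 'I_e -> R).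
(** The companion matrix of T^e - sum c_j T^j, acting on row vectors. *)
Definition compmx : 'M[R]_e :=
  \matrix_(i, j) if (i == e.-1 :> nat) then c j else (i.+1 == j :> nat)%:R.
Definition comp_poly_tail : {poly R} := \sum_(j < e) c j *: 'X^j.

Lemma size_comp_poly_tail : (size comp_poly_tail <= e)%N.
Proof.
apply/leq_sizeP => i ei; rewrite coef_sum big1 // => j _.
by rewrite coefZ coefXn gtn_eqF ?mulr0 // (leq_trans (ltn_ord j)).
Qed.
Lemma coef_comp_poly_tail (j : 'I_e) : comp_poly_tail`_j = c j.
Proof.
rewrite coef_sum (bigD1 j) //= coefZ coefXn eqxx mulr1 big1 ?addr0 // => i ij.
by rewrite coefZ coefXn eq_sym val_eqE (negPf ij) mulr0.
Qed.

Lemma char_poly_compmx : char_poly compmx = 'X^e - comp_poly_tail.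
Proof.
set p := _ - _; have st : (size (- comp_poly_tail) < size ('X^e : {poly R}))%N.
  by rewrite size_polyN size_polyXn ltnS size_comp_poly_tail.
have pm : p \is monic by rewrite monicE lead_coefDl // lead_coefXn.
have sp : (size p).-1 = e by rewrite size_polyDl // size_polyXn.
have pc (j : 'I_e) : - p`_j = c j.
  by rewrite coefB coefXn ltn_eqF // sub0r opprK coef_comp_poly_tail.
have -> : compmx = \matrix_(i, j) if (i == e.-1 :> nat) then - p`_j else (i.+1 == j :> nat)%:R.
  by apply/matrixP => i j; rewrite !mxE pc.
by move: {pc} e sp => _ <-; apply: companionmxK.
Qed.

Lemma det_compmx (j0 : 'I_e) : val j0 = 0%N -> \det compmx = (-1) ^+ e.+1 * c j0.
Proof.
move=> j00; have := char_poly_det compmx; rewrite char_poly_compmx coefB coefXn.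
have -> : (0 == e)%N = false by rewrite ltn_eqF // (leq_ltn_trans (leq0n j0)).
rewrite sub0r -{1}j00 coef_comp_poly_tail => H.
by rewrite exprS -mulrA mulN1r -mulrN H mulrA -expr2 sqrr_sign mul1r.
Qed.

Lemma det_sub_compmx (z : R) : \det (z%:M - compmx) = z ^+ e - \sum_(j < e) c j * z ^+ j.
Proof.
have -> : \det (z%:M - compmx) = ('X^e - comp_poly_tail).[z].
  rewrite -char_poly_compmx /char_poly -horner_evalE -det_map_mx; congr (\det _).
  by apply/matrixP => i j; rewrite /char_poly_mx !mxE rmorphB rmorphMn /= /horner_eval hornerX hornerC.
rewrite hornerD hornerXn hornerN horner_sum; congr (_ - _).
by apply: eq_bigr => j _; rewrite hornerZ hornerXn.
Qed.
End Companion.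

Lemma det_1sub_compmx (F : fieldType) e (c : 'I_e -> {poly F}) (y : F) :
  \det (1%:M - y%:P *: compmx c) = 1 - \sum_(j < e) y ^+ (e - j) *: c j.
Proof.
have [->|y0] := eqVneq y 0.
  rewrite polyC0 scale0r subr0 det1 big1 ?subr0 // => j _.
  by rewrite expr0n subn_eq0 leqNgt ltn_ord scale0r.
have -> : 1%:M - y%:P *: compmx c = y%:P *: ((y^-1)%:P%:M - compmx c).
  by rewrite scalerBr scale_scalar_mx -polyCM divff.
rewrite detZ det_sub_compmx mulrBr -exprMn -rmorphM /= divff // expr1n; congr (_ - _).
rewrite mulr_sumr; apply: eq_bigr => j _.
rewrite mulrCA -!polyC_exp -polyCM mulrC mul_polyC; congr (_ *: _).
by rewrite exprVn expfB.
Qed.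

(** * The lattice F[[t]] over F[[sigma]] *)

Section LocalLattice.
Variables (F : closedFieldType) (e : nat) (sg x : laurent F).
Hypotheses (e0 : (0 < e)%N) (sge : vanish_below e sg) (xe : vanish_below (- e%:Z) x)
  (xsg : x * sg = 1).
Local Notation Lc := (@lcst F).

(** F[[t]], seen as a module over F[[sg]] for a series sg of order e, with the
    basis 1, t, ..., t^(e-1). *)
Definition lattice : set (laurent F) := [set h | vanish_below 0 h].
Local Notation O := lattice.
Definition tbasis (j : 'I_e) : laurent F := tpow F j.

Lemma lat_B u v : O u -> O v -> O (u - v). Proof. exact: vanish_belowB. Qed.
Lemma lat_M u v : O u -> O v -> O (u * v). Proof. exact: vanish_belowM0. Qed.
Lemma lat_cst a : O (Lc a). Proof. exact: vanish_below_cst. Qed.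
Lemma lat_sg : O sg. Proof. exact: vanish_belowW sge. Qed.
Lemma lat_sgI : injective ( *%R sg).
Proof. by move=> u v /(congr1 ( *%R x)); rewrite !mulrA xsg !mul1r. Qed.
Lemma lat_tpow (i : nat) : O (tpow F i).
Proof. by apply: vanish_belowW (@vanish_below_tpow F i%:Z). Qed.

Lemma lat_adic : adic_lattice lcst sg O.
Proof. by split; [exact: lat_B|exact: lat_M|exact: lat_cst|exact: lat_sg|exact: lat_sgI]. Qed.

Notation eqL := (eqL sg O).

Lemma eqL_vanish L (u v : laurent F) : vanish_below (e * L)%N (u - v) -> eqL L u v.
Proof.
move=> uv; exists ((u - v) * x ^+ L); last first.
  by rewrite mulrCA -exprMn mulrC (mulrC sg) xsg expr1n mul1r.
have := vanish_belowM uv (vanish_belowX (n := L) xe).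
by apply: vanish_belowW; lia.
Qed.
Lemma vanish_eqL L (u v : laurent F) : eqL L u v -> vanish_below (e * L)%N (u - v).
Proof.
move=> [h Oh ->]; have := vanish_belowM (vanish_belowX (n := L) sge) Oh.
by apply: vanish_belowW; lia.
Qed.

Lemma lcoef_tsum (a : 'I_e -> F) (i : int) : (\sum_(j < e) Lc (a j) * tbasis j) i =
  \sum_(j < e) (if i == j%:Z then a j else 0).
Proof.
rewrite lcoef_sum; apply: eq_bigr => j _.
by rewrite (lcoef_cstM (a j) (tbasis j)) lcoef_monomialE; case: ifP; rewrite ?mulr1 ?mulr0.
Qed.
Lemma lcoef_tsum_ord (a : 'I_e -> F) (i : 'I_e) : (\sum_j Lc (a j) * tbasis j) i%:Z = a i.
Proof.
rewrite lcoef_tsum (bigD1 i) //= eqxx big1 ?addr0 // => j ji.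
by rewrite ifN //; apply: contra ji => /eqP[ij]; apply/eqP/val_inj.
Qed.

Lemma tbasisP : adic_basis Lc sg O tbasis.
Proof.
split.
- by move=> j; apply: lat_tpow.
- move=> h Oh; exists (fun j : 'I_e => h j%:Z).
  set s := \sum_j _; have [|h' Oh' he] := @eqL_vanish 1 h s; last first.
    by exists h' => //; rewrite -[h](subrK s) he expr1 addrC.
  rewrite muln1 => i ie; rewrite lcoefB; case: (ltP i 0) => i0.
    rewrite Oh // /s lcoef_tsum big1 ?subr0 // => j _.
    by rewrite ifN //; apply/eqP => ij; move: i0; rewrite ij.
  have [i' i'E] : exists i' : nat, i = i'%:Z by exists `|i|%N; lia.
  rewrite i'E in ie *; have ie' : (i' < e)%N by lia.
  by rewrite -[i']/(val (Ordinal ie')) lcoef_tsum_ord subrr.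
- move=> a h' Oh' E j; rewrite -(lcoef_tsum_ord a) E.
  by apply: (vanish_belowM sge Oh'); rewrite addr0; have := ltn_ord j; lia.
Qed.

Lemma mul_mx_t L (c : 'I_e -> {poly F}) :
  eqL L.+1 (tpow F e) (\sum_j hev Lc sg (c j) * tbasis j) ->
  mul_mx Lc sg O tbasis L (tpow F 1) (compmx c).
Proof.
move=> H i; rewrite /tbasis tpowD; have [ie|ie] := eqVneq (nat_of_ord i) e.-1.
  have -> : 1 + i%:Z = e%:Z by rewrite ie; lia.
  by under eq_bigr => j _ do rewrite mxE ie eqxx.
have i1 : (i.+1 < e)%N by have := ltn_ord i; move: ie => /eqP; lia.
rewrite (bigD1 (Ordinal i1)) //= big1 ?addr0 => [|j ji].
  rewrite mxE (negPf ie) eqxx rmorph1 mul1r; have -> : 1 + i%:Z = i.+1%:Z by lia.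
  exact: (eqL_refl lat_adic).
rewrite mxE (negPf ie) [_ == _ :> nat](_ : _ = false) ?rmorph0 ?mul0r //.
by apply/eqP => ij; case/eqP: ji; apply/val_inj.
Qed.

(** The Weierstrass polynomial of t over F[[sg]], truncated: t satisfies T^e =
    sum c_j(sg) T^j modulo sg^(L+1). *)
Definition is_weierstrass L (c : 'I_e -> {poly F}) :=
  eqL L.+1 (tpow F e) (\sum_j hev Lc sg (c j) * tbasis j).

Lemma weierstrass_exists L : exists c, is_weierstrass L c.
Proof. exact: (adic_expansion tbasisP _ (lat_tpow _)). Qed.

Let j0 := Ordinal e0.

(** t^e is 0 modulo sg: the polynomial is distinguished. *)
Lemma weierstrass0 L c : is_weierstrass L c -> forall j, (c j)`_0 = 0.
Proof.
move=> wc j.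
suff H : eqL 1 (\sum_j hev Lc sg (c j) * tbasis j) 0.
  exact: (adic_expansion0 lat_adic tbasisP H).
apply: (eqL_trans lat_adic (eqL_sym lat_adic _)); last first.
  by apply: eqL_vanish; rewrite subr0 muln1; exact: vanish_below_tpow.
by apply: eqL_vanish; apply: vanish_belowW (vanish_eqL wc); lia.
Qed.

(** Comparison of the coefficients of t^e: only c_0(sg) contributes, by its
    linear term. *)
Lemma weierstrass1 L c : (0 < L)%N -> is_weierstrass L c -> sg e * (c j0)`_1 = 1.
Proof.
move=> L0 wc; have := vanish_eqL wc (i := e%:Z) _; rewrite lcoefB => /(_ _).
have -> : tpow F e e = 1 by rewrite lcoef_monomialE eqxx.
move=> H; apply/esym/eqP; rewrite -subr_eq0; apply/eqP.
rewrite -[RHS]H; last by rewrite ltz_nat; nia.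
congr (_ - _); rewrite lcoef_sum (bigD1 j0) //= /tbasis tpow0 mulr1.
rewrite hev_head (weierstrass0 wc) rmorph0 add0r.
have vb p : vanish_below 0 (hev Lc sg p) by apply: (adic_hev lat_adic).
have := lcoefM_lead sge (vb (drop_poly 1 (c j0))); rewrite addr0 => ->.
rewrite [in X in _ = X + _]hev_head.
rewrite lcoefD lcoef_monomialE eqxx coef_drop_poly add0n (vanish_belowM sge (vb _)) ?addr0 //.
rewrite big1 ?addr0 // => j jj.
rewrite hev_head (weierstrass0 wc) rmorph0 add0r.
have v := vanish_belowM (vanish_belowM sge (vb (drop_poly 1 (c j)))) (@vanish_below_tpow F j%:Z).
apply: v.
have : (0 < j)%N by rewrite lt0n; apply: contra jj => /eqP j00; apply/eqP/val_inj.
by rewrite addr0; lia.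
Qed.

(** P is a0 times a product of factors 1 - y t up to high order, and the
    multiplication by t has the companion matrix of the Weierstrass polynomial.
    The power of sg makes the function regular; a negative w is moved to the
    other side, so that both sides are polynomials. *)
Lemma local_det L c w (P : laurent F) a0 alpha m d Lw :
  is_weierstrass L c -> witt_series P a0 alpha -> (e * L.+1 <= Lw)%N ->
  has_det Lc sg O tbasis L (sg ^+ m * (tpow F w * P)) d ->
  let wp := if 0 <= w then `|w|%N else 0%N in
  let wn := if 0 <= w then 0%N else `|w|%N in
  in_qpoly ('X^(L.+1) : {poly F}) (d * \det (compmx c) ^+ wn) =
  in_qpoly 'X^(L.+1) ('X ^+ (m * e) * a0%:P ^+ e * \det (compmx c) ^+ wp *
    \prod_(i < Lw) \prod_(y <- radicals i.+1 (alpha i)) \det (1%:M - y%:P *: compmx c)).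
Proof.
move=> wc [a0n P0 PE] eL hd wp wn.
have Ct := mul_mx_t wc; have hdM := @has_detM _ _ _ _ _ lat_adic _ _ L tbasisP.
have hdX := @has_detX _ _ _ _ _ lat_adic _ _ L tbasisP.
have hdev := has_det_hev lat_adic (n := e) tbasis L.
have tO : O (tpow F 1) := lat_tpow 1.
have hdt : has_det Lc sg O tbasis L (tpow F 1) (\det (compmx c)) by exact: has_det_mx.
have hdy y : has_det Lc sg O tbasis L (1 - Lc y * tpow F 1) (\det (1%:M - y%:P *: compmx c)).
  apply: has_det_mx; first by apply: lat_B; [exact: (lat_cst 1)|apply: lat_M => //; apply: lat_cst].
  apply: (mul_mxB lat_adic).
    by have := mul_mx_hev lat_adic tbasis L 1; rewrite rmorph1.
  have := mul_mx_hev lat_adic tbasis L y%:P; rewrite hevC => hy.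
  have := mul_mxM lat_adic tbasisP (lat_cst y) hy Ct.
  by rewrite mul_mx_scalar.
have hdp := @has_det_prod _ _ _ _ _ lat_adic _ _ L tbasisP.
have h1 := hdM _ _ _ _ hd (hdX _ _ wn hdt).
have h2 : has_det Lc sg O tbasis L (sg ^+ m * Lc a0 * tpow F 1 ^+ wp *
    \prod_(i < Lw) \prod_(y <- radicals i.+1 (alpha i)) (1 - Lc y * tpow F 1))
  ('X ^+ (m * e) * a0%:P ^+ e * \det (compmx c) ^+ wp *
    \prod_(i < Lw) \prod_(y <- radicals i.+1 (alpha i)) \det (1%:M - y%:P *: compmx c)).
  apply: (hdM); last by apply: (hdp) => i _; apply: (hdp) => y _; exact: hdy.
  apply: (hdM); last exact: hdX.
  have -> : 'X ^+ (m * e) * a0%:P ^+ e = (a0 *: 'X^m) ^+ e :> {poly F}.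
    by rewrite -mul_polyC exprMn -exprM mulrC.
  by have := hdev (a0 *: 'X^m); rewrite hevZ hevXn mulrC.
apply: (has_det_unique lat_adic tbasisP _ h1 h2).
have prodE : \prod_(i < Lw) \prod_(y <- radicals i.+1 (alpha i)) (1 - Lc y * tpow F 1) =
   pev (tpow F 1) (witt_poly alpha Lw).
  rewrite rmorph_prod; apply: eq_bigr => i _.
  have -> : 1 - alpha i *: 'X^(i.+1) = \prod_(y <- radicals i.+1 (alpha i)) (1 - y *: 'X).
    by apply: closed_poly_ext => z; rewrite horner_prod; under [RHS]eq_bigr do rewrite !hornerE; rewrite prod_radicals // !hornerE.
  rewrite rmorph_prod; apply: eq_bigr => y _.
  by rewrite rmorphB rmorph1 /= pevZ pevX.
rewrite prodE; apply: eqL_vanish; rewrite !tpowX.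
have -> : sg ^+ m * (tpow F w * P) * tpow F (1 *+ wn) - sg ^+ m * Lc a0 * tpow F (1 *+ wp) *
   pev (tpow F 1) (witt_poly alpha Lw) =
  sg ^+ m * (tpow F (1 *+ wp) * (P - Lc a0 * pev (tpow F 1) (witt_poly alpha Lw))).
  have wE : w + (1 *+ wn) = 1 *+ wp by rewrite /wn /wp; case: ifP; lia.
  by rewrite -wE -tpowD; ring.
have v1 : vanish_below Lw.+1 (P - Lc a0 * pev (tpow F 1) (witt_poly alpha Lw)).
  move=> i iL; rewrite lcoefB (lcoef_cstM a0 (pev _ _)); case: (ltP i 0) => i0.
    by rewrite P0 // vanish_below_pev_t // mulr0 subr0.
  have [i' i'E] : exists i' : nat, i = i'%:Z by exists `|i|%N; lia.
  by rewrite i'E in iL *; rewrite lcoef_pev_t (PE Lw) ?subrr //; lia.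
have := vanish_belowM (vanish_belowX (n := m) sge) (vanish_belowM (@vanish_below_tpow F (1 *+ wp)) v1).
by apply: vanish_belowW; lia.
Qed.

End LocalLattice.

(** * The triangular decomposition of 1 - delta x *)

Section WeierstrassSymbol.
Variables (F : closedFieldType) (k : comUnitRingType) (lam : {rmorphism F -> k})
  (rho : {rmorphism k -> F}) (eps : k) (n : nat).
Hypotheses (lamK : cancel lam rho) (eps_nil : eps ^+ n = 0)
  (rho_ker : forall x, rho x = 0 -> exists y, x = eps * y).
Variables (e : nat) (sg x : laurent F).
Hypotheses (e0 : (0 < e)%N) (sge : vanish_below e sg) (xe : vanish_below (- e%:Z) x)
  (xsg : x * sg = 1).
Variables (L : nat) (delta : k) (c : 'I_e -> {poly F}).
Hypotheses (L0 : (0 < L)%N) (deltaL : delta ^+ L = 0) (wc : is_weierstrass sg L c).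
Let sgk := map_laurent lam sg.
Local Notation ev := (hev lam delta).
Let j0 := Ordinal e0.

Lemma rho_delta : rho delta = 0.
Proof.
by apply/eqP; have := congr1 rho deltaL; rewrite rmorphXn rmorph0 => /eqP; rewrite expf_eq0 => /andP[].
Qed.

Lemma rho_ev p : rho (ev p) = p`_0.
Proof. by rewrite hev_head rmorphD rmorphM rho_delta mul0r addr0 lamK. Qed.

Lemma drop_polyMXaddC (p : {poly F}) a : drop_poly 1 (p * 'X + a%:P) = p.
Proof. by apply/polyP => i; rewrite coef_drop_poly addn1 coefD coefMX coefC /= addr0. Qed.

(** The divided difference D = (p(sg) - p(delta)) / (sg - delta), whose constant
    term is (p(0) - p(delta)) / (0 - delta), as sg has positive order; this is
    the value at delta of (p - p(0)) / X. *)
Lemma hev_diff p : exists D : laurent k,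
  [/\ vanish_below 0 D, map_laurent lam (hev lcst sg p) - lcst (ev p) = (sgk - lcst delta) * D &
      D 0 = ev (drop_poly 1 p)].
Proof.
elim/poly_ind: p => [|p a [D [D0 DE _]]].
  by exists 0; split; [exact: vanish_below0|rewrite !rmorph0 subrr mulr0|
     rewrite lcoef0 (_ : drop_poly 1 0 = 0) ?rmorph0 //; apply/polyP => i; rewrite coef_drop_poly !coef0].
have sgk0 : vanish_below 1 sgk by apply: vanish_belowW (vanish_below_map _ sge); lia.
exists (lcst (ev p) + sgk * D); split.
- apply: vanish_belowD; first exact: vanish_below_cst.
  by apply: vanish_belowW (vanish_belowM sgk0 D0); lia.
- have -> : map_laurent lam (hev lcst sg (p * 'X + a%:P)) =
     map_laurent lam (hev lcst sg p) * sgk + lcst (lam a).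
    have -> : hev lcst sg (p * 'X + a%:P) = hev lcst sg p * sg + lcst a.
      by rewrite rmorphD rmorphM /= hevX hevC.
    by rewrite rmorphD rmorphM /= map_lcst.
  have -> : ev (p * 'X + a%:P) = ev p * delta + lam a.
    by rewrite rmorphD rmorphM /= hevX hevC.
  rewrite rmorphD rmorphM /=.
  have -> : map_laurent lam (hev lcst sg p) = (sgk - lcst delta) * D + lcst (ev p).
    by rewrite -DE subrK.
  ring.
- by rewrite drop_polyMXaddC lcoefD (vanish_belowM sgk0 D0) // addr0 lcoef_monomialE.
Qed.

(** The Weierstrass polynomial T^e - sum c_j(delta) T^j, specialized at sg =
    delta and multiplied by T^(-e), as a polynomial in u = 1/T. *)
Definition weierstrass_rev : {poly k} := 1 - \sum_(j < e) ev (c j) *: 'X^(e - j).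

Lemma coef_weierstrass_rev0 : weierstrass_rev`_0 = 1.
Proof.
rewrite coefB coefC coef_sum big1 ?subr0 // => j _.
by rewrite coefZ coefXn ltn_eqF ?mulr0 // subn_gt0.
Qed.

Lemma polar_weierstrass_rev : polar rho weierstrass_rev.
Proof.
split; first exact: coef_weierstrass_rev0.
case=> [//|i] _; rewrite coefB coefC sub0r coef_sum rmorphN rmorph_sum big1 ?oppr0 // => j _.
rewrite coefZ rmorphM rho_ev (weierstrass0 e0 sge xe xsg wc) mul0r //.
Qed.

(** Both sides are the reversed characteristic polynomial of the multiplication
    by t, specialized at sg = delta. *)
Lemma horner_weierstrass_rev y :
  weierstrass_rev.[lam y] = ev (\det (1%:M - y%:P *: compmx c)).
Proof.
rewrite det_1sub_compmx rmorphB rmorph1 hornerD hornerN hornerC rmorph_sum horner_sum.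
congr (_ - _); apply: eq_bigr => j _.
by rewrite /= hevZ hornerZ hornerXn rmorphXn mulrC.
Qed.

(** As t is a zero of the Weierstrass polynomial with coefficients c_j(sg),
    subtracting its value with coefficients c_j(delta) leaves a multiple of sg -
    delta = (1 - delta x) sg. Thus 1 - delta x is the reversed polynomial in
    1/t, divided by a power series; uniqueness of triangular decompositions
    identifies q, and comparing constant terms gives P(0). *)
Lemma weierstrass_triang q Pg :
  triang rho (1 - lcst delta * map_laurent lam x) 0 q Pg ->
  q = weierstrass_rev /\ Pg 0 * ev (drop_poly 1 (c j0)) = lam (c j0)`_1.
Proof.
move=> [gE qp Pg0 Pgu].
have [r Or rE] := wc.
have /choice [D DP] := fun j => hev_diff (c j).
have [DL [DL0 DLE DL1]] := hev_diff 'X^(L.+1).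
have dL1 : drop_poly 1 'X^(L.+1) = 'X^L :> {poly F}.
  by apply/polyP => i; rewrite coef_drop_poly !coefXn addn1.
rewrite dL1 hevXn deltaL in DL1.
have evXL : ev 'X^(L.+1) = 0 by rewrite hevXn exprS deltaL mulr0.
rewrite evXL rmorph0 subr0 in DLE.
pose rk := map_laurent lam r; have rk0 : vanish_below 0 rk := vanish_below_map _ Or.
pose Q' := DL * rk + \sum_(j < e) D j * tpow k j.
have PQ : tpow k e - \sum_(j < e) lcst (ev (c j)) * tpow k j = (sgk - lcst delta) * Q'.
  have := congr1 (map_laurent lam) rE; rewrite rmorphB rmorphM rmorph_sum /= map_tpow.
  rewrite -(hevXn lcst) DLE => e1.
  have -> : tpow k e = (sgk - lcst delta) * DL * rk +
      \sum_(j < e) map_laurent lam (hev lcst sg (c j)) * tpow k j.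
    rewrite -e1; rewrite [X in _ + X](_ : _ = \sum_(i < e) map_laurent lam (hev lcst sg (c i) * tbasis F i)).
      by rewrite subrK.
    by apply: eq_bigr => j _; rewrite rmorphM /= map_tpow.
  rewrite -addrA -sumrB /Q' mulrDr mulrA mulr_sumr; congr (_ + _).
  by apply: eq_bigr => j _; have [_ DE _] := DP j; rewrite -mulrBl DE mulrA.
have Q'0 : vanish_below 0 Q'.
  apply: vanish_belowD; first exact: vanish_belowM0.
  apply: vanish_below_sum => j _; have [Dj0 _ _] := DP j; apply: vanish_belowM0 => //.
  by apply: vanish_belowW (@vanish_below_tpow k j%:Z).
have Q'1 : Q' 0 = ev (drop_poly 1 (c j0)).
  have := lcoefM_lead DL0 rk0; rewrite addr0 /Q' lcoefD => ->.
  rewrite DL1 mul0r add0r lcoef_sum (bigD1 j0) //= tpow0 mulr1; have [_ _ ->] := DP j0.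
  rewrite big1 ?addr0 // => j jj; have [Dj0 _ _] := DP j.
  have v := vanish_belowM Dj0 (@vanish_below_tpow k j); apply: v.
  have : (0 < j)%N by rewrite lt0n; apply: contra jj => /eqP j00; apply/eqP/val_inj.
  by lia.
pose sp := tpow k (- e%:Z) * sgk.
have spE : sgk = tpow k e * sp by rewrite /sp mulrA tpowD subrr mul1r.
have sp0 : vanish_below 0 sp.
  by apply: vanish_below_tpowM; rewrite sub0r opprK; apply: vanish_below_map.
have sp1 : sp 0 = lam (sg e) by rewrite /sp (lcoef_tpowM (- e%:Z) sgk) sub0r opprK.
have revE : tpow k e - \sum_(j < e) lcst (ev (c j)) * tpow k j = tpow k e * pev (tpow k (-1)) weierstrass_rev.
  rewrite /weierstrass_rev rmorphB rmorph1 rmorph_sum mulrBr mulr1 mulr_sumr; congr (_ - _).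
  apply: eq_bigr => j _; rewrite /= pevZ pevXn mulrCA tpowX tpowD; congr (_ * tpow _ _).
  by have := ltn_ord j; lia.
(* the reversed polynomial is 1 - delta x times the power series sp Q' *)
have key : pev (tpow k (-1)) weierstrass_rev * 1 = pev (tpow k (-1)) q * (Pg * (sp * Q')).
  apply: (@tpow_inj _ e); rewrite mulr1 -revE PQ.
  have -> : sgk - lcst delta = (1 - lcst delta * map_laurent lam x) * sgk.
    by rewrite mulrBl mul1r -mulrA -rmorphM xsg rmorph1 mulr1.
  rewrite gE tpow0 mul1r {1}spE; ring.
have spQ0 : vanish_below 0 (sp * Q') by exact: vanish_belowM0.
have u1 : (1 : laurent k) 0 \is a GRing.unit by rewrite -monomial1E lcoef_monomialE unitr1.
have [<- e1] := polar_unique eps_nil rho_ker polar_weierstrass_rev qp (@vanish_below1 _)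
  (vanish_belowM0 Pg0 spQ0) u1 key.
split=> //.
have := congr1 (fun f : laurent k => f 0) e1; rewrite -monomial1E lcoef_monomialE /=.
have := lcoefM_lead Pg0 spQ0; rewrite addr0 => ->.
have := lcoefM_lead sp0 Q'0; rewrite addr0 => ->.
rewrite sp1 Q'1 => e2.
have := congr1 lam (weierstrass1 e0 sge xe xsg L0 wc); rewrite rmorph1 rmorphM => e3.
by rewrite -[LHS]mulr1 -e3 -[RHS]mul1r e2; ring.
Qed.

End WeierstrassSymbol.

(** * Algebraicity in transcendence degree one *)

Section Algebraic.
Variables (F : closedFieldType) (K : fieldType) (iota : {rmorphism F -> K}).

(** Over an algebraically closed field a nonconstant element is transcendental. *)
Lemma hev_neq0 x : ~ range iota x -> forall p, p != 0 -> hev iota x p != 0.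
Proof.
move=> xF p p0; have [r ->] := closed_field_poly_normal p.
rewrite hevZ mulf_neq0 ?fmorph_eq0 ?lead_coef_eq0 // rmorph_prod.
rewrite prodf_seq_neq0; apply/allP => a _; rewrite /= rmorphB /= hevX hevC subr_eq0.
by apply/eqP => xa; apply: xF; exists a.
Qed.

Section Over.
Variable x : K.
Local Notation ev := (hev iota x).
Local Notation integral := (integralOver ev).

(** Algebraicity of z over F(x), by an equation with coefficients in F[x]. *)
Definition alg2 z := exists2 P : {poly {poly F}}, P != 0 & hev ev z P = 0.

(** Multiply the equation P(z) = 0 by the power l^(m-1) of its leading
    coefficient, where m is its degree. *)
Lemma integral_lead (P : {poly {poly F}}) z : hev ev z P = 0 -> integral (ev (lead_coef P) * z).
Proof.
have [->|P0] := eqVneq P 0; first by rewrite lead_coef0 [ev 0]rmorph0 mul0r => _; exact: integral0.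
move=> Pz; pose m := (size P).-1; pose l := lead_coef P.
have sP : size P = m.+1 by rewrite /m prednK // size_poly_gt0.
pose T : {poly {poly F}} := \poly_(i < m) (P`_i * l ^+ (m.-1 - i)).
have sT : (size T < size ('X^m : {poly {poly F}}))%N by rewrite size_polyXn ltnS size_poly.
have Qm : 'X^m + T \is monic by rewrite monicE lead_coefDl // lead_coefXn.
have [m0|m0] := posnP m.
  move: Pz; have s1 : (size P <= 1)%N by rewrite sP m0.
  by rewrite (size1_polyC s1) hevC lead_coefC /= => ->; rewrite mul0r; exact: integral0.
exists ('X^m + T) => //; apply/rootP; change (hev ev (ev l * z) ('X^m + T) = 0).
rewrite rmorphD /= hevXn (hev_wide _ _ (size_poly _ _)).
transitivity (ev l ^+ m.-1 * hev ev z P); last by rewrite Pz mulr0.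
rewrite (hev_wide _ _ (leqnn (size P))) sP big_ord_recr /= mulrDr addrC mulr_sumr; congr (_ + _).
  apply: eq_bigr => i _; rewrite coef_poly ltn_ord rmorphM rmorphXn exprMn /=.
  have -> : m.-1 = (m.-1 - i + i)%N by rewrite subnK // -ltnS prednK.
  by rewrite addnK exprD; ring.
have -> : P`_m = l by rewrite /l lead_coefE sP.
by rewrite mulrA -exprSr prednK // exprMn.
Qed.

Hypothesis xF : ~ range iota x.

(** Algebraicity of z over F(x), in the form of a denominator d(x) that makes z
    integral over F[x]. *)
Definition alg z := exists2 d, d != 0 & integral (ev d * z).

Lemma alg2_alg z : alg2 z -> alg z.
Proof. by move=> [P P0 Pz]; exists (lead_coef P); [rewrite lead_coef_eq0|apply: integral_lead]. Qed.
Lemma alg_alg2 z : alg z -> alg2 z.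
Proof.
move=> [d d0 [P Pm /rootP]]; change (hev ev (ev d * z) P = 0 -> alg2 z) => Pz.
exists (\poly_(i < size P) (P`_i * d ^+ i)).
  rewrite -lead_coef_eq0 lead_coef_poly.
  - by rewrite -lead_coefE mulf_neq0 ?expf_neq0 // lead_coef_eq0 monic_neq0.
  - by rewrite size_poly_gt0 monic_neq0.
  - by rewrite -lead_coefE mulf_neq0 ?expf_neq0 // lead_coef_eq0 monic_neq0.
rewrite -Pz (hev_wide _ _ (size_poly _ _)) (hev_wide _ _ (leqnn (size P))).
apply: eq_bigr => i _; rewrite coef_poly ltn_ord rmorphM rmorphXn exprMn /=; ring.
Qed.

Lemma integral_ev d : integral (ev d).
Proof. exact: integral_id. Qed.
Lemma algD y z : alg y -> alg z -> alg (y + z).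
Proof.
move=> [d d0 Id] [d' d0' Id']; exists (d * d'); first exact: mulf_neq0.
rewrite rmorphM mulrDr; apply: integral_add.
  by rewrite (mulrC (ev d)) -mulrA; apply: integral_mul => //; exact: integral_ev.
by rewrite -mulrA; apply: integral_mul => //; exact: integral_ev.
Qed.
Lemma algM y z : alg y -> alg z -> alg (y * z).
Proof.
move=> [d d0 Id] [d' d0' Id']; exists (d * d'); first exact: mulf_neq0.
by rewrite rmorphM mulrACA; apply: integral_mul.
Qed.
Lemma alg_cst a : alg (iota a).
Proof. by exists 1; [exact: oner_neq0|rewrite rmorph1 mul1r -(hevC iota x); exact: integral_ev]. Qed.
Lemma alg_hev z p : alg z -> alg (hev iota z p).
Proof.
move=> az; elim/poly_ind: p => [|p c IH]; first by rewrite rmorph0 -(rmorph0 iota); exact: alg_cst.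
by rewrite rmorphD rmorphM /= hevX hevC; apply: algD (alg_cst _); apply: algM.
Qed.
(** The reversed equation. *)
Lemma algV z : alg z -> alg z^-1.
Proof.
have [->|z0] := eqVneq z 0; first by rewrite invr0.
move=> /alg_alg2 [P P0 Pz]; apply: alg2_alg.
exists (\poly_(i < size P) P`_((size P).-1 - i)).
  apply/eqP => R0; have := congr1 (fun p : {poly {poly F}} => p`_0) R0.
  rewrite coef_poly subn0 coef0 size_poly_gt0 P0 -lead_coefE => /eqP.
  by rewrite lead_coef_eq0 (negPf P0).
rewrite (hev_wide _ _ (size_poly _ _)).
transitivity (z^-1 ^+ (size P).-1 * hev ev z P); last by rewrite Pz mulr0.
rewrite (hev_wide _ _ (leqnn (size P))) (reindex_inj rev_ord_inj) mulr_sumr; apply: eq_bigr => i _ /=.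
have sP : (0 < size P)%N by rewrite size_poly_gt0.
have iP := ltn_ord i.
rewrite coef_poly; have -> : (size P - i.+1 < size P)%N by lia.
have -> : ((size P).-1 - (size P - i.+1) = i)%N by lia.
have -> : ((size P).-1 = (size P - i.+1) + i)%N by lia.
rewrite mulrCA; congr (_ * _); rewrite exprD -mulrA -exprMn mulVf // expr1n mulr1 //.
Qed.
(** An element algebraic over F(x0) is algebraic over F(x): divide its equation
    by the leading coefficient, and clear the denominators of all coefficients
    by one d(x); the resulting monic equation has integral coefficients. *)
Lemma alg_trans x0 v : alg x0 -> (forall p, p != 0 -> hev iota x0 p != 0) ->
  (exists2 P : {poly {poly F}}, P != 0 & hev (hev iota x0) v P = 0) -> alg v.
Proof.
move=> ax x0tr [P P0 Pv].
pose l := lead_coef P; have l0 : hev iota x0 l != 0 by apply: x0tr; rewrite lead_coef_eq0.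
pose c i := hev iota x0 P`_i / hev iota x0 l.
have ac i : alg (c i) by apply: algM; [apply: alg_hev|apply: algV; apply: alg_hev].
have /choice [d dP] : forall i, exists d, d != 0 /\ integral (ev d * c i).
  by move=> i; have [d] := ac i; exists d.
pose D := \prod_(i < size P) d i.
have D0 : D != 0 by rewrite prodf_seq_neq0; apply/allP => i _; have [] := dP i.
have ID i : integral (ev D * c i).
  case: (ltnP i (size P)) => iP; last first.
    by rewrite /c nth_default // rmorph0 mul0r mulr0; exact: integral0.
  rewrite /D (bigD1 (Ordinal iP)) //= rmorphM /= mulrAC mulrC; apply: integral_mul; first exact: integral_ev.
  by have [] := dP i.
exists D => //; pose m := (size P).-1.
have sP : size P = m.+1 by rewrite /m prednK // size_poly_gt0.
(* a monic equation of D v with integral coefficients *)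
pose T : {poly K} := \poly_(i < m) (ev D ^+ (m - i) * c i).
have sT : (size T < size ('X^m : {poly K}))%N by rewrite size_polyXn ltnS size_poly.
apply: (@integral_root_monic _ _ _ _ ('X^m + T)).
- by rewrite monicE lead_coefDl // lead_coefXn.
- apply/rootP; rewrite hornerD hornerXn (horner_coef_wide _ (size_poly _ _)).
  transitivity (ev D ^+ m / hev iota x0 l * hev (hev iota x0) v P); last by rewrite Pv mulr0.
  rewrite (hev_wide _ _ (leqnn (size P))) sP big_ord_recr /= mulrDr addrC mulr_sumr; congr (_ + _).
    apply: eq_bigr => i _; rewrite coef_poly ltn_ord exprMn /c.
    have -> : ev D ^+ m = ev D ^+ (m - i) * ev D ^+ i by rewrite -exprD subnK // ltnW.
    ring.
  have -> : P`_m = l by rewrite /l lead_coefE sP.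
  by rewrite -/l mulrA mulfVK // exprMn.
- apply/integral_poly => i; rewrite coefD coefXn; apply: integral_add; first exact: integral_nat.
  rewrite coef_poly; case: ltnP => im; last exact: integral0.
  have -> : (m - i = (m - i).-1.+1)%N by rewrite prednK // subn_gt0.
  by rewrite exprSr -mulrA -rmorphXn; apply: integral_mul; first exact: integral_ev.
Qed.
End Over.

Lemma hev_map_polyC a b c : hev (hev iota a) b (map_poly polyC c) = hev iota b c.
Proof.
elim/poly_ind: c => [|c d IH]; first by rewrite !rmorph0.
rewrite rmorphD rmorphM /= map_polyX map_polyC /= rmorphD rmorphM /= hevX hevC /= hevC IH.
by rewrite rmorphD rmorphM /= hevX hevC.
Qed.
Lemma hev_swapXY a b P : hev (hev iota a) b (swapXY P) = hev (hev iota b) a P.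
Proof.
elim/poly_ind: P => [|P c IH]; first by rewrite !rmorph0.
rewrite rmorphD rmorphM /= swapXY_X swapXY_polyC rmorphD rmorphM /= hevC /= hevX IH hev_map_polyC.
by rewrite rmorphD rmorphM /= hevX hevC.
Qed.

(** Any nonconstant x can serve as a transcendence basis: reading the equation
    of x over F(x0) as an equation of x0 over F(x), which is done by exchanging
    the variables, shows that x0 is algebraic over F(x). *)
Lemma trdeg1_alg x v : trdeg1 iota -> ~ range iota x -> alg x v.
Proof.
move=> [x0 x0alg tr] xF.
have x0F : ~ range iota x0.
  by move=> [a _ xa]; apply: x0alg; rewrite -xa; exact: algebraic_id.
have {}tr y : exists2 P : {poly {poly F}}, P != 0 & hev (hev iota x0) y P = 0.
  by have [P P0 /rootP Py] := tr y; exists P.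
apply: (alg_trans _ (hev_neq0 x0F) (tr v)).
apply: alg2_alg; have [P P0 Px] := tr x.
by exists (swapXY P); [rewrite swapXY_eq0|rewrite hev_swapXY].
Qed.

Lemma trdeg1_alg2 x v : trdeg1 iota -> ~ range iota x -> alg2 x v.
Proof. by move=> tr xF; apply: alg_alg2; apply: trdeg1_alg. Qed.

(** Zariski's lemma. A finitely generated algebra becomes integral over F[x]
    after inversion of one d(x). Were it the whole field, the inverse of x - c,
    for c with d(c) nonzero, would satisfy a monic equation with a power of d(x)
    as its denominator; multiplied by (x - c)^n, it gives a polynomial relation
    for x that is nonzero at c. *)
Lemma generated_algebra_proper gens : trdeg1 iota -> generated_algebra iota gens <> [set: K].
Proof.
move=> tr gT; have [x xalg _] := tr.
have xF : ~ range iota x.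
  by move=> [a _ xa]; apply: xalg; rewrite -xa; exact: algebraic_id.
have [d [d0 dI]] : exists d, d != 0 /\ forall g, g \in gens -> integralOver (hev iota x) (hev iota x d * g).
  elim: gens {gT} => [|g gens [d [d0 IH]]]; first by exists 1; rewrite oner_neq0.
  have [d' d0' Id'] := trdeg1_alg g tr xF; exists (d' * d); split; first exact: mulf_neq0.
  move=> g'; rewrite inE rmorphM => /orP[/eqP->|/IH I].
    by rewrite mulrAC mulrC; apply: integral_mul => //; exact: integral_ev.
  by rewrite -mulrA; apply: integral_mul => //; exact: integral_ev.
pose A := [set z | exists m, integralOver (hev iota x) (hev iota x d ^+ m * z)].
have up m m' z : (m <= m')%N -> integralOver (hev iota x) (hev iota x d ^+ m * z) ->
    integralOver (hev iota x) (hev iota x d ^+ m' * z).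
  move=> mm I; rewrite -(subnK mm) exprD -mulrA -rmorphXn.
  by apply: integral_mul => //; exact: integral_ev.
have AT z : A z.
  have : generated_algebra iota gens z by rewrite gT.
  move=> /(_ A); apply; split; last by move=> g gg; exists 1%N; rewrite expr1; exact: dI.
  split.
  - move=> _ [a _ <-]; exists 0%N; rewrite mul1r -(hevC iota x); exact: integral_ev.
  - move=> f g [m If] [m' Ig]; exists (maxn m m'); rewrite mulrBr; apply: integral_sub.
      by apply: up If; rewrite leq_maxl.
    by apply: up Ig; rewrite leq_maxr.
  - by move=> f g [m If] [m' Ig]; exists (m + m')%N; rewrite exprD mulrACA; apply: integral_mul.
have [c c0] : exists c, d.[c] != 0.
  apply: contrapT => H; case/eqP: d0; apply: closed_poly_ext => c; rewrite horner0.
  by apply/eqP/negPn/negP => dc; apply: H; exists c.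
have [m [P Pm /rootP]] := AT (x - iota c)^-1.
have y0 : x - iota c != 0 by rewrite subr_eq0; apply/eqP => xc; apply: xF; exists c.
set y := x - iota c in y0 *; set z := _ * _.
change (hev (hev iota x) z P = 0 -> False) => Pz.
pose n := (size P).-1; have sP : size P = n.+1 by rewrite /n prednK // size_poly_gt0 monic_neq0.
(* Q(x) = (x - c)^n P(z), with the powers of x - c cancelled *)
pose Q : {poly F} := d ^+ (m * n) + ('X - c%:P) * \sum_(i < n) P`_i * d ^+ (m * i) * ('X - c%:P) ^+ (n - i).-1.
have Q0 : Q != 0.
  apply/eqP => /(congr1 (fun p => p.[c])); rewrite hornerD hornerM hornerXsubC subrr mul0r addr0.
  by rewrite horner_exp horner0 => /eqP; rewrite expf_eq0 (negPf c0) andbF.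
have yE : hev iota x ('X - c%:P) = y by rewrite rmorphB /= hevX hevC.
have := hev_neq0 xF Q0; rewrite /Q rmorphD rmorphM rmorphXn rmorph_sum /= yE.
suff -> : hev iota x d ^+ (m * n) + y * \sum_(i < n) hev iota x (P`_i * d ^+ (m * i) * ('X - c%:P) ^+ (n - i).-1) = y ^+ n * hev (hev iota x) z P.
  by rewrite Pz mulr0 eqxx.
rewrite (hev_wide _ _ (leqnn (size P))) sP big_ord_recr /= mulrDr addrC !mulr_sumr; congr (_ + _).
  apply: eq_bigr => i _; rewrite !rmorphM !rmorphXn /= yE /z exprMn -exprM exprVn.
  have -> : y ^+ n = y * y ^+ (n - i).-1 * y ^+ i.
    by rewrite -exprS prednK ?subn_gt0 // -exprD subnK // ltnW.
  have yi : y ^+ i != 0 by rewrite expf_neq0.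
  by field.
have -> : P`_n = 1 by have := monicP Pm; rewrite lead_coefE sP.
by rewrite rmorph1 mul1r /z exprMn -exprM mulrCA -exprMn divff // expr1n mulr1.
Qed.

End Algebraic.

(** * Local rings of closed points *)

(** Divide the relation by z as often as possible. *)
Lemma relation_coef0 (R : idomainType) (K : fieldType) (ev : {rmorphism R -> K}) z (P : {poly R}) :
  z != 0 -> P != 0 -> hev ev z P = 0 -> exists2 Q : {poly R}, Q`_0 != 0 & hev ev z Q = 0.
Proof.
move=> z0; have [n] := ubnP (size P); elim: n P => // n IH P sP P0 Pz.
have [P00|P00] := eqVneq P`_0 0; last by exists P.
have PE := poly_head P; rewrite P00 polyC0 add0r in PE.
have d0 : drop_poly 1 P != 0 by apply: contra P0 => /eqP d0; rewrite PE d0 mulr0.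
apply: (IH (drop_poly 1 P)) => //.
  by rewrite size_drop_poly; have := size_poly_eq0 P; rewrite (negPf P0); lia.
have : hev ev z ('X * drop_poly 1 P) = 0 by rewrite -PE.
by rewrite rmorphM /= hevX => /eqP; rewrite mulf_eq0 (negPf z0) => /eqP.
Qed.

Section LocalRing.
Variables (F : closedFieldType) (K : fieldType) (iota : {rmorphism F -> K}).
Hypothesis tr : trdeg1 iota.
Variables (gens : seq K) (M : set K).
Local Notation A := (generated_algebra iota gens).
Hypotheses (Afrac : has_fraction_field A) (Mmax : maximal_ideal A M).
Local Notation O := (localization A M).

Lemma generated_subalgebra : subalgebra iota A.
Proof.
split.
- by move=> f If B [BP _]; have [IB _ _] := BP; apply: IB.
- by move=> f g Af Ag B BP; have [BS _] := BP; have [_ BB _] := BS; apply: BB; [apply: Af|apply: Ag].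
- by move=> f g Af Ag B BP; have [BS _] := BP; have [_ _ BM] := BS; apply: BM; [apply: Af|apply: Ag].
Qed.
Let Acst a : A (iota a). Proof. by have [H _ _] := generated_subalgebra; apply: H; exists a. Qed.
Let AB f g : A f -> A g -> A (f - g). Proof. by have [_ H _] := generated_subalgebra; apply: H. Qed.
Let AM f g : A f -> A g -> A (f * g). Proof. by have [_ _ H] := generated_subalgebra; apply: H. Qed.
Let A0 : A 0. Proof. by rewrite -(rmorph0 iota). Qed.
Let A1 : A 1. Proof. by rewrite -(rmorph1 iota). Qed.
Let AD f g : A f -> A g -> A (f + g).
Proof. by move=> Af Ag; rewrite -[g]opprK; apply: AB => //; rewrite -sub0r; apply: AB. Qed.

Lemma maximal_prime f g : A f -> A g -> ~ M f -> ~ M g -> ~ M (f * g).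
Proof.
have [[MA M0 MD MM] M1 max] := Mmax.
move=> Af Ag Mf Mg Mfg.
pose J := [set h | exists m a, [/\ M m, A a & h = m + a * f]].
have Jid : ideal A J.
  split.
  - by move=> _ [m [a [Mm Aa ->]]]; apply: AD; [apply: MA|apply: AM].
  - by exists 0, 0; rewrite mul0r addr0.
  - move=> _ _ [m [a [Mm Aa ->]]] [m' [a' [Mm' Aa' ->]]]; exists (m + m'), (a + a').
    by split; [apply: MD|apply: AD|rewrite mulrDl addrACA].
  - move=> h _ Ah [m [a [Mm Aa ->]]]; exists (h * m), (h * a).
    by split; [apply: MM|apply: AM|rewrite mulrDr mulrA].
have [[m [a [Mm Aa e]]]|J1] := pselect (J 1).
  apply: Mg; have -> : g = g * m + a * (f * g) by rewrite -[g in LHS]mulr1 e; ring.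
  by apply: MD; apply: MM.
have JM : J = M by apply: max => // m Mm; exists m, 0; rewrite mul0r addr0.
by apply: Mf; rewrite -JM; exists 0, 1; rewrite mul1r add0r.
Qed.

Lemma notM_neq0 g : ~ M g -> g != 0.
Proof. by have [[_ M0 _ _] _ _] := Mmax; move=> Mg; apply/eqP => g0; apply: Mg; rewrite g0. Qed.

Lemma loc_A f : A f -> O f.
Proof. by have [_ M1 _] := Mmax; move=> Af; exists f, 1; rewrite divr1. Qed.
Lemma loc_subalgebra : subalgebra iota O.
Proof.
split.
- by move=> _ [a _ <-]; apply: loc_A.
- move=> _ _ [f [g [Af Ag Mg ->]]] [f' [g' [Af' Ag' Mg' ->]]].
  exists (f * g' - f' * g), (g * g'); split; [by apply: AB; apply: AM|exact: AM|exact: maximal_prime|].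
  by field; rewrite !notM_neq0.
- move=> _ _ [f [g [Af Ag Mg ->]]] [f' [g' [Af' Ag' Mg' ->]]].
  exists (f * f'), (g * g'); split; [exact: AM|exact: AM|exact: maximal_prime|].
  by field; rewrite !notM_neq0.
Qed.

Lemma loc_frac h : exists f g, [/\ O f, O g, g != 0 & h = f / g].
Proof. by have [f [g [Af Ag g0 ->]]] := Afrac h; exists f, g; split=> //; apply: loc_A. Qed.

(** The local ring of a closed point is not a field: otherwise the maximal ideal
    M would be 0, the coordinate ring a field, hence equal to its fraction
    field, against Zariski's lemma. *)
Lemma loc_nonunit : exists2 f, f != 0 & nonunits O f.
Proof.
have [[MA M0 MD MM] M1 max] := Mmax.
apply: contrapT => H; have Ounit f : O f -> f != 0 -> O f^-1.
  move=> Of f0; apply: contrapT => nO; apply: H; exists f => //; split=> // -[g Og fg].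
  by apply: nO; rewrite -[f^-1]mulr1 -fg mulKf.
have MZ m : M m -> m = 0.
  move=> Mm; apply/eqP/negPn/negP => m0.
  have [a [b [Aa Ab Mb e]]] := Ounit m (loc_A (MA _ Mm)) m0.
  have b0 := notM_neq0 Mb; apply: Mb.
  have -> : b = a * m by rewrite -[a](divfK b0) -e mulrAC mulVf ?mul1r.
  exact: MM.
have Aunit f : A f -> f != 0 -> A f^-1.
  move=> Af f0; pose J := [set h | exists2 a, A a & h = a * f].
  have [[a Aa e]|J1] := pselect (J 1).
    by have -> : f^-1 = a by rewrite -[f^-1]mul1r e mulfK.
  have JM : J = M.
    apply: max => //; last by move=> m /MZ ->; exists 0; rewrite ?mul0r.
    split.
    - by move=> _ [a Aa ->]; apply: AM.
    - by exists 0; rewrite ?mul0r.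
    - by move=> _ _ [a Aa ->] [b Ab ->]; exists (a + b); [apply: AD|rewrite mulrDl].
    - by move=> h _ Ah [a Aa ->]; exists (h * a); [apply: AM|rewrite mulrA].
  have : M f by rewrite -JM; exists 1; rewrite ?mul1r.
  by move/MZ/eqP; rewrite (negPf f0).
apply: (generated_algebra_proper (gens := gens) tr); apply/seteqP; split=> // h _.
have [f [g [Af Ag g0 ->]]] := Afrac h.
by apply: AM => //; apply: Aunit.
Qed.

End LocalRing.

(** * Discrete valuation rings and their completions *)

Section Dvr.
Variables (F : closedFieldType) (K : fieldType) (iota : {rmorphism F -> K}) (O : set K) (pi : K).
Hypotheses (tr : trdeg1 iota) (Osub : subalgebra iota O)
  (Ofrac : forall h, exists f g, [/\ O f, O g, g != 0 & h = f / g])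
  (Opi : nonunits O = [set pi * g | g in O]) (Onon : exists2 f, f != 0 & nonunits O f).

Let Ocst a : O (iota a). Proof. by have [H _ _] := Osub; apply: H; exists a. Qed.
Let OB f g : O f -> O g -> O (f - g). Proof. by have [_ H _] := Osub; apply: H. Qed.
Let OM f g : O f -> O g -> O (f * g). Proof. by have [_ _ H] := Osub; apply: H. Qed.
Let O0 : O 0. Proof. by rewrite -(rmorph0 iota). Qed.
Let O1 : O 1. Proof. by rewrite -(rmorph1 iota). Qed.
Let ON f : O f -> O (- f). Proof. by move=> Of; rewrite -sub0r; apply: OB. Qed.
Let OD f g : O f -> O g -> O (f + g).
Proof. by move=> Of Og; rewrite -[g]opprK; apply: OB => //; apply: ON. Qed.
Let OX f n : O f -> O (f ^+ n).
Proof. by move=> Of; elim: n => [|n IH]; rewrite ?expr0 // exprS; apply: OM. Qed.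

Lemma dvr_hev z p : O z -> O (hev iota z p).
Proof.
move=> Oz; elim/poly_ind: p => [|p c IH]; first by rewrite rmorph0.
by rewrite rmorphD rmorphM /= hevX hevC; apply: OD => //; apply: OM.
Qed.
Lemma dvr_hev2 y z P : O y -> O z -> O (hev (hev iota y) z P).
Proof.
move=> Oy Oz; elim/poly_ind: P => [|p c IH]; first by rewrite rmorph0.
by rewrite rmorphD rmorphM /= hevX hevC; apply: OD; [apply: OM|apply: dvr_hev].
Qed.

Lemma nonunit_pi f : nonunits O f <-> exists2 g, O g & f = pi * g.
Proof. by rewrite Opi; split=> -[g Og]; [move=> <-; exists g|move=> ->; exists g]. Qed.
Lemma dvr_pi : nonunits O pi.
Proof. by apply/nonunit_pi; exists 1; rewrite ?mulr1. Qed.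
Lemma dvr_Opi : O pi. Proof. by have [] := dvr_pi. Qed.
Lemma pi_neq0 : pi != 0.
Proof.
have [f f0 /nonunit_pi [g _ fE]] := Onon.
by apply: contra f0 => /eqP p0; rewrite fE p0 mul0r.
Qed.
Lemma dvr_case f : O f -> (f != 0 /\ O f^-1) \/ exists2 g, O g & f = pi * g.
Proof.
move=> Of; have [[g Og fg]|H] := pselect (exists2 g, O g & f * g = 1); last by right; apply/nonunit_pi.
left; have f0 : f != 0.
  by apply/eqP => f0; move: fg; rewrite f0 mul0r => /esym/eqP; rewrite oner_eq0.
by split=> //; suff -> : f^-1 = g by []; apply: (mulfI f0); rewrite fg divff.
Qed.
Lemma dvr_unit_pi g : O g -> pi * g <> 1.
Proof. by move=> Og e; have [_] := dvr_pi; apply; exists g. Qed.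
Lemma iota_unit_pi a g : O g -> iota a = pi * g -> a = 0.
Proof.
move=> Og e; apply/eqP/negPn/negP => a0; apply: (@dvr_unit_pi (g * iota a^-1)); first exact: OM.
by rewrite mulrA -e -rmorphM divff ?rmorph1.
Qed.
Lemma pi_nonconstant : ~ range iota pi.
Proof.
move=> [a _ e]; have a0 : a = 0 by apply: (@iota_unit_pi a 1); rewrite ?mulr1.
by have := pi_neq0; rewrite -e a0 rmorph0 eqxx.
Qed.

(** The intersection of the powers of pi O is 0. If all powers of pi divide h,
    an equation Q(h) = 0 over F[pi] with nonzero constant term Q_0 = pi^m R
    shows that h divides pi^m R(pi), so that pi divides R(0), a nonzero
    constant. *)
Lemma dvr_ord_O h : O h -> h != 0 -> exists n u, [/\ O u, O u^-1 & h = pi ^+ n * u].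
Proof.
move=> Oh h0; apply: contrapT => H.
have D n : exists2 g, O g & h = pi ^+ n * g.
  elim: n => [|n [g Og hE]]; first by exists h; rewrite ?mul1r.
  have [[_ Ou]|[g' Og' gE]] := dvr_case Og; first by case: H; exists n, g.
  by exists g' => //; rewrite hE gE exprSr mulrA.
have [P P0 PE] := trdeg1_alg2 h tr pi_nonconstant.
have [Q Q0 QE] := relation_coef0 h0 P0 PE.
have [m [R [R0 RE]]] : exists m (R : {poly F}), R`_0 != 0 /\ Q`_0 = 'X^m * R.
  have [n] := ubnP (size Q`_0); elim: n (Q`_0) Q0 => // n IH p p0 sp.
  have [p00|p00] := eqVneq p`_0 0; last by exists 0%N, p; rewrite mul1r.
  have pE := poly_head p; rewrite p00 polyC0 add0r in pE.
  have d0 : drop_poly 1 p != 0 by apply: contra p0 => /eqP d0; rewrite pE d0 mulr0.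
  have [|m [R [R0 RE]]] := IH _ d0.
    by rewrite size_drop_poly; have := size_poly_eq0 p; rewrite (negPf p0); lia.
  by exists m.+1, R; split=> //; rewrite exprS -mulrA -RE.
have [g Og hE] := D m.+1.
case/eqP: R0; apply: (@iota_unit_pi _ (- hev iota pi (drop_poly 1 R) - g * hev (hev iota pi) h (drop_poly 1 Q))).
  apply: OB; first by apply: ON; apply: dvr_hev; exact: dvr_Opi.
  by apply: OM => //; apply: dvr_hev2 => //; exact: dvr_Opi.
move: QE; rewrite hev_head /= RE rmorphM /= hevXn (hev_head iota pi R).
rewrite {1}hE exprSr => e.
have : pi ^+ m * (iota R`_0 + pi * hev iota pi (drop_poly 1 R) + pi * g * hev (hev iota pi) h (drop_poly 1 Q)) = 0.
  by rewrite -e; ring.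
move/eqP; rewrite mulf_eq0 expf_eq0 (negPf pi_neq0) andbF /= => /eqP e2.
by apply/eqP; rewrite -subr_eq0 -e2; apply/eqP; ring.
Qed.

Lemma dvr_ord h : h != 0 -> exists (n : int) u, [/\ O u, O u^-1 & h = pi ^ n * u].
Proof.
move=> h0; have [f [g [Of Og g0 hE]]] := Ofrac h.
have f0 : f != 0 by apply: contra h0 => /eqP f0; rewrite hE f0 mul0r.
have [n [u [Ou Ou' fE]]] := dvr_ord_O Of f0; have [m [v [Ov Ov' gE]]] := dvr_ord_O Og g0.
exists (n%:Z - m%:Z), (u / v); split; [exact: OM|by rewrite invf_div; apply: OM|].
rewrite hE fE gE expfzDr ?pi_neq0 // -exprnN -exprnP invfM; ring.
Qed.

(** The residue field is F. In an equation of y over F[pi], not all of whose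
    coefficients are divisible by pi, setting pi = 0 gives a nonzero polynomial
    with root the residue of y; F being algebraically closed, some y - a is not
    a unit. *)
Lemma dvr_residue y : O y -> exists a, exists2 y', O y' & y = iota a + pi * y'.
Proof.
move=> Oy; have [P P0 PE] := trdeg1_alg2 y tr pi_nonconstant.
have sP0 : swapXY P != 0 by rewrite swapXY_eq0.
have sPE : hev (hev iota y) pi (swapXY P) = 0 by rewrite hev_swapXY.
have [Q Q0 QE] := relation_coef0 pi_neq0 sP0 sPE.
have H : exists2 g, O g & hev iota y Q`_0 = pi * g.
  exists (- hev (hev iota y) pi (drop_poly 1 Q)).
    by apply: ON; apply: dvr_hev2 => //; exact: dvr_Opi.
  by move: QE; rewrite hev_head => /eqP; rewrite addr_eq0 => /eqP ->; rewrite mulrN.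
have [r rE] := closed_field_poly_normal Q`_0.
move: H; rewrite rE hevZ rmorph_prod /=; set l := lead_coef _.
have l0 : l != 0 by rewrite lead_coef_eq0.
move=> [g Og e].
have {g Og e} : exists2 g, O g & \prod_(a <- r) hev iota y ('X - a%:P) = pi * g.
  exists (iota l^-1 * g); first exact: OM.
  by rewrite mulrCA -e mulrA -rmorphM mulVf // rmorph1 mul1r.
elim: r {rE} => [|a r IH]; first by rewrite big_nil => -[g Og /esym/dvr_unit_pi].
rewrite big_cons rmorphB /= hevX hevC => -[g Og e].
have [[ya u]|[y' Oy' yE]] := dvr_case (OB Oy (Ocst a)); last first.
  by exists a, y' => //; rewrite -yE addrC subrK.
apply: IH; exists ((y - iota a)^-1 * g); first exact: OM.
by rewrite mulrCA -e mulKf.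
Qed.

Lemma dvr_digits u : O u -> exists c : nat -> F, forall L,
  exists2 g, O g & u = hev iota pi (\poly_(i < L) c i) + pi ^+ L * g.
Proof.
have /choice [dig digP] : forall u, exists ag : F * K, O u -> O ag.2 /\ u = iota ag.1 + pi * ag.2.
  move=> v; have [Ov|nOv] := pselect (O v); last by exists (0, 0).
  by have [a [y' Oy' yE]] := dvr_residue Ov; exists (a, y').
move=> Ou; pose v n := iter n (fun w => (dig w).2) u.
have Ov n : O (v n) by elim: n => [//|n IH]; have [] := digP _ IH.
exists (fun n => (dig (v n)).1) => L; exists (v L) => //.
elim: L => [|L IH]; first by rewrite poly_def big_ord0 rmorph0 add0r mul1r.
rewrite {1}IH; have [_ {1}->] := digP _ (Ov L).
rewrite !poly_def big_ord_recr rmorphD /= hevZ hevXn exprSr /=; ring.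
Qed.

(** The series a, read from degree m on, is the expansion of f in powers of pi. *)
Definition expands m f (a : laurent F) := forall L : nat,
  exists2 g, O g & f = pi ^ m * (hev iota pi (window m L a) + pi ^+ L * g).

Lemma expands_le m f a (L L' : nat) : (L <= L')%N ->
  (exists2 g, O g & f = pi ^ m * (hev iota pi (window m L' a) + pi ^+ L' * g)) ->
  exists2 g, O g & f = pi ^ m * (hev iota pi (window m L a) + pi ^+ L * g).
Proof.
move=> LL [g Og fE].
exists (hev iota pi (drop_poly L (window m L' a)) + pi ^+ (L' - L) * g).
  by apply: OD; [apply: dvr_hev dvr_Opi|apply: OM => //; apply: OX dvr_Opi].
rewrite fE; congr (_ * _).
have WE : window m L' a = window m L a + 'X^L * drop_poly L (window m L' a).
  apply/polyP => i; rewrite coefD coefXnM coef_drop_poly !coef_poly.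
  case: (ltnP i L) => iL; first by rewrite (leq_trans iL LL) addr0.
  by rewrite subnK // add0r.
by rewrite {1}WE rmorphD rmorphM /= hevXn mulrDr mulrA -exprD subnKC // addrA.
Qed.

Lemma window_shift (m : int) (d L : nat) (a : int -> F) : vanish_below (m + d%:Z) a ->
  window m (L + d) a = 'X^d * window (m + d%:Z) L a.
Proof.
move=> ad; apply/polyP => i; rewrite coefXnM !coef_poly.
case: (ltnP i d) => id; first by case: ifP => // _; apply: ad; lia.
have -> : (i - d < L)%N = (i < L + d)%N by lia.
by case: ifP => // _; congr a; lia.
Qed.

Lemma expands_shift (m : int) (d : nat) f (a : laurent F) : vanish_below (m + d%:Z) a -> expands m f a <-> expands (m + d%:Z) f a.
Proof.
move=> ad; have H L g : pi ^ m * (hev iota pi (window m (L + d) a) + pi ^+ (L + d) * g) =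
    pi ^ (m + d%:Z) * (hev iota pi (window (m + d%:Z) L a) + pi ^+ L * g).
  rewrite window_shift // rmorphM /= hevXn expfzDr ?pi_neq0 // exprD /exprz /=; ring.
split=> E L.
  by have [g Og ->] := E (L + d)%N; exists g; rewrite ?H.
apply: (@expands_le _ _ _ _ (L + d)%N); first exact: leq_addr.
by have [g Og ->] := E L; exists g; rewrite ?H.
Qed.

Lemma expands_any (m m' : int) f (a : laurent F) : vanish_below m a -> vanish_below m' a -> expands m f a -> expands m' f a.
Proof.
case: (leP m m') => mm am am'.
  have [d dE] : exists d : nat, m' = m + d%:Z by exists `|m' - m|%N; lia.
  by rewrite dE in am' *; move/expands_shift; apply.
have [d dE] : exists d : nat, m = m' + d%:Z by exists `|m - m'|%N; lia.
by rewrite dE in am *; move=> E; have [_ H] := expands_shift f am; apply: H.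
Qed.

Definition expansion f (a : laurent F) := exists2 m, vanish_below m a & expands m f a.

Lemma expansion_exists f : exists a, expansion f a.
Proof.
have [->|f0] := eqVneq f 0.
  exists 0, 0; first exact: vanish_below0.
  move=> L; exists 0 => //; rewrite mulr0 addr0 (_ : window _ _ _ = 0) ?rmorph0 ?mulr0 //.
  by apply/polyP => i; rewrite coef_poly coef0; case: ifP => // _; apply: lcoef0.
have [m [u [Ou _ fE]]] := dvr_ord f0; have [c cE] := dvr_digits Ou.
pose a (i : int) := if m <= i then c `|i - m|%N else 0.
have am : vanish_below m a by move=> i im; rewrite /a lt_geF.
have ab : exists m : int, vanish_below m a by exists m.
exists (Laurent ab), m => // L; have [g Og uE] := cE L; exists g => //.
rewrite fE uE; congr (_ * (hev iota pi _ + _)).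
apply/polyP => i; rewrite !coef_poly; case: ifP => // _; rewrite -[Laurent ab _]/(a _) /a lerDl.
by congr c; lia.
Qed.

(** A polynomial in pi of size at most L that pi^L divides is 0, since a nonzero
    constant is not divisible by pi. *)
Lemma expansion0 a : expansion 0 a -> a = 0.
Proof.
move=> [m am E]; apply: laurentP; apply: (eq_vanish_below am); first exact: vanish_below0.
move=> j; rewrite lcoef0.
have H L (p : {poly F}) g : O g -> (size p <= L)%N -> hev iota pi p = pi ^+ L * g -> p = 0.
  elim: L p g => [|L IH] p g Og sp e.
    by apply/eqP; rewrite -size_poly_eq0; lia.
  have p0 : p`_0 = 0.
    apply: (@iota_unit_pi _ (pi ^+ L * g - hev iota pi (drop_poly 1 p))).
      by apply: OB; [apply: OM => //; apply: OX dvr_Opi|apply: dvr_hev dvr_Opi].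
    by rewrite mulrBr mulrA -exprS -e hev_head addrK.
  have := poly_head p; rewrite p0 polyC0 add0r (IH (drop_poly 1 p) g) ?mulr0 //.
    by rewrite size_drop_poly; lia.
  by apply: (mulfI pi_neq0); rewrite mulrA -exprS -e (hev_head iota pi p) p0 rmorph0 add0r.
have [g Og e] := E j.+1.
have := H j.+1 (window m j.+1 a) (- g) (ON Og) (size_poly _ _).
have pm : pi ^ m != 0 by rewrite expfz_neq0 ?pi_neq0.
have -> : hev iota pi (window m j.+1 a) = pi ^+ j.+1 * - g.
  by move/eqP: e; rewrite eq_sym mulf_eq0 (negPf pm) /= addr_eq0 => /eqP ->; rewrite mulrN.
move=> /(_ erefl) /(congr1 (fun p : {poly F} => p`_j)).
by rewrite coef_poly ltnSn coef0.
Qed.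

Lemma expansionB f f' a b : expansion f a -> expansion f' b -> expansion (f - f') (a - b).
Proof.
move=> [m am E] [m' bm E']; have [n [an bn]] := vanish_below2 a b.
exists n; first exact: vanish_belowB.
have Ea := expands_any am an E; have Eb := expands_any bm bn E'.
move=> L; have [g Og ->] := Ea L; have [g' Og' ->] := Eb L.
exists (g - g'); first exact: OB.
have -> : window n L (a - b) = window n L a - window n L b.
  by apply/polyP => i; rewrite coefB !coef_poly; case: ifP; rewrite ?subr0.
rewrite rmorphB /=; ring.
Qed.

Lemma expansion_unique f a b : expansion f a -> expansion f b -> a = b.
Proof.
move=> fa fb; apply/eqP; rewrite -subr_eq0; apply/eqP/expansion0.
by rewrite -(subrr f); apply: expansionB.
Qed.

(** The window of a product is the product of the windows, up to terms that go
    into the remainder. *)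
Lemma expansionM f f' a b : expansion f a -> expansion f' b -> expansion (f * f') (a * b).
Proof.
move=> [m am E] [p bp E']; exists (m + p); first exact: vanish_belowM.
move=> L; have [g Og ->] := E L; have [g' Og' ->] := E' L.
set P := window m L a; set Q := window p L b.
have -> : window (m + p) L (a * b) = P * Q - 'X^L * drop_poly L (P * Q).
  apply/polyP => i; rewrite coefB coefXnM coef_drop_poly.
  case: (ltnP i L) => iL; first by rewrite (window_convolution am bp iL) subr0.
  by rewrite subnK // subrr coef_poly ltnNge iL.
exists (hev iota pi (drop_poly L (P * Q)) + hev iota pi P * g' + hev iota pi Q * g + pi ^+ L * g * g').
  have h r := dvr_hev r dvr_Opi.
  apply: (OD (OD (OD (h _) (OM (h _) Og')) (OM (h _) Og)) _).
  by apply: OM => //; apply: OM => //; apply: OX dvr_Opi.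
rewrite rmorphB !rmorphM /= hevXn expfzDr ?pi_neq0 //; ring.
Qed.

Lemma expansion_cst c : expansion (iota c) (lcst c).
Proof.
exists 0; first exact: vanish_below_cst.
move=> L; apply: (@expands_le _ _ _ _ L.+1) => //; exists 0 => //.
rewrite mulr0 addr0 expr0z mul1r (_ : window _ _ _ = c%:P) ?hevC //.
apply/polyP => i; rewrite coef_poly coefC add0r lcoef_monomialE.
by case: i => [|i] //=; rewrite if_same.
Qed.

Lemma expansion_pi : expansion pi (tpow F 1).
Proof.
exists 0; first by apply: vanish_belowW (@vanish_below_tpow F 1).
move=> L; apply: (@expands_le _ _ _ _ L.+2) => //; first lia.
exists 0 => //; rewrite mulr0 addr0 expr0z mul1r (_ : window _ _ _ = 'X) ?hevX //.
apply/polyP => i; rewrite coef_poly coefX add0r lcoef_monomialE.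
by case: i => [|[|i]] //=; rewrite if_same.
Qed.

(** An element of O has an expansion without negative degrees, and expansions
    are unique. *)
Lemma expansion_O f a : expansion f a -> O f <-> vanish_below 0 a.
Proof.
move=> E; split=> [Of|a0]; last first.
  have [m am Em] := E; have [g Og ->] := expands_any am a0 Em 0%N.
  by rewrite expr0z mul1r (_ : window _ _ _ = 0) ?rmorph0 ?add0r ?mul1r // /window poly_def big_ord0.
have [c cE] := dvr_digits Of.
pose b (i : int) := if 0 <= i then c `|i|%N else 0.
have b0 : vanish_below 0 b by move=> i im; rewrite /b lt_geF.
have bb : exists m : int, vanish_below m b by exists 0.
suff -> : a = Laurent bb by [].
apply: (expansion_unique E); exists 0 => // L; have [g Og uE] := cE L; exists g => //.
rewrite expr0z mul1r {1}uE; congr (hev iota pi _ + _).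
Qed.

Definition place_fun f := xget (0 : laurent F) [set a | expansion f a].
Lemma place_funP f : expansion f (place_fun f).
Proof.
by rewrite /place_fun; case: xgetP => // H; have [a] := expansion_exists f; move/H.
Qed.

(** Laurent expansion embeds K into F((t)); O is the preimage of F[[t]]. *)
Lemma place_exists : exists E : {rmorphism K -> laurent F},
  [/\ forall a, E (iota a) = lcst a, E pi = tpow F 1, forall f, O f <-> vanish_below 0 (E f) &
      forall f, expansion f (E f)].
Proof.
have HB : zmod_morphism place_fun.
  move=> f g; apply: (expansion_unique (place_funP _)).
  by apply: expansionB; exact: place_funP.
have HM : monoid_morphism place_fun.
  split; first by apply: (expansion_unique (place_funP _)); rewrite -(rmorph1 iota); exact: (expansion_cst 1).
  move=> f g; apply: (expansion_unique (place_funP _)).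
  by apply: expansionM; exact: place_funP.
pose Ea := GRing.isZmodMorphism.Build K (laurent F) place_fun HB.
pose Em := GRing.isMonoidMorphism.Build K (laurent F) place_fun HM.
pose E : {rmorphism K -> laurent F} := HB.pack place_fun Ea Em.
exists E; split=> [a||f|f].
- exact: (expansion_unique (place_funP _) (expansion_cst a)).
- exact: (expansion_unique (place_funP _) expansion_pi).
- exact: expansion_O (place_funP f).
- exact: place_funP.
Qed.
End Dvr.

(** * Places of a nonsingular curve *)

Lemma laurent_ord (F K : fieldType) (E : {rmorphism K -> laurent F}) f : f != 0 ->
  exists m, [/\ vanish_below m (E f), E f m != 0, vanish_below (- m) (E f^-1) & E f^-1 (- m) != 0].
Proof.
have ne0 g : g != 0 -> E g <> 0.
  move=> g0 Eg; have := rmorph1 E; rewrite -(mulfV g0) rmorphM Eg mul0r => /eqP.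
  by rewrite eq_sym oner_eq0.
move=> f0; have [m am am0] := lead_coef_exists (ne0 _ f0).
have fi0 : f^-1 != 0 by rewrite invr_eq0.
have [l al al0] := lead_coef_exists (ne0 _ fi0).
suff lm : l = - m by exists m; rewrite -lm.
have := lcoefM_lead am al; rewrite -rmorphM divff // rmorph1 -monomial1E lcoef_monomialE.
case: eqP => [e _|_ /esym/eqP]; first by apply/eqP; rewrite -addr_eq0 addrC e.
by rewrite mulf_eq0 (negPf am0) (negPf al0).
Qed.

Section CurvePlaces.
Variables (F : closedFieldType) (X : curve F).
Hypothesis X_nonsingular : nonsingular X.
Local Notation K := (function_field X).
Local Notation iota := (constants X).
Implicit Types (p : X) (f : K).

Lemma curve_local p : exists gens M, 
  [/\ has_fraction_field (generated_algebra iota gens),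
      maximal_ideal (generated_algebra iota gens) M &
      local_ring p = localization (generated_algebra iota gens) M].
Proof.
have [charts frac cover] := curve_affine_cover X.
have : range (@local_ring F X) (local_ring p) by exists p.
rewrite cover => -[gens gc [M Mm <-]]; exists gens, M; split=> //.
exact: frac.
Qed.

(** E is the Laurent expansion at p in powers of pi. *)
Definition is_place p (pi : K) (E : {rmorphism K -> laurent F}) :=
  [/\ forall a, E (iota a) = lcst a, E pi = tpow F 1,
      forall f, local_ring p f <-> vanish_below 0 (E f) &
      forall f a, laurent_expansion p pi f a -> E f = a].

Lemma curve_place p pi : uniformizer p pi -> exists E, is_place p pi E.
Proof.
move=> upi; have [gens [M [frac Mm OE]]] := curve_local p.
have tr := curve_dim1 X.
have Osub := loc_subalgebra Mm; have Ofrac := loc_frac frac Mm.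
have Onon := loc_nonunit tr frac Mm.
have Opi := upi; rewrite /uniformizer OE in Opi.
have [E [E1 E2 E3 E4]] := place_exists tr Osub Ofrac Opi Onon.
exists E; split=> //; first by rewrite OE.
move=> f a fa; apply: (expansion_unique Osub Opi Onon (E4 f)).
have [m am] := laurent_bounded a; exists m => // L.
have [g Og fE] := fa (m + L%:Z); exists g; first by rewrite -OE.
have pi0 := pi_neq0 Opi Onon.
have SE : \sum_(i \in [set i : int | i < m + L%:Z]) iota (a i) * pi ^ i =
    pi ^ m * hev iota pi (window m L a).
  pose r := [seq m + i%:Z | i <- seq.iota 0 L].
  rewrite (fsbigE r).
  - rewrite big_map big_mkcond /= /window poly_def rmorph_sum mulr_sumr.
    rewrite -(big_mkord xpredT (fun i => pi ^ m * hev iota pi (a (m + i%:Z) *: 'X^i))).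
    rewrite /index_iota subn0; apply: eq_big_seq => i; rewrite mem_iota => iL.
    rewrite mem_set /=; last by lia.
    by rewrite hevZ hevXn expfzDr // -exprnP mulrCA.
  - by rewrite map_inj_uniq ?iota_uniq // => u v /addrI [].
  - by move=> i /mapP[j]; rewrite mem_iota => jL -> /=; lia.
  - move=> i /= iL ir; case: (ltP i m) => [/am->|mi]; first by rewrite rmorph0 mul0r.
    case/mapP: ir; exists `|i - m|%N; last by lia.
    by rewrite mem_iota; lia.
rewrite SE in fE.
by rewrite mulrDr mulrA exprnP -expfzDr // -fE addrC subrK.
Qed.

(** If z had a pole at p, dividing its monic equation by z^n would express 1 by
    functions that vanish at p. *)
Lemma place_integral p pi E x z : is_place p pi E -> local_ring p x ->
  integralOver (hev iota x) z -> local_ring p z.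
Proof.
move=> [E1 E2 E3 _] Ox [P Pm /rootP]; change (hev (hev iota x) z P = 0 -> local_ring p z) => Pz.
apply/E3; apply: contrapT => nz.
have z0 : z != 0 by apply/eqP => z0; apply: nz; rewrite z0 rmorph0; exact: vanish_below0.
have [m [Ezm _ Ezl _]] := laurent_ord E z0; pose l := - m.
have m0 : m < 0 by rewrite ltNge; apply/negP => m0; apply: nz; apply: vanish_belowW Ezm.
pose n := (size P).-1; have sP : size P = n.+1 by rewrite /n prednK // size_poly_gt0 monic_neq0.
have Pn : P`_n = 1 by have := monicP Pm; rewrite lead_coefE sP.
have e1 : 1 = - \sum_(i < n) hev iota x P`_i * z^-1 ^+ (n - i).
  apply/eqP; rewrite -addr_eq0; apply/eqP.
  transitivity (z^-1 ^+ n * hev (hev iota x) z P); last by rewrite Pz mulr0.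
  rewrite (hev_wide _ _ (leqnn (size P))) sP big_ord_recr /= Pn rmorph1 mul1r addrC mulrDr mulr_sumr.
  congr (_ + _); first by rewrite -exprMn mulVf // expr1n.
  apply: eq_bigr => i _; rewrite mulrCA; congr (_ * _).
  have -> : z^-1 ^+ n = z^-1 ^+ (n - i) * z^-1 ^+ i by rewrite -exprD subnK // ltnW.
  by rewrite -mulrA -exprMn mulVf // expr1n mulr1.
have v1 : vanish_below 1 (E 1).
  rewrite e1 rmorphN rmorph_sum; apply: vanish_belowN; apply: vanish_below_sum => i _.
  rewrite rmorphM rmorphXn.
  have v2 : vanish_below 0 (E (hev iota x P`_i)).
    elim/poly_ind: (P`_i) => [|q c IH]; first by rewrite !rmorph0; exact: vanish_below0.
    rewrite rmorphD rmorphM /= hevX hevC rmorphD rmorphM E1; apply: vanish_belowD (vanish_below_cst _).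
    by apply: vanish_belowM0 => //; apply/E3.
  have := vanish_belowM v2 (vanish_belowX (n := n - i) Ezl); apply: vanish_belowW.
  have : (0 < n - i)%N by rewrite subn_gt0.
  have l0 : 0 < l by rewrite /l; lia.
  by case: (n - i)%N => // d _; rewrite mulrS add0r ler_wpDr // mulrn_wge0 // ltW.
have := v1 0 isT; rewrite rmorph1 -monomial1E lcoef_monomialE eqxx => /eqP.
by rewrite oner_eq0.
Qed.

(** If the local ring of p lies in that of q, an element f that vanishes at p
    also vanishes at q: otherwise f^c / piq, which for large c is regular at p
    and hence at q, would make 1 / piq regular at q. Thus the valuation ring of
    q dominates the local rings of both points, which separation excludes. *)
Lemma place_distinct p q : p <> q -> exists2 f, local_ring p f & ~ local_ring q f.
Proof.
move=> pq; apply: contrapT => H.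
have sub f : local_ring p f -> local_ring q f.
  by move=> Of; apply: contrapT => nO; apply: H; exists f.
have [pip up] := X_nonsingular p; have [piq uq] := X_nonsingular q.
have [Ep [E1 E2 E3 _]] := curve_place up; have [Eq [D1 D2 D3 _]] := curve_place uq.
apply: pq; apply: (curve_separated (V := local_ring q)).
- split.
    have [gens [M [frac Mm ->]]] := curve_local q; exact: (loc_subalgebra Mm).
  move=> f; have [->|f0] := eqVneq f 0; first by left; apply/D3; rewrite rmorph0; exact: vanish_below0.
  have [m [am _ bm _]] := laurent_ord Eq f0.
  by case: (leP 0 m) => m0; [left|right]; apply/D3; [apply: vanish_belowW am|apply: vanish_belowW bm; lia].
- split=> // f [Of nf]; split; first exact: sub.
  move=> [g Og fg]; have f0 : f != 0.
    by apply/eqP => f0; move: fg; rewrite f0 mul0r => /esym/eqP; rewrite oner_eq0.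
  have gE : g = f^-1 by rewrite -[g]mul1r -(mulVf f0) -mulrA fg mulr1.
  have [m [am _ bm bm0]] := laurent_ord Ep f0.
  have m0 : 0 < m.
    rewrite ltNge; apply/negP => m0; apply: nf; exists f^-1; last by rewrite divff.
    by apply/E3; apply: vanish_belowW bm; lia.
  have q0 : piq != 0.
    apply/eqP => q0; have := D2; rewrite q0 rmorph0 => /(congr1 (fun h : laurent F => h 1)).
    by rewrite lcoef0 lcoef_monomialE eqxx => /esym/eqP; rewrite oner_eq0.
  have [c [hc _ _ _]] := laurent_ord Ep (invr_neq0 q0).
  have /sub /D3 v1 : local_ring p (f ^+ `|c|%N * piq^-1).
    apply/E3; rewrite rmorphM rmorphXn.
    have := vanish_belowM (vanish_belowX (n := `|c|%N) am) hc; apply: vanish_belowW.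
    have : `|c|%N%:Z <= m *+ `|c|%N by rewrite -mulr_natr natz ler_peMl //; lia.
    by lia.
  (* 1/piq would be regular at q *)
  have v2 : vanish_below 0 (Eq piq^-1).
    have -> : piq^-1 = g ^+ `|c|%N * (f ^+ `|c|%N * piq^-1).
      by rewrite mulrA -exprMn gE mulVf // expr1n mul1r.
    rewrite rmorphM; apply: vanish_belowM0 v1; rewrite rmorphXn -(mul0rn _ `|c|%N).
    by apply: vanish_belowX; apply/D3.
  have q1 : vanish_below 1 (Eq piq) by rewrite D2; exact: vanish_below_tpow.
  have := vanish_belowM q1 v2; rewrite -rmorphM divff // rmorph1 => /(_ 0 isT).
  by rewrite -monomial1E lcoef_monomialE eqxx => /eqP; rewrite oner_eq0.
- by split.
Qed.
End CurvePlaces.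

(** * Orders and weak approximation *)

Section Order.
Variables (F K : fieldType) (E : {rmorphism K -> laurent F}).

(** The default value 0 is taken at f = 0 only. *)
Definition ord (f : K) : int := xget 0 [set m | vanish_below m (E f) /\ E f m != 0].

Lemma ordP f : f != 0 -> vanish_below (ord f) (E f) /\ E f (ord f) != 0.
Proof.
move=> f0; rewrite /ord; case: xgetP => [m _ //|H].
by have [m [am am0 _ _]] := laurent_ord E f0; case: (H m).
Qed.
Lemma ord_vanish f n : f != 0 -> vanish_below n (E f) <-> n <= ord f.
Proof.
move=> f0; have [v v0] := ordP f0; split=> [vn|nf]; last exact: vanish_belowW v.
by rewrite leNgt; apply/negP => /vn e; move: v0; rewrite e eqxx.
Qed.
Lemma ord_eq f m : vanish_below m (E f) -> E f m != 0 -> ord f = m.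
Proof.
move=> fm fm0; have f0 : f != 0.
  by apply: contra fm0 => /eqP ->; rewrite rmorph0 lcoef0.
have [v v0] := ordP f0; apply/eqP; rewrite eq_le; apply/andP; split.
  by rewrite leNgt; apply/negP => /v e; move: fm0; rewrite e eqxx.
exact/ord_vanish.
Qed.
Lemma ordM f g : f != 0 -> g != 0 -> ord (f * g) = ord f + ord g.
Proof.
move=> f0 g0; have [v v0] := ordP f0; have [w w0] := ordP g0.
by apply: ord_eq; rewrite rmorphM; [apply: vanish_belowM|rewrite lcoefM_lead // mulf_neq0].
Qed.
Lemma ord1 : ord 1 = 0.
Proof. by apply: ord_eq; rewrite rmorph1 -monomial1E; [exact: vanish_below1|rewrite lcoef_monomialE eqxx oner_eq0]. Qed.
Lemma ordV f : f != 0 -> ord f^-1 = - ord f.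
Proof.
move=> f0; have := ordM f0 (invr_neq0 f0); rewrite divff // ord1 => /esym/eqP.
by rewrite addr_eq0 => /eqP ->; rewrite opprK.
Qed.
Lemma ordX f n : f != 0 -> ord (f ^+ n) = ord f *+ n.
Proof.
move=> f0; elim: n => [|n IH]; first by rewrite expr0 ord1.
by rewrite exprS ordM ?expf_neq0 // IH mulrS.
Qed.
Lemma ordD f g : f != 0 -> g != 0 -> ord f < ord g -> f + g != 0 /\ ord (f + g) = ord f.
Proof.
move=> f0 g0 fg; have [v v0] := ordP f0; have [w w0] := ordP g0.
have c : E (f + g) (ord f) != 0 by rewrite rmorphD lcoefD w // addr0.
split; first by apply: contra c => /eqP ->; rewrite rmorph0 lcoef0.
apply: ord_eq => //; rewrite rmorphD; apply: vanish_belowD => //.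
by apply: vanish_belowW w; apply: ltW.
Qed.
End Order.

Section Approximation.
Variables (F : closedFieldType) (K : fieldType) (I : finType) (E : I -> {rmorphism K -> laurent F})
  (pi : I -> K).
Hypotheses (E_pi : forall s, E s (pi s) = tpow F 1)
  (E_distinct : forall s t, s != t -> exists2 f, vanish_below 0 (E s f) & ~ vanish_below 0 (E t f)).
Implicit Types s t : I.

Lemma ord_pi s : ord (E s) (pi s) = 1.
Proof.
by apply: ord_eq; rewrite E_pi; [exact: vanish_below_tpow|rewrite lcoef_monomialE eqxx oner_eq0].
Qed.
Lemma pi_ne0 s : pi s != 0.
Proof.
apply/eqP => p0; have := E_pi s; rewrite p0 rmorph0 => /(congr1 (fun h : laurent F => h 1)).
by rewrite lcoef0 lcoef_monomialE eqxx => /esym/eqP; rewrite oner_eq0.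
Qed.

Lemma not_reg_neq0 t f : ~ vanish_below 0 (E t f) -> f != 0.
Proof. by move=> H; apply/eqP => f0; apply: H; rewrite f0 rmorph0; exact: vanish_below0. Qed.

(** A quotient a / b, with a regular at t but not at s and conversely for b. *)
Lemma separate2 s t : s != t -> exists z, [/\ z != 0, ord (E s) z < 0 & 0 < ord (E t) z].
Proof.
move=> st; have [b bs bt] := E_distinct st; rewrite eq_sym in st.
have [a at_ as_] := E_distinct st.
have a0 := not_reg_neq0 as_; have b0 := not_reg_neq0 bt.
exists (a / b); rewrite mulf_neq0 ?invr_neq0 // !ordM ?invr_neq0 // !ordV //.
move: as_ at_ bs bt; rewrite !ord_vanish // => /negP; rewrite -ltNge => ? ? ? /negP; rewrite -ltNge => ?.
by split=> //; lia.
Qed.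

(** z^N / (1 + z^N) vanishes to high order where z vanishes, and is close to 1
    where z has a pole. *)
Lemma damping z N t : z != 0 -> (0 < N)%N -> ord (E t) z != 0 ->
  [/\ 1 + z ^+ N != 0, 0 < ord (E t) z -> ord (E t) (1 + z ^+ N) = 0 &
      ord (E t) z < 0 -> ord (E t) (1 + z ^+ N) = ord (E t) z *+ N].
Proof.
move=> z0 N0 zt; have zN0 : z ^+ N != 0 by rewrite expf_neq0.
have o1 : (1 : K) != 0 := oner_neq0 _.
case: (ltgtP (ord (E t) z) 0) => [zt0|zt0|/eqP]; last by rewrite (negPf zt).
  have [|h1 h2] := @ordD _ _ (E t) (z ^+ N) 1 zN0 o1.
    by rewrite ord1 ordX // pmulrn_llt0.
  by rewrite addrC; split=> //; rewrite h2 ordX.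
have [|h1 h2] := @ordD _ _ (E t) 1 (z ^+ N) o1 zN0.
  by rewrite ord1 ordX // pmulrn_lgt0.
by split=> //; rewrite h2 ord1.
Qed.

(** Induction on T: a high power of the function for T, damped in case it has a
    pole at the new t, is multiplied by a function that separates s from t. *)
Lemma separate s (T : seq I) : s \notin T ->
  exists z, [/\ z != 0, ord (E s) z < 0 & forall t, t \in T -> 0 < ord (E t) z].
Proof.
elim: T => [_|t T IH].
  exists (pi s)^-1; split=> //; first by rewrite invr_neq0 // pi_ne0.
  by rewrite ordV ?pi_ne0 // ord_pi.
rewrite inE negb_or => /andP[st /IH [z [z0 zs zT]]].
have [y [y0 ys yt]] := separate2 st.
pose N := (\sum_u `|ord (E u) y|).+1%N.
have Ny u : 0 < ord (E u) z -> 0 < ord (E u) z *+ N + ord (E u) y.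
  move=> zu; have h1 : N%:Z <= ord (E u) z *+ N by rewrite -mulr_natr natz ler_peMl //; lia.
  have h2 : (`|ord (E u) y| < N)%N by rewrite ltnS (bigD1 u) //= leq_addr.
  by lia.
have zN : ord (E s) z *+ N < 0 by rewrite pmulrn_llt0.
have [zt|zt] := leP 0 (ord (E t) z).
  exists (z ^+ N * y); rewrite mulf_neq0 ?expf_neq0 // ordM ?expf_neq0 // ordX //.
  split=> //; first by lia.
  move=> u; rewrite inE => /orP[/eqP->|/zT uz]; rewrite ordM ?expf_neq0 // ordX //; last exact: Ny.
  by rewrite ltr_wpDl // mulrn_wge0.
have zne : ord (E s) z != 0 by rewrite lt_eqF.
have [d0 _ ds] := damping z0 (ltn0Sn _ : (0 < N)%N) zne.
have [_ _ dt] := damping z0 (ltn0Sn _ : (0 < N)%N) (ltr0_neq0 zt).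
exists (z ^+ N / (1 + z ^+ N) * y).
have w0 : z ^+ N / (1 + z ^+ N) != 0 by rewrite mulf_neq0 ?expf_neq0 ?invr_neq0.
have wE u : ord (E u) (z ^+ N / (1 + z ^+ N) * y) =
    ord (E u) z *+ N - ord (E u) (1 + z ^+ N) + ord (E u) y.
  by rewrite ordM // ordM ?expf_neq0 ?invr_neq0 // ordX // ordV.
rewrite mulf_neq0 // wE ds // subrr add0r; split=> // u; rewrite wE inE => /orP[/eqP->|/zT uz].
  by rewrite dt // subrr add0r.
have [_ du _] := damping z0 (ltn0Sn _ : (0 < N)%N) (lt0r_neq0 uz).
by rewrite du // subr0; exact: Ny.
Qed.

(** Weak approximation: y times z^N / (1 + z^N), for a function z with a pole at
    s and zeros at the other places. *)
Lemma approximation s (y : K) (M : nat) : exists v, vanish_below M (E s (v - y)) /\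
  forall t, t != s -> vanish_below M (E t v).
Proof.
have [->|y0] := eqVneq y 0.
  by exists 0; rewrite subrr; split=> [|t _]; rewrite rmorph0; exact: vanish_below0.
have [|z [z0 zs zT]] := @separate s (filter (predC1 s) (enum I)).
  by rewrite mem_filter /= eqxx.
have {}zT t : t != s -> 0 < ord (E t) z by move=> ts; apply: zT; rewrite mem_filter /= ts mem_enum.
pose N := (M + \sum_u `|ord (E u) y|).+1%N.
have Ny u : (M + `|ord (E u) y| < N)%N by rewrite ltnS leq_add2l (bigD1 u) //= leq_addr.
have Nz u : 0 < ord (E u) z -> N%:Z <= ord (E u) z *+ N.
  by move=> zu; rewrite -mulr_natr natz ler_peMl //; lia.
have [d0 _ ds] := damping z0 (ltn0Sn _ : (0 < N)%N) (ltr0_neq0 zs).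
have w0 : z ^+ N / (1 + z ^+ N) != 0 by rewrite mulf_neq0 ?expf_neq0 ?invr_neq0.
exists (z ^+ N / (1 + z ^+ N) * y); split=> [|t ts].
  have -> : z ^+ N / (1 + z ^+ N) * y - y = - ((1 + z ^+ N)^-1 * y) by field.
  rewrite rmorphN; apply: vanish_belowN; apply/ord_vanish; first by rewrite mulf_neq0 ?invr_neq0.
  rewrite ordM ?invr_neq0 // ordV // ds //.
  have : N%:Z <= (- ord (E s) z) *+ N by rewrite -mulr_natr natz ler_peMl //; lia.
  by rewrite mulNrn; have := Ny s; lia.
have [_ dt _] := damping z0 (ltn0Sn _ : (0 < N)%N) (lt0r_neq0 (zT _ ts)).
apply/ord_vanish; first by rewrite mulf_neq0.
rewrite ordM // ordM ?expf_neq0 ?invr_neq0 // ordX // ordV // dt ?zT // subr0.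
by have := Nz t (zT _ ts); have := Ny t; lia.
Qed.
End Approximation.

(** * The semilocal lattice *)

Lemma unitmx_ker (F : fieldType) n (A : 'M[F]_n) :
  (forall c : 'rV_n, c *m A = 0 -> c = 0) -> A \in unitmx.
Proof.
move=> H; rewrite -row_free_unit -kermx_eq0; apply/eqP/row_matrixP => i.
by rewrite row0; apply: H; rewrite -row_mul mulmx_ker row0.
Qed.

Lemma polyXn_factor (F : fieldType) (p q : {poly F}) k : p * q = 'X^k ->
  exists c a, c != 0 /\ p = c *: 'X^a.
Proof.
have XI : injective ( *%R ('X : {poly F})) by apply: mulfI; rewrite polyX_eq0.
elim: k p q => [|k IH] p q pq.
  have p0 : p != 0 by apply: contra_eq_neq pq => ->; rewrite mul0r eq_sym oner_eq0.
  have q0 : q != 0 by apply: contra_eq_neq pq => ->; rewrite mulr0 eq_sym oner_eq0.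
  have := size_mul p0 q0; rewrite pq size_poly1 => s1.
  have s2 : (size p <= 1)%N.
    move: s1 p0 q0; rewrite -!size_poly_gt0; case: (size p) (size q) => [|[|a]] [|b] //.
    by rewrite addSn /= addnS.
  exists p`_0, 0%N; rewrite expr0 alg_polyC -(size1_polyC s2); split=> //.
  by apply: contra p0 => /eqP p00; rewrite (size1_polyC s2) p00.
have : (p * q)`_0 = 0 by rewrite pq coefXn.
rewrite coefM big_ord1 => /eqP; rewrite mulf_eq0 => /orP[/eqP p0|/eqP q0].
  have pE := poly_head p; rewrite p0 polyC0 add0r in pE.
  have [|c [a [c0 aE]]] := IH (drop_poly 1 p) q.
    by apply: XI; rewrite mulrA -pE pq exprS.
  by exists c, a.+1; split=> //; rewrite pE aE -scalerAr exprS.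
have qE := poly_head q; rewrite q0 polyC0 add0r in qE.
by apply: (IH p (drop_poly 1 q)); apply: XI; rewrite mulrCA -qE pq exprS.
Qed.

Lemma vbW (A : nzRingType) (f : laurent A) m m' : vanish_below m f -> m' <= m -> vanish_below m' f.
Proof. by move=> fm mm; apply: vanish_belowW fm. Qed.

Section Global.
Variables (F : closedFieldType) (K : fieldType) (iota : {rmorphism F -> K}) (m : nat)
  (E : 'I_m -> {rmorphism K -> laurent F}) (pi : 'I_m -> K).
Hypotheses (E_cst : forall s a, E s (iota a) = lcst a)
  (E_pi : forall s, E s (pi s) = tpow F 1)
  (E_distinct : forall s t, s != t -> exists2 f, vanish_below 0 (E s f) & ~ vanish_below 0 (E t f)).
Variables (x : K) (x0 : x != 0) (x_pole : forall s, ord (E s) x < 0).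

Definition semilocal : set K := [set h | forall s, vanish_below 0 (E s h)].
Local Notation O := semilocal.
Local Notation sg := (x^-1).
Definition pole_order s := `|ord (E s) x|%N.
Local Notation e := pole_order.
Local Notation n := (\sum_s e s)%N.

Lemma pole_order_gt0 s : (0 < e s)%N.
Proof. by rewrite /e; have := x_pole s; lia. Qed.
Lemma pole_orderE s : ord (E s) x = - (e s)%:Z.
Proof. by rewrite /e; have := x_pole s; lia. Qed.
Lemma sg_vanish s : vanish_below (e s) (E s sg).
Proof. by apply/ord_vanish; rewrite ?invr_neq0 // ordV // pole_orderE opprK. Qed.
Lemma x_vanish s : vanish_below (- (e s)%:Z) (E s x).
Proof. by apply/ord_vanish; rewrite // pole_orderE. Qed.
Lemma E_xsg s : E s x * E s sg = 1.
Proof. by rewrite -rmorphM divff // rmorph1. Qed.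
Lemma sgI : injective ( *%R sg).
Proof. by apply: mulfI; rewrite invr_neq0. Qed.

Lemma semilocal_adic : adic_lattice iota sg O.
Proof.
split.
- by move=> u v Ou Ov s; rewrite rmorphB; apply: vanish_belowB.
- by move=> u v Ou Ov s; rewrite rmorphM; apply: vanish_belowM0.
- by move=> a s; rewrite E_cst; exact: vanish_below_cst.
- by move=> s; apply: (vbW (@sg_vanish s)).
- exact: sgI.
Qed.

(** 1/x has order pole_order s at s. *)
Lemma semilocal_sg L h : (forall s, vanish_below (e s * L)%N (E s h)) ->
  exists2 h', O h' & h = sg ^+ L * h'.
Proof.
move=> hv; exists (x ^+ L * h); last by rewrite mulrA -exprMn mulVf // expr1n mul1r.
move=> s; rewrite rmorphM rmorphXn.
by apply: (vbW (vanish_belowM (vanish_belowX (n := L) (@x_vanish s)) (hv s))); lia.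
Qed.

(** The class of h modulo 1/x: at each place s the coefficients of degree less
    than the order e_s of 1/x. *)
Definition kap (h : K) : 'rV[F]_n :=
  \row_k E (tagnat.sig1 k) h (nat_of_ord (tagnat.sig2 k))%:Z.

Lemma kapE h k : kap h 0 k = E (tagnat.sig1 k) h (nat_of_ord (tagnat.sig2 k))%:Z.
Proof. by rewrite mxE. Qed.
Lemma kapB h h' : kap (h - h') = kap h - kap h'.
Proof. by apply/rowP => k; rewrite !mxE rmorphB lcoefB. Qed.
Lemma kap_lin (a : 'I_n -> F) (u : 'I_n -> K) :
  kap (\sum_i iota (a i) * u i) = (\row_i a i) *m (\matrix_i kap (u i)).
Proof.
apply/rowP => k; rewrite !mxE rmorph_sum lcoef_sum; apply: eq_bigr => i _.
by rewrite rmorphM E_cst (lcoef_cstM (a i) (E _ _)) !mxE.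
Qed.

Lemma kap0P h : O h -> (kap h = 0 <-> exists2 h', O h' & h = sg * h').
Proof.
move=> Oh; split=> [k0|[h' Oh' ->]]; last first.
  apply/rowP => k; rewrite !mxE rmorphM; set s := tagnat.sig1 k.
  apply: (vanish_belowM (@sg_vanish s) (Oh' s)).
  by rewrite addr0; have := ltn_ord (tagnat.sig2 k); rewrite -/s; lia.
have [|h' Oh' hE] := @semilocal_sg 1 h; last by exists h'.
move=> s i; rewrite muln1 => ie; case: (ltP i 0) => [/(Oh s)//|i0].
have [j jE] : exists j : nat, i = j%:Z by exists `|i|%N; lia.
rewrite jE in ie *; have je : (j < e s)%N by lia.
have := congr1 (fun r : 'rV_n => r 0 (tagnat.Rank s (Ordinal je))) k0.
rewrite kapE mxE; set k := tagnat.Rank _ _.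
have -> : nat_of_ord (tagnat.sig2 k) = j by rewrite /k tagnat.Rank2K.
by rewrite tagnat.Rank1K.
Qed.

Lemma kap_basis (v : 'I_n -> K) : (forall k, O (v k)) -> (\matrix_i kap (v i)) \in unitmx ->
  adic_basis iota sg O v.
Proof.
move=> Ov Vu; set V := \matrix_i _ in Vu.
have [OB OM Ocst Osg _] := semilocal_adic.
have Osum (a : 'I_n -> F) : O (\sum_j iota (a j) * v j).
  by apply: (adic_sum semilocal_adic) => j _; apply: OM.
split=> //.
- move=> h Oh; pose a := kap h *m invmx V; exists (fun j => a 0 j).
  have [|h' Oh' hE] := (kap0P (OB _ _ Oh (Osum (fun j => a 0 j)))).1.
    rewrite kapB kap_lin -/V; have -> : \row_i a 0 i = a by apply/rowP => i; rewrite mxE.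
    by rewrite mulmxKV // subrr.
  by exists h' => //; rewrite -hE addrC subrK.
- move=> a h' Oh' e1; have := (kap0P (Osum a)).2 (ex_intro2 _ _ h' Oh' e1).
  rewrite kap_lin -/V => /(congr1 (mulmx^~ (invmx V))); rewrite mulmxK // mul0mx => /rowP a0 j.
  by have := a0 j; rewrite !mxE.
Qed.

(** A basis that is, up to order M, the union of the bases 1, pi_s, ...,
    pi_s^(e_s - 1) of the local rings: tau_(s,j) is close to pi_s^j at s and
    close to 0 elsewhere. *)
Definition adapted (M : nat) (tau : 'I_n -> K) := forall k,
  vanish_below M (E (tagnat.sig1 k) (tau k - pi (tagnat.sig1 k) ^+ tagnat.sig2 k)) /\
  forall t, t != tagnat.sig1 k -> vanish_below M (E t (tau k)).

Lemma adapted_exists M : exists tau, adapted M tau.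
Proof.
have /choice [tau tauP] := fun k : 'I_n => approximation E_pi E_distinct (tagnat.sig1 k)
  (pi (tagnat.sig1 k) ^+ tagnat.sig2 k) M.
by exists tau.
Qed.

Lemma E_piX s j : E s (pi s ^+ j) = tpow F j.
Proof. by rewrite rmorphXn E_pi tpowX natz. Qed.

Lemma adapted_semilocal M tau k : (n <= M)%N -> adapted M tau -> O (tau k).
Proof.
move=> nM ad t; have [v1 v2] := ad k.
have [->|ts] := eqVneq t (tagnat.sig1 k); last by apply: (vbW (v2 _ ts)).
rewrite -[tau k](subrK (pi (tagnat.sig1 k) ^+ tagnat.sig2 k)) rmorphD; apply: vanish_belowD.
  exact: (vbW v1).
by rewrite E_piX; apply: (vbW (@vanish_below_tpow F _)).
Qed.

Lemma adapted_kap M tau : (n <= M)%N -> adapted M tau -> \matrix_i kap (tau i) = 1%:M.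
Proof.
move=> nM ad.
have eM s : (e s <= M)%N by apply: leq_trans nM; rewrite (bigD1 s) //= leq_addr.
apply/matrixP => i k; rewrite !mxE; have [v1 v2] := ad i.
have lM : ((tagnat.sig2 k : nat)%:Z < M%:Z) by have := ltn_ord (tagnat.sig2 k); have := eM (tagnat.sig1 k); lia.
set l := nat_of_ord (tagnat.sig2 k) in lM *.
have [ki|ki] := eqVneq (tagnat.sig1 k) (tagnat.sig1 i); last first.
  rewrite v2 //; case: eqP => // ik; by rewrite ik eqxx in ki.
rewrite -[tau i](subrK (pi (tagnat.sig1 i) ^+ tagnat.sig2 i)) rmorphD lcoefD ki v1 // add0r.
rewrite E_piX lcoef_monomialE eqz_nat.
have -> : (i == k) = (l == tagnat.sig2 i).
  apply/eqP/eqP => [->//|e2].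
  by apply/val_inj/eqP; rewrite /= -[i]tagnat.sig2K -[k]tagnat.sig2K tagnat.eq_Rank -/l e2 eq_sym ki !eqxx.
by case: ifP.
Qed.

Lemma adapted_basis M tau : (n <= M)%N -> adapted M tau -> adic_basis iota sg O tau.
Proof.
move=> nM ad; apply: kap_basis => [k|]; first exact: adapted_semilocal ad.
by rewrite (adapted_kap nM ad) unitmx1.
Qed.
End Global.

(** * The ring of regular functions as an F[x]-module *)

Section Birkhoff.
Variables (F : closedFieldType) (K : fieldType) (iota : {rmorphism F -> K}) (m : nat)
  (E : 'I_m -> {rmorphism K -> laurent F}) (pi : 'I_m -> K).
Hypotheses (tr : trdeg1 iota) (E_cst : forall s a, E s (iota a) = lcst a)
  (E_pi : forall s, E s (pi s) = tpow F 1)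
  (E_distinct : forall s t, s != t -> exists2 f, vanish_below 0 (E s f) & ~ vanish_below 0 (E t f)).
Variables (x : K) (x0 : x != 0) (x_pole : forall s, ord (E s) x < 0) (s0 : 'I_m).
Variable R : set K.
Hypotheses (RB : forall u v, R u -> R v -> R (u - v)) (RM : forall u v, R u -> R v -> R (u * v))
  (Rcst : forall a, R (iota a)) (Rx : R x)
  (R_O : forall u, R u -> semilocal E u -> range iota u)
  (R_integral : forall u, integralOver (hev iota x) u -> R u).

Local Notation O := (semilocal E).
Local Notation sg := (x^-1).
Local Notation n := (\sum_s pole_order E x s)%N.
Local Notation kap := (@kap _ _ _ E x).
Local Notation evx := (hev iota x).
Local Notation evs := (hev iota sg).

Let ad := semilocal_adic E_cst x0 x_pole.
Let OB u v : O u -> O v -> O (u - v). Proof. by have [H _ _ _ _] := ad; apply: H. Qed.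
Let OM u v : O u -> O v -> O (u * v). Proof. by have [_ H _ _ _] := ad; apply: H. Qed.
Let Ocst a : O (iota a). Proof. by have [_ _ H _ _] := ad. Qed.
Let Osg : O sg. Proof. by have [_ _ _ H _] := ad. Qed.
Let sgI : injective ( *%R sg). Proof. by have [_ _ _ _ H] := ad. Qed.
Let OD u v : O u -> O v -> O (u + v). Proof. exact: (adicD ad). Qed.
Let OX u k : O u -> O (u ^+ k). Proof. exact: (adicX ad). Qed.
Let RD u v : R u -> R v -> R (u + v).
Proof. by move=> Ru Rv; rewrite -[v]opprK -[- v]sub0r -(rmorph0 iota); apply: RB => //; apply: RB. Qed.
Let R_sum I (r : seq I) (P : pred I) (f : I -> K) :
  (forall j, P j -> R (f j)) -> R (\sum_(j <- r | P j) f j).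
Proof. by move=> H; elim/big_rec: _ => [|j v Pj Rv]; [rewrite -(rmorph0 iota)|apply: RD; auto]. Qed.
Let RX u k : R u -> R (u ^+ k).
Proof. by move=> Ru; elim: k => [|k IH]; rewrite ?expr0 -?(rmorph1 iota) // exprS; apply: RM. Qed.

Lemma x_nonconstant : ~ range iota x.
Proof.
move=> [a _ ax]; have := x_pole s0; rewrite -ax ltNge => /negP; apply.
by apply/ord_vanish; rewrite ?ax // -ax E_cst; exact: vanish_below_cst.
Qed.

(** d(x) / x^l is the leading coefficient of d plus a multiple of 1/x. *)
Lemma evx_lead (d : {poly F}) : d != 0 -> exists2 o, O o &
  sg ^+ (size d).-1 * evx d = iota (lead_coef d) + sg * o.
Proof.
move=> d0; set l := (size d).-1; have sd : size d = l.+1 by rewrite /l prednK // size_poly_gt0.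
exists (\sum_(i < l) iota d`_i * sg ^+ (l - i).-1).
  by apply: (adic_sum ad) => i _; apply: OM => //; apply: OX.
rewrite (hev_wide _ _ (leqnn (size d))) sd big_ord_recr /= mulrDr addrC lead_coefE sd; congr (_ + _).
  by rewrite mulrCA -exprMn mulVf // expr1n mulr1.
rewrite !mulr_sumr; apply: eq_bigr => i _; rewrite [RHS]mulrCA [LHS]mulrCA; congr (_ * _).
have il : (0 < l - i)%N by rewrite subn_gt0.
have -> : sg ^+ l = sg ^+ (l - i) * sg ^+ i by rewrite -exprD subnK // ltnW.
by rewrite -mulrA -exprMn mulVf // expr1n mulr1 -exprS prednK.
Qed.

(** Every class modulo 1/x is the class of h / x^l for some h in R: a function v
    in the class becomes integral over F[x], hence an element of R, after
    multiplication by some d(x), and d(x) is c x^l up to lower order. *)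
Lemma R_surjective (w : 'rV[F]_n) : exists (l : nat) h, [/\ R h, O (sg ^+ l * h) & kap (sg ^+ l * h) = w].
Proof.
have [tau ta] := adapted_exists E_pi E_distinct x n.
have [v Ov kv] : exists2 v, O v & kap v = w.
  exists (\sum_i iota (w 0 i) * tau i).
    by apply: (adic_sum ad) => i _; apply: OM => //; exact: (adapted_semilocal E_pi i (leqnn n) ta).
  rewrite (kap_lin E_cst) (adapted_kap E_pi x0 (leqnn n) ta) mulmx1.
  by apply/rowP => i; rewrite mxE.
have [d d0 Id] := trdeg1_alg v tr x_nonconstant.
have [o Oo oE] := evx_lead d0; set l := (size d).-1 in oE; set c := lead_coef d in oE.
have c0 : c != 0 by rewrite lead_coef_eq0.
have lE : sg ^+ l * (iota c^-1 * (evx d * v)) = v + sg * (iota c^-1 * (o * v)).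
  have -> : sg ^+ l * (iota c^-1 * (evx d * v)) = iota c^-1 * (sg ^+ l * evx d) * v by ring.
  rewrite oE mulrDr -rmorphM mulVf // rmorph1; ring.
exists l, (iota c^-1 * (evx d * v)); split.
- by apply: RM => //; apply: R_integral.
- by rewrite lE; apply: OD => //; apply: OM => //; apply: OM => //; apply: OM.
- rewrite lE -[sg * _]opprK kapB -[- (sg * _)]mulrN.
  have -> : kap (sg * - (iota c^-1 * (o * v))) = 0.
    apply/(kap0P x0 x_pole); first by apply: OM => //; apply: (adicN ad); apply: OM => //; apply: OM.
    by exists (- (iota c^-1 * (o * v))) => //; apply: (adicN ad); apply: OM => //; apply: OM.
  by rewrite subr0.
Qed.

(** Families u of elements of R whose classes of u_i / x^(d_i) form an F-basis
    of O modulo 1/x; D is the total degree, to be minimized. *)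
Definition flag_basis D := exists (u : 'I_n -> K) (d : 'I_n -> nat),
  [/\ forall i, R (u i), forall i, O (sg ^+ d i * u i),
      (\matrix_i kap (sg ^+ d i * u i)) \in unitmx & (\sum_i d i)%N = D].

Lemma flag_basis_exists : exists D, flag_basis D.
Proof.
have /choice [d dP] := fun i : 'I_n => R_surjective (delta_mx 0 i).
have /choice [u uP] := dP; exists (\sum_i d i)%N, u, d; split=> //.
- by move=> i; have [] := uP i.
- by move=> i; have [] := uP i.
- have -> : \matrix_i kap (sg ^+ d i * u i) = 1%:M; last exact: unitmx1.
  by apply/row_matrixP => i; rewrite rowK row1; have [] := uP i.
Qed.

(** In a family of minimal total degree, the class of h / x^l for h in R only
    involves basis elements of degree at most l: otherwise h could replace one
    of larger degree. *)
Lemma flag_basis_exchange D u d : 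
  (forall D', flag_basis D' -> (D <= D')%N) ->
  (forall i, R (u i)) -> (forall i, O (sg ^+ d i * u i)) ->
  (\matrix_i kap (sg ^+ d i * u i)) \in unitmx -> (\sum_i d i)%N = D ->
  forall l h, R h -> O (sg ^+ l * h) -> forall j : 'I_n,
  (kap (sg ^+ l * h) *m invmx (\matrix_i kap (sg ^+ d i * u i))) 0 j != 0 -> (d j <= l)%N.
Proof.
move=> Dmin Ru Ou; set V := \matrix_i _ => Vu dD l h Rh Oh j; set a := kap _ *m _ => aj.
have aV : a *m V = kap (sg ^+ l * h) by rewrite /a mulmxKV.
clearbody a; rewrite leqNgt; apply/negP => lj.
(* replace u_j by h *)
pose u' i := if i == j then h else u i; pose d' i := if i == j then l else d i.
have : flag_basis (\sum_i d' i)%N.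
  exists u', d'; split=> //.
  - by move=> i; rewrite /u'; case: eqP.
  - by move=> i; rewrite /u' /d'; case: eqP.
  - apply: unitmx_ker => c.
    have -> : c *m (\matrix_i kap (sg ^+ d' i * u' i)) = (\row_i (if i == j then c 0 j * a 0 j else c 0 i + c 0 j * a 0 i)) *m V.
      have -> : \row_i (if i == j then c 0 j * a 0 j else c 0 i + c 0 j * a 0 i) =
          (\row_i (if i == j then 0 else c 0 i)) + c 0 j *: a.
        by apply/rowP => i; rewrite !mxE; case: eqP => [->|]; rewrite ?add0r.
      rewrite mulmxDl -scalemxAl aV; apply/rowP => k; rewrite !mxE (bigD1 j) //= [in RHS](bigD1 j) //=.
      rewrite !mxE /d' /u' eqxx mul0r add0r addrC; congr (_ + _).
      by apply: eq_bigr => i ij; rewrite !mxE (negPf ij).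
    move/(congr1 (mulmx^~ (invmx V))); rewrite mulmxK // mul0mx => /rowP H.
    have cj : c 0 j = 0.
      by have := H j; rewrite !mxE eqxx => /eqP; rewrite mulf_eq0 (negPf aj) orbF => /eqP.
    apply/rowP => i; have := H i; rewrite !mxE; case: eqP => [->|_]; rewrite ?cj //.
    by rewrite mul0r addr0.
have e1 : (\sum_i d' i = l + \sum_(i | i != j) d i)%N.
  rewrite (bigD1 j) //= /d' eqxx; congr (_ + _)%N.
  by apply: eq_bigr => i /negPf ->.
move/Dmin; rewrite -dD e1 (bigD1 j) //= leq_add2r.
by rewrite leqNgt lj.
Qed.

Lemma R_filtration h : exists l, O (sg ^+ l * h).
Proof.
have [->|h0] := eqVneq h 0; first by exists 0%N; rewrite mulr0; exact: (adic0 ad).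
exists (\sum_s `|ord (E s) h|)%N => s; apply/ord_vanish.
  by rewrite mulf_neq0 ?expf_neq0 ?invr_neq0.
rewrite ordM ?expf_neq0 ?invr_neq0 // ordX ?invr_neq0 // ordV // pole_orderE // opprK.
have e0 := pole_order_gt0 x0 x_pole s.
have h1 : (`|ord (E s) h| <= \sum_s `|ord (E s) h|)%N by rewrite (bigD1 s) //= leq_addr.
set N := (\sum_s _)%N in h1 *.
have h2 : N%:Z <= (pole_order E x s)%:Z *+ N by rewrite -mulr_natr natz ler_peMl //; lia.
by lia.
Qed.

(** R is a free F[x]-module, with a basis that is compatible with the behaviour
    at the poles of x: this is the splitting of a vector bundle on the
    projective line. For h in R of degree l, flag_basis_exchange allows to
    subtract a combination of the u_j with coefficients in F[x] so that the
    degree drops. Below degree 0, only functions regular everywhere that vanish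
    at a pole of x remain, and these are 0. *)
Lemma R_basis : exists (u : 'I_n -> K) (d : 'I_n -> nat), 
  [/\ forall i, R (u i), adic_basis iota sg O (fun i => sg ^+ d i * u i) &
      forall h, R h -> exists p : 'I_n -> {poly F}, h = \sum_j evx (p j) * u j].
Proof.
have [D [u [d [Ru Ou Vu dD]]] Dmin] : exists2 D, flag_basis D & forall D', flag_basis D' -> (D <= D')%N.
  have [D0 fD0] := flag_basis_exists.
  have ex : exists D, `[< flag_basis D >] by exists D0; apply/asboolP.
  case: (ex_minnP ex) => D /asboolP fD Dm; exists D => // D' fD'; apply: Dm; exact/asboolP.
have ob : adic_basis iota sg O (fun i => sg ^+ d i * u i) by apply: kap_basis.
exists u, d; split=> // h Rh; have [l Oh] := R_filtration h.
have step k g : R g -> O (sg ^+ k * g) -> exists (p : 'I_n -> {poly F}) g1,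
    [/\ R g1, g = \sum_j evx (p j) * u j + g1 & exists2 g', O g' & sg ^+ k * g1 = sg * g'].
  move=> Rg Og; have := flag_basis_exchange Dmin Ru Ou Vu dD Rg Og.
  set V := \matrix_i _ in Vu *; set a := kap _ *m _ => exch.
  have aV : a *m V = kap (sg ^+ k * g) by rewrite /a mulmxKV.
  clearbody a.
  pose p j : {poly F} := a 0 j *: 'X^(k - d j).
  have pE j : sg ^+ k * (evx (p j) * u j) = iota (a 0 j) * (sg ^+ d j * u j).
    have [aj|aj] := eqVneq (a 0 j) 0; first by rewrite /p aj scale0r !rmorph0 !mul0r mulr0.
    rewrite /p hevZ hevXn; have dk := exch j aj.
    have -> : sg ^+ k = sg ^+ (k - d j) * sg ^+ d j by rewrite -exprD subnK.
    have xs : sg ^+ (k - d j) * x ^+ (k - d j) = 1 by rewrite -exprMn mulVf // expr1n.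
    transitivity (iota (a 0 j) * (sg ^+ d j * u j) * (sg ^+ (k - d j) * x ^+ (k - d j))); first ring.
    by rewrite xs mulr1.
  have sE : sg ^+ k * \sum_j evx (p j) * u j = \sum_j iota (a 0 j) * (sg ^+ d j * u j).
    by rewrite mulr_sumr; apply: eq_bigr => j _; rewrite pE.
  exists p, (g - \sum_j evx (p j) * u j); split.
  - apply: RB => //; apply: R_sum => j _; apply: RM => //.
    by rewrite /p hevZ hevXn; apply: RM => //; apply: RX.
  - by rewrite addrC subrK.
  - apply/(kap0P x0 x_pole); rewrite mulrBr sE.
      by apply: OB => //; apply: (adic_sum ad) => j _; apply: OM.
    rewrite kapB (kap_lin E_cst) -/V; have -> : \row_i a 0 i = a by apply/rowP => i; rewrite mxE.
    by rewrite aV subrr.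
elim: l h Rh Oh => [|l IH] h Rh Oh; have [p [h1 [Rh1 hE [h' Oh' h1E]]]] := step _ _ Rh Oh.
  exists p; rewrite {1}hE; rewrite expr0 mul1r in h1E.
  suff -> : h1 = 0 by rewrite addr0.
  have Oh1 : O h1 by rewrite h1E; apply: OM.
  have [c _ cE] := R_O Rh1 Oh1.
  have c0 : c = 0.
    have := vanish_belowM (sg_vanish x0 x_pole (s := s0)) (Oh' s0); rewrite -rmorphM -h1E -cE E_cst.
    move=> /(_ 0); rewrite lcoef_monomialE eqxx addr0; apply.
    by have := pole_order_gt0 x0 x_pole s0; lia.
  by rewrite -cE c0 rmorph0.
have [p' p'E] : exists p' : 'I_n -> {poly F}, h1 = \sum_j evx (p' j) * u j.
  apply: IH => //; suff -> : sg ^+ l * h1 = h' by [].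
  by apply: sgI; rewrite mulrA -exprS h1E.
exists (fun j => p j + p' j); rewrite {1}hE {1}p'E -big_split; apply: eq_bigr => j _.
by rewrite rmorphD mulrDl.
Qed.

Lemma evx_to_evs (p : {poly F}) k : (size p <= k)%N -> exists q, sg ^+ k * evx p = evs q.
Proof.
move=> pk; exists (\sum_(i < k) p`_i *: 'X^(k - i)).
rewrite (hev_wide _ _ pk) mulr_sumr rmorph_sum; apply: eq_bigr => i _ /=.
rewrite hevZ hevXn mulrCA; congr (_ * _).
have -> : sg ^+ k = sg ^+ (k - i) * sg ^+ i by rewrite -exprD subnK // ltnW.
by rewrite -mulrA -exprMn mulVf // expr1n mulr1.
Qed.

(** In the basis u_i / x^(d_i) the multiplication by f / x^N has, for N large,
    coefficients that are polynomials in 1/x, exactly and not only modulo a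
    power of 1/x. *)
Lemma R_matrix (u : 'I_n -> K) (d : 'I_n -> nat) : 
  (forall i, R (u i)) ->
  (forall h, R h -> exists p : 'I_n -> {poly F}, h = \sum_j evx (p j) * u j) ->
  forall f, R f -> exists N0, forall N, (N0 <= N)%N -> O (sg ^+ N * f) /\
   exists M : 'M[{poly F}]_n, 
    forall i, sg ^+ N * f * (sg ^+ d i * u i) = \sum_j evs (M i j) * (sg ^+ d j * u j).
Proof.
move=> Ru gen f Rf.
have /choice [p pE] := fun i => gen _ (RM Rf (Ru i)).
have [l Ol] := R_filtration f.
exists (l + \sum_i \sum_j (size (p i j) + d j))%N => N NN; split.
  have -> : sg ^+ N * f = sg ^+ (N - l) * (sg ^+ l * f) by rewrite mulrA -exprD subnK //; lia.
  by apply: OM => //; apply: OX.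
have HN i j : (size (p i j) + d j <= N)%N.
  by apply: leq_trans NN; rewrite (bigD1 i) //= (bigD1 j) //= -addnA addnCA leq_addr.
have H i j : exists q, sg ^+ (N - d j) * evx (p i j) = evs q.
  by apply: evx_to_evs; have := HN i j; lia.
have /choice [q qE] : forall ij : 'I_n * 'I_n, exists q, sg ^+ (N - d ij.2) * evx (p ij.1 ij.2) = evs q.
  by move=> ij; apply: H.
exists (\matrix_(i, j) (q (i, j) * 'X^(d i))) => i.
transitivity (sg ^+ (N + d i) * (f * u i)); first by rewrite exprD; ring.
rewrite pE mulr_sumr; apply: eq_bigr => j _; rewrite mxE rmorphM /= hevXn -(qE (i, j)) exprD.
have dN : (d j <= N)%N by have := HN i j; lia.
have -> : sg ^+ N = sg ^+ (N - d j) * sg ^+ d j by rewrite -exprD subnK.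
ring.
Qed.

(** The matrices M and M' of f / x^N and f' / x^N have polynomial determinants
    in X = 1/x, with product X^(2Nn); hence both are monomials. This is the
    statement that the norm of a unit of R is a unit of F[x], hence a constant. *)
Lemma R_unit_det f f' : R f -> R f' -> f * f' = 1 -> exists (v : 'I_n -> K) N (c : F) (a : nat),
  [/\ c != 0, adic_basis iota sg O v, O (sg ^+ N * f) &
      forall L, has_det iota sg O v L (sg ^+ N * f) (c *: 'X^a)].
Proof.
move=> Rf Rf' ff.
have [u [d [Ru vb gen]]] := R_basis.
have [N0 H] := R_matrix d Ru gen Rf; have [N1 H'] := R_matrix d Ru gen Rf'.
pose N := maxn N0 N1; have [Of [M ME]] := H N (leq_maxl _ _); have [Of' [M' ME']] := H' N (leq_maxr _ _).
have MM L : mul_mx iota sg O (fun i => sg ^+ d i * u i) L (sg ^+ N * f) M.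
  by move=> i; rewrite ME; exact: (eqL_refl ad).
have MM' L : mul_mx iota sg O (fun i => sg ^+ d i * u i) L (sg ^+ N * f') M'.
  by move=> i; rewrite ME'; exact: (eqL_refl ad).
have red L : in_qpoly 'X^(L.+1) (\det M * \det M') = in_qpoly 'X^(L.+1) (('X^(N + N)) ^+ n : {poly F}).
  apply: (has_det_unique ad vb (eqL_refl ad _ _)).
    exact: (has_detM ad vb (has_det_mx Of (MM L)) (has_det_mx Of' (MM' L))).
  have -> : sg ^+ N * f * (sg ^+ N * f') = evs 'X^(N + N).
    by rewrite hevXn exprD mulrACA ff mulr1.
  exact: (has_det_hev ad).
(* the congruences modulo X^(L+1) for all L amount to an equality *)
have e1 : \det M * \det M' = 'X^((N + N) * n).
  rewrite exprM; apply/polyP => i; have /eq_trunc := red i; exact.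
have [c [a [c0 aE]]] := polyXn_factor e1.
exists (fun i => sg ^+ d i * u i), N, c, a; split=> // L.
by rewrite -aE; apply: has_det_mx => //; exact: MM.
Qed.

End Birkhoff.

(** * The global determinant as a product of local ones *)

Lemma det_mxdiag (R : comNzRingType) n (p : 'I_n -> nat) (B : forall i, 'M[R]_(p i)) :
  \det (\mxdiag_i B i) = \prod_i \det (B i).
Proof.
elim: n p B => [|n IH] p B.
  by move: (\mxdiag_i B i); rewrite !big_ord0 => M; rewrite det_mx00.
rewrite mxdiag_recl [RHS]big_ord_recl -IH.
by case: _ / mxsize_recl; rewrite ?castmx_id det_ublock.
Qed.

Lemma sum_tagnat (V : nmodType) m (e : 'I_m -> nat) (G : 'I_(\sum_s e s) -> V) :
  \sum_k G k = \sum_s \sum_(j < e s) G (tagnat.Rank s j).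
Proof.
rewrite sig_big_dep /= (reindex _ (tagnat.rank_bij_on (p_ := e))) /=.
by apply: eq_bigr => -[s j] _; rewrite tagnat.rankE.
Qed.

Section BlockDet.
Variables (F : closedFieldType) (K : fieldType) (iota : {rmorphism F -> K}) (m : nat)
  (E : 'I_m -> {rmorphism K -> laurent F}) (pi : 'I_m -> K).
Hypotheses (E_cst : forall s a, E s (iota a) = lcst a) (E_pi : forall s, E s (pi s) = tpow F 1).
Variables (x : K) (x0 : x != 0) (x_pole : forall s, ord (E s) x < 0).
Local Notation O := (semilocal E).
Local Notation sg := (x^-1).
Local Notation e := (pole_order E x).
Local Notation n := (\sum_s e s)%N.

Lemma E_hev s p : E s (hev iota sg p) = hev lcst (E s sg) p.
Proof.
elim/poly_ind: p => [|p c IH]; first by rewrite !rmorph0.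
by rewrite rmorphD rmorphM /= hevX hevC rmorphD rmorphM E_cst IH [in RHS]rmorphD rmorphM /= hevX hevC.
Qed.

Lemma adaptedR M tau (s : 'I_m) (j : 'I_(e s)) : adapted pi M tau ->
  vanish_below M (E s (tau (tagnat.Rank s j) - pi s ^+ j)) /\
  forall t, t != s -> vanish_below M (E t (tau (tagnat.Rank s j))).
Proof.
move=> ad; have := ad (tagnat.Rank s j).
have -> : nat_of_ord (tagnat.sig2 (tagnat.Rank s j)) = j by rewrite tagnat.Rank2K.
by rewrite tagnat.Rank1K.
Qed.

Lemma mxdiagR (N : forall s, 'M[{poly F}]_(e s)) s j s' j' :
  (\mxdiag_s N s) (tagnat.Rank s j) (tagnat.Rank s' j') =
  if s == s' then conform_mx 0 (N s) j j' else 0.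
Proof.
have -> : (\mxdiag_s N s) (tagnat.Rank s j) (tagnat.Rank s' j') = submxblock (\mxdiag_s N s) s s' j j'.
  by rewrite [RHS]mxE.
by rewrite /mxdiag mxblockK; case: ifP => // _; rewrite mxE.
Qed.

(** In an adapted basis the matrix of h is block diagonal up to the precision
    considered. *)
Lemma adapted_det L M (tau : 'I_n -> K) h (d : 'I_m -> {poly F}) : (n <= M)%N -> (n * L.+1 <= M)%N ->
  adapted pi M tau -> O h ->
  (forall s, has_det lcst (E s sg) (@lattice F) (@tbasis F (e s)) L (E s h) (d s)) ->
  has_det iota sg O tau L h (\prod_s d s).
Proof.
move=> nM nLM ad Oh hd; split=> //.
have eM s : (e s * L.+1 <= M)%N.
  by apply: leq_trans nLM; rewrite leq_mul2r (bigD1 s) //= leq_addr ?orbT.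
have NP s : exists N : 'M[{poly F}]_(e s),
    mul_mx lcst (E s sg) (@lattice F) (@tbasis F (e s)) L (E s h) N /\
    in_qpoly ('X^(L.+1) : {poly F}) (\det N) = in_qpoly 'X^(L.+1) (d s).
  by have [_ [N hN Nd]] := hd s; exists N.
pose N s := sval (cid (NP s)).
have hN s : mul_mx lcst (E s sg) (@lattice F) (@tbasis F (e s)) L (E s h) (N s).
  by have [] := svalP (cid (NP s)).
have Nd s : in_qpoly ('X^(L.+1) : {poly F}) (\det (N s)) = in_qpoly 'X^(L.+1) (d s).
  by have [] := svalP (cid (NP s)).
exists (\mxdiag_s N s); last first.
  by rewrite det_mxdiag !rmorph_prod; apply: eq_bigr => s _; exact: Nd.
have Oev p t : vanish_below 0 (E t (hev iota sg p)).
  exact: (adic_hev (semilocal_adic E_cst x0 x_pole)).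
move=> k; rewrite -[k]tagnat.sig2K; move: (tagnat.sig1 k) (tagnat.sig2 k) => s j.
have sumE : \sum_l hev iota sg ((\mxdiag_s N s) (tagnat.Rank s j) l) * tau l =
    \sum_(j' < e s) hev iota sg (N s j j') * tau (tagnat.Rank s j').
  rewrite sum_tagnat (bigD1 s) //= [X in _ + X]big1 ?addr0 => [|s' ss].
    by apply: eq_bigr => j' _; rewrite mxdiagR eqxx conform_mx_id.
  by rewrite big1 // => j' _; rewrite mxdiagR eq_sym (negPf ss) rmorph0 mul0r.
rewrite sumE; apply: (semilocal_sg x0 x_pole) => t.
have [->|ts] := eqVneq t s; last first.
  move: (eM t); move: (e t * L.+1)%N => B eB.
  rewrite rmorphB rmorphM rmorph_sum; apply: vanish_belowB.
    have [_ v] := adaptedR j ad; apply: (vbW (vanish_belowM (Oh t) (v t ts))).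
    by rewrite add0r lez_nat.
  apply: vanish_below_sum => j' _; rewrite rmorphM.
  have [_ v] := adaptedR j' ad; apply: (vbW (vanish_belowM (Oev (N s j j') t) (v t ts))).
  by rewrite add0r lez_nat.
have v1 : vanish_below (e s * L.+1)%N (E s h * tpow F j - \sum_(j' < e s) hev lcst (E s sg) (N s j j') * tpow F j').
  exact: (vanish_eqL (pole_order_gt0 x0 x_pole s) (@sg_vanish _ _ _ _ _ x0 x_pole s) (hN s j)).
move: (eM s) v1; move: (e s * L.+1)%N => B eB v1.
pose dlt j' := E s (tau (tagnat.Rank s j')) - tpow F j'.
have dv j' : vanish_below B (dlt j').
  have [v _] := adaptedR j' ad.
  by rewrite rmorphB rmorphXn E_pi tpowX natz in v; apply: (vbW v); rewrite lez_nat.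
have -> : E s (h * tau (tagnat.Rank s j) - \sum_(j' < e s) hev iota sg (N s j j') * tau (tagnat.Rank s j')) =
  (E s h * tpow F j - \sum_(j' < e s) hev lcst (E s sg) (N s j j') * tpow F j') +
  (E s h * dlt j - \sum_(j' < e s) hev lcst (E s sg) (N s j j') * dlt j').
  rewrite rmorphB rmorphM rmorph_sum addrACA -opprD -big_split -mulrDr; congr (_ * _ - _).
    by rewrite addrC subrK.
  apply: eq_bigr => j' _; rewrite rmorphM E_hev /= -mulrDr; congr (_ * _).
  by rewrite addrC subrK.
apply: vanish_belowD => //; apply: vanish_belowB.
  by have := vanish_belowM (Oh s) (dv j); rewrite add0r.
apply: vanish_below_sum => j' _; rewrite -E_hev.
by have := vanish_belowM (Oev (N s j j') s) (dv j'); rewrite add0r.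
Qed.
End BlockDet.

(** * The symbol at one place *)

Section LocalSymbol.
Variables (F : closedFieldType) (k : comUnitRingType) (lam : {rmorphism F -> k})
  (rho : {rmorphism k -> F}) (eps : k) (n : nat).
Hypotheses (lamK : cancel lam rho) (eps_nil : eps ^+ n = 0)
  (rho_ker : forall x, rho x = 0 -> exists y, x = eps * y).

Lemma rho_horner_polar q a : polar rho q -> rho q.[a] = 1.
Proof. by move=> qp; rewrite -horner_map /= (polarP rho qp.1).1 // hornerC. Qed.

(** The nonzero constant terms force p = q, so that U and V agree up to order n. *)
Lemma hev_eq_trunc L p q (U V : {poly F}) delta : delta ^+ n = 0 ->
  in_qpoly 'X^(L.+1) ('X^p * U) = in_qpoly 'X^(L.+1) ('X^q * V) ->
  U`_0 != 0 -> V`_0 != 0 -> (n + p + q <= L)%N ->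
  U`_0 = V`_0 /\ hev lam delta U = hev lam delta V.
Proof.
move=> dn /eq_trunc H U0 V0 Lb.
have pq : p = q.
  case: (ltngtP p q) => // pq.
    have := H p; rewrite !coefXnM ltnn subnn pq => /(_ ltac:(lia)) e.
    by move: U0; rewrite e eqxx.
  have := H q; rewrite !coefXnM ltnn subnn pq => /(_ ltac:(lia)) e.
  by move: V0; rewrite -e eqxx.
have UV j : (j <= n)%N -> U`_j = V`_j.
  move=> jn; have := H (p + j)%N; rewrite !coefXnM -pq ltnNge leq_addr /= addKn.
  by apply; lia.
split; first exact: UV.
apply/eqP; rewrite -subr_eq0 -rmorphB /=.
have -> : U - V = drop_poly n (U - V) * 'X^n.
  rewrite -[LHS](poly_take_drop n); suff -> : take_poly n (U - V) = 0 by rewrite add0r.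
  by apply/polyP => j; rewrite coef_take_poly coef0 coefB; case: ltnP => // /ltnW /UV ->; rewrite subrr.
by rewrite rmorphM /= hevXn dn mulr0.
Qed.

Section OnePlace.
Variables (e : nat) (sg x : laurent F).
Hypotheses (e0 : (0 < e)%N) (sge : vanish_below e sg) (xe : vanish_below (- e%:Z) x)
  (xsg : x * sg = 1).
Variables (L : nat) (delta : k) (c : 'I_e -> {poly F}).
Hypotheses (L0 : (0 < L)%N) (deltaL : delta ^+ L = 0) (wc : is_weierstrass sg L c).

(** The determinant of the multiplication by t, divided by X. *)
Definition norm_t : {poly F} := (-1) ^+ e.+1 * drop_poly 1 (c (Ordinal e0)).
Lemma norm_tE : \det (compmx c) = 'X * norm_t.
Proof.
rewrite (@det_compmx _ _ _ (Ordinal e0)) // mulrCA; congr (_ * _).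
by rewrite {1}(poly_head (c _)) (weierstrass0 e0 sge xe xsg wc) add0r.
Qed.
Lemma norm_t0 : norm_t`_0 != 0.
Proof.
have h := weierstrass1 e0 sge xe xsg L0 wc.
have h0 : (c (Ordinal e0))`_1 != 0.
  by apply/eqP => h0; move: h; rewrite h0 mulr0 => /esym/eqP; rewrite oner_eq0.
rewrite /norm_t -polyC1 -polyCN -polyC_exp coefCM coef_drop_poly.
by rewrite mulf_neq0 ?expf_neq0 ?oppr_eq0 ?oner_eq0.
Qed.

(** The determinant of the multiplication by prod (1 - alpha_i t^(i+1)), the
    product being truncated. *)
Definition norm_roots (alpha : nat -> F) Lw : {poly F} :=
  \prod_(i < Lw) \prod_(y <- radicals i.+1 (alpha i)) \det (1%:M - y%:P *: compmx c).
Lemma norm_roots0 alpha Lw : (norm_roots alpha Lw)`_0 = 1.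
Proof.
have H (y : F) : (\det (1%:M - y%:P *: compmx c))`_0 = 1.
  rewrite -(rho_ev lamK deltaL) -horner_weierstrass_rev.
  apply: rho_horner_polar; apply: (polar_weierstrass_rev lamK e0 sge xe xsg); [exact: deltaL|exact: wc].
rewrite /norm_roots -horner_coef0 !horner_prod big1 // => i _.
by rewrite horner_prod big1 // => y _; rewrite horner_coef0 H.
Qed.

(** By weierstrass_triang the two factors of the symbol are, up to constants,
    the values at X = delta of the determinants of t^w and of the power series
    with constant term 1. Powers with negative exponent are moved to the other
    side. *)
Lemma local_symbol w (P : laurent F) a0 alpha q Pg : witt_series P a0 alpha ->
  triang rho (1 - lcst delta * map_laurent lam x) 0 q Pg ->
  exists Lw0, forall Lw, (Lw0 <= Lw)%N ->
  let wp := if 0 <= w then `|w|%N else 0%N in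
  let wn := if 0 <= w then 0%N else `|w|%N in
  contou_carrere (map_laurent lam (tpow F w * P)) (1 - lcst delta * map_laurent lam x)
    * hev lam delta norm_t ^+ wn * lam norm_t`_0 ^+ wp =
  hev lam delta (norm_t ^+ wp * norm_roots alpha Lw) * lam norm_t`_0 ^+ wn.
Proof.
move=> ws T; have [Lw0 H] := contou_carrere_triang lamK eps_nil rho_ker w ws T.
exists Lw0 => Lw LL wp wn; rewrite (H _ LL).
have [qE PgE] := weierstrass_triang lamK eps_nil rho_ker e0 sge xe xsg L0 deltaL wc T.
have rE : Pg 0 * hev lam delta norm_t = lam norm_t`_0.
  rewrite /norm_t -polyC1 -polyCN -polyC_exp rmorphM /= hevC mulrCA PgE -rmorphM coefCM.
  by rewrite coef_drop_poly.
have DE : root_product lam alpha Lw q = hev lam delta (norm_roots alpha Lw).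
  rewrite /root_product /norm_roots rmorph_prod; apply: eq_bigr => i _.
  by rewrite rmorph_prod; apply: eq_bigr => y _; rewrite qE horner_weierstrass_rev.
have Pu : Pg 0 \is a GRing.unit by case: T.
have evE b (D : {poly F}) : hev lam delta (norm_t ^+ b * D) = hev lam delta norm_t ^+ b * hev lam delta D.
  by rewrite rmorphM rmorphXn.
rewrite DE evE -rE; set r := hev _ _ norm_t; rewrite /wp /wn.
case: ifP => w0.
  have -> : Pg 0 ^ (- w) = (Pg 0) ^- `|w|%N by rewrite exprnN gez0_abs.
  rewrite !expr0 !mulr1 exprMn; have uu := mulVr (unitrX `|w|%N Pu).
  have e1 (a b c' d : k) : a * b = 1 -> a * c' * (b * d) = d * c'.
    by move=> ab; rewrite mulrACA ab mul1r mulrC.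
  exact: e1.
have -> : Pg 0 ^ (- w) = (Pg 0) ^+ `|w|%N.
  by rewrite exprnP; congr (_ ^ _); lia.
by rewrite !expr0 !mulr1 mul1r exprMn; ring.
Qed.
End OnePlace.
End LocalSymbol.

(** * Reciprocity for 1 - delta x *)

Section SymbolProduct.
Variables (F : closedFieldType) (k : comUnitRingType) (lam : {rmorphism F -> k})
  (rho : {rmorphism k -> F}) (eps : k) (n : nat).
Hypotheses (lamK : cancel lam rho) (n0 : (0 < n)%N) (eps_nil : eps ^+ n = 0)
  (rho_ker : forall x, rho x = 0 -> exists y, x = eps * y).
Variables (K : fieldType) (iota : {rmorphism F -> K}) (m : nat)
  (E : 'I_m -> {rmorphism K -> laurent F}) (pi : 'I_m -> K).
Hypotheses (tr : trdeg1 iota) (E_cst : forall s a, E s (iota a) = lcst a)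
  (E_pi : forall s, E s (pi s) = tpow F 1)
  (E_distinct : forall s t, s != t -> exists2 f, vanish_below 0 (E s f) & ~ vanish_below 0 (E t f)).
Variables (x : K) (x0 : x != 0) (x_pole : forall s, ord (E s) x < 0) (s0 : 'I_m).
Variable R : set K.
Hypotheses (RB : forall u v, R u -> R v -> R (u - v)) (RM : forall u v, R u -> R v -> R (u * v))
  (Rcst : forall a, R (iota a)) (Rx : R x)
  (R_O : forall u, R u -> semilocal E u -> range iota u)
  (R_integral : forall u, integralOver (hev iota x) u -> R u).

(** The function f / x^N0 has the determinant c X^a by R_unit_det and, by
    adapted_det and local_det, also a product of local determinants. After
    division by powers of X this becomes an equality of polynomials U1 = U2 with
    nonzero constant terms, up to a high order. By local_symbol, the product of
    the symbols is the quotient of U2(delta) / U2(0) by U1(delta) / U1(0). *)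
Lemma symbol_product f f' (i : nat) : R f -> R f' -> f * f' = 1 -> (0 < i)%N ->
  \prod_s contou_carrere (map_laurent lam (E s f))
            (1 - lcst (eps ^+ i) * map_laurent lam (E s x)) = 1.
Proof.
move=> Rf Rf' ff i0.
have [v [N0 [c [a [c0 vb Of hd]]]]] :=
  R_unit_det tr E_cst E_pi E_distinct x0 x_pole s0 RB RM Rcst Rx R_O R_integral Rf Rf' ff.
have f0 : f != 0 by apply/eqP => f0; move: ff; rewrite f0 mul0r => /esym/eqP; rewrite oner_eq0.
pose e := pole_order E x.
have e0 s : (0 < e s)%N := @pole_order_gt0 _ _ _ _ _ x0 x_pole s.
have sge s : vanish_below (e s) (E s x^-1) by apply: (@sg_vanish _ _ _ _ _ x0 x_pole).
have xe s : vanish_below (- (e s)%:Z) (E s x) by apply: (@x_vanish _ _ _ _ _ x0 x_pole).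
have xsg s : E s x * E s x^-1 = 1 by apply: (E_xsg E x0).
have /choice [w] : forall s, exists w, exists P a0 alpha, E s f = tpow F w * P /\ witt_series P a0 alpha.
  by move=> s; apply: witt_series_exists; apply/eqP; rewrite fmorph_eq0.
move=> /choice [P] /choice [a0] /choice [alpha] EP.
have ws s : witt_series (P s) (a0 s) (alpha s) by case: (EP s).
pose delta := eps ^+ i.
have deltaL L : (n <= L)%N -> delta ^+ L = 0.
  by move=> nL; rewrite /delta -exprM -(subnK (leq_trans nL (leq_pmull L i0))) exprD eps_nil mulr0.
have /choice [q] : forall s, exists q, exists Pg,
    triang rho (1 - lcst delta * map_laurent lam (E s x)) 0 q Pg.
  move=> s; have [|q [Pg [T _]]] :=
    @triang_exists _ _ _ _ _ _ lamK eps_nil rho_ker (1 - 'X^i * (E s x)%:P) n0.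
    by rewrite coefB coefC coefXnM i0 subr0.
  exists q, Pg; move: T; rewrite rmorphB rmorph1 rmorphM /=.
  by rewrite epolyXn epolyC.
move=> /choice [Pg] T.
pose wp s := if 0 <= w s then `|w s|%N else 0%N.
pose wn s := if 0 <= w s then 0%N else `|w s|%N.
pose nn := (\sum_s e s)%N; pose Wp := (\sum_s wp s)%N; pose Wn := (\sum_s wn s)%N.
(* the precision must exceed the powers of X to be cancelled by n, the order of eps *)
pose L := (n + (a + Wn) + (N0 * nn + Wp)).+1.
have nL : (n <= L)%N by rewrite /L; lia.
have L0 : (0 < L)%N by [].
have ccx s : exists c, is_weierstrass (E s x^-1) L (c : 'I_(e s) -> _).
  exact: (weierstrass_exists (e0 s) (sge s) (xe s) (xsg s)).
pose cc s := sval (cid (ccx s)); have wc s : is_weierstrass (E s x^-1) L (cc s) := svalP (cid (ccx s)).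
have /choice [Lw0 sym] := fun s => local_symbol lamK eps_nil rho_ker (e0 s) (sge s) (xe s) (xsg s)
  L0 (deltaL L nL) (wc s) (w s) (ws s) (T s).
pose Lw := ((\sum_s Lw0 s) + nn * L.+1)%N.
have LL s : (Lw0 s <= Lw)%N by rewrite /Lw (bigD1 s) //=; lia.
have eL s : (e s * L.+1 <= Lw)%N.
  rewrite /Lw; apply: (leq_trans _ (leq_addl _ _)); rewrite leq_pmul2r //.
  by rewrite /nn (bigD1 s) //= leq_addr.
have Os s : lattice (E s (x^-1 ^+ N0 * f)) by exact: Of.
have /choice [d hdd] : forall s, exists d,
    has_det lcst (E s x^-1) (@lattice F) (@tbasis F (e s)) L (E s (x^-1 ^+ N0 * f)) d.
  move=> s; exact: (has_det_exists (lat_adic (sge s) (xsg s)) L (tbasisP (e0 s) (sge s) (xe s) (xsg s)) (Os s)).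
pose M := (nn * L.+2)%N.
have nM : (nn <= M)%N by rewrite /M leq_pmulr.
have nLM : (nn * L.+1 <= M)%N by rewrite /M leq_mul2l leqnSn orbT.
have [tau ad] := adapted_exists E_pi E_distinct x M.
have tb := adapted_basis E_cst E_pi x0 x_pole nM ad.
have hd1 := adapted_det E_cst E_pi x0 x_pole nM nLM ad Of hdd.
have red1 := has_det_basis (semilocal_adic E_cst x0 x_pole) tb vb hd1 (hd L).
pose rr s := norm_t (e0 s) (cc s); pose DD s := norm_roots (cc s) (alpha s) Lw.
pose U1 := c%:P * \prod_s rr s ^+ wn s.
pose U2 := \prod_s ((a0 s)%:P ^+ e s * rr s ^+ wp s * DD s).
have r0 s : (rr s)`_0 != 0 by exact: (norm_t0 (e0 s) (sge s) (xe s) (xsg s) L0 (wc s)).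
have D0 s : (DD s)`_0 = 1 by exact: (norm_roots0 lamK (e0 s) (sge s) (xe s) (xsg s) (deltaL L nL) (wc s)).
have red2 : in_qpoly 'X^(L.+1) ('X^(a + Wn) * U1) = in_qpoly 'X^(L.+1) ('X^(N0 * nn + Wp) * U2).
  have dE s : \det (compmx (cc s)) = 'X * rr s by exact: (norm_tE (e0 s) (sge s) (xe s) (xsg s) (wc s)).
  have -> : 'X^(a + Wn) * U1 = c *: 'X^a * \prod_s \det (compmx (cc s)) ^+ wn s.
    rewrite (eq_bigr (fun s => 'X^(wn s) * rr s ^+ wn s)); last by move=> s _; rewrite dE exprMn.
    rewrite big_split exprD /Wn (expr_sum 'X) /U1 -mul_polyC.
    by rewrite mulrACA (mulrC ('X^a)).
  have -> : 'X^(N0 * nn + Wp) * U2 = \prod_s ('X^(N0 * e s) * (a0 s)%:P ^+ e s *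
      \det (compmx (cc s)) ^+ wp s * DD s).
    rewrite exprD /nn big_distrr /Wp !(expr_sum 'X) -!big_split; apply: eq_bigr => s _.
    by rewrite dE (exprMn _ 'X) /=; move: (rr s ^+ _) => b; rewrite -!mulrA; congr (_ * _); exact: mulrCA.
  rewrite rmorphM /= -red1 -rmorphM -big_split /= !rmorph_prod; apply: eq_bigr => s _.
  have := local_det (e0 s) (sge s) (xe s) (xsg s) (wc s) (ws s) (eL s).
  move=> /(_ (w s) N0 (d s)) H.
    by apply: H; rewrite -(EP s).1; have := hdd s; rewrite rmorphM rmorphXn.
have U10 : U1`_0 = c * \prod_s (rr s)`_0 ^+ wn s.
  rewrite -!horner_coef0 hornerM hornerC horner_prod; congr (_ * _).
  by apply: eq_bigr => s _; rewrite horner_exp horner_coef0.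
have U20 : U2`_0 = (\prod_s a0 s ^+ e s) * \prod_s (rr s)`_0 ^+ wp s.
  rewrite -!horner_coef0 horner_prod -big_split /=.
  by apply: eq_bigr => s _; rewrite !hornerM !horner_exp hornerC !horner_coef0 D0 mulr1.
have [||//|UU evU] := hev_eq_trunc lam (deltaL n (leqnn n)) red2.
- by rewrite U10 mulf_neq0 //; apply/prodf_neq0 => s _; rewrite expf_neq0.
- rewrite U20 mulf_neq0 //; apply/prodf_neq0 => s _; rewrite expf_neq0 //; by case: (ws s).
have sigP s : contou_carrere (map_laurent lam (E s f)) (1 - lcst delta * map_laurent lam (E s x))
    * hev lam delta (rr s) ^+ wn s * lam (rr s)`_0 ^+ wp s =
  hev lam delta (rr s) ^+ wp s * hev lam delta (DD s) * lam (rr s)`_0 ^+ wn s.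
  by rewrite (EP s).1 (sym s Lw (LL s)) rmorphM rmorphXn.
rewrite -/delta; set sig := \prod_s _.
have evU1 : hev lam delta U1 = lam c * \prod_s hev lam delta (rr s) ^+ wn s.
  by rewrite rmorphM /= hevC rmorph_prod; congr (_ * _); apply: eq_bigr => s _; rewrite rmorphXn.
have evU2 : hev lam delta U2 = lam (\prod_s a0 s ^+ e s) *
    (\prod_s (hev lam delta (rr s) ^+ wp s * hev lam delta (DD s))).
  rewrite !rmorph_prod -big_split /=; apply: eq_bigr => s _.
  by move: (rr s) (DD s) => r D; rewrite !rmorphM !rmorphXn /= hevC mulrA.
have key : sig * hev lam delta U1 * lam U2`_0 = hev lam delta U2 * lam U1`_0.
  have H : sig * (\prod_s hev lam delta (rr s) ^+ wn s) * (\prod_s lam (rr s)`_0 ^+ wp s) =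
      (\prod_s (hev lam delta (rr s) ^+ wp s * hev lam delta (DD s))) * \prod_s lam (rr s)`_0 ^+ wn s.
    by rewrite -!big_split; apply: eq_bigr => s _; exact: sigP.
  have lamX (g : 'I_m -> nat) : \prod_s lam (rr s)`_0 ^+ g s = lam (\prod_s (rr s)`_0 ^+ g s).
    by rewrite rmorph_prod; apply: eq_bigr => s _; rewrite rmorphXn.
  rewrite evU1 evU2 U10 U20 !(rmorphM lam) -!lamX.
  have e1 (s1 c1 r1 a1 p1 p2 p4 : k) : s1 * r1 * p1 = p2 * p4 ->
      s1 * (c1 * r1) * (a1 * p1) = a1 * p2 * (c1 * p4).
    by move=> h; transitivity (a1 * c1 * (s1 * r1 * p1)); [ring|rewrite h; ring].
  exact: e1.
have u1 : hev lam delta U2 \is a GRing.unit.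
  rewrite (unit_rho lamK eps_nil rho_ker) -evU (rho_ev lamK (deltaL n (leqnn n))) U10.
  by rewrite mulf_neq0 //; apply/prodf_neq0 => s _; rewrite expf_neq0.
have u2 : lam U2`_0 \is a GRing.unit.
  rewrite rmorph_unit // unitfE U20 mulf_neq0 //; apply/prodf_neq0 => s _; rewrite expf_neq0 //.
  by case: (ws s).
move: key; rewrite evU UU -mulrA => key.
have u : hev lam delta U2 * lam U2`_0 \is a GRing.unit by rewrite unitrM u1.
by apply: (mulIr u); rewrite key mul1r.
Qed.
End SymbolProduct.

(** * Multiplicativity of the symbol *)

Section SymbolMorphism.
Variables (F : closedFieldType) (k : comUnitRingType) (lam : {rmorphism F -> k})
  (rho : {rmorphism k -> F}) (eps : k) (n : nat).
Hypotheses (lamK : cancel lam rho) (n0 : (0 < n)%N) (eps_nil : eps ^+ n = 0)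
  (rho_ker : forall x, rho x = 0 -> exists y, x = eps * y).
Local Notation symbol f G := (contou_carrere (map_laurent lam f) (epoly lam eps G)).

Lemma rho_symbol (f : laurent F) (G : {poly laurent F}) : f <> 0 -> G`_0 = 1 -> rho (symbol f G) = 1.
Proof.
move=> /(@witt_series_exists _ _) [w [P [a0 [alpha [-> ws]]]]] G0.
have [q [Pg [T Pg1]]] := triang_exists lamK eps_nil rho_ker n0 G0.
have [L0 H] := contou_carrere_triang lamK eps_nil rho_ker w ws T; rewrite (H L0 (leqnn _)).
have Pu : Pg 0 \is a GRing.unit by case: T.
have qp : polar rho q by case: T.
rewrite rmorphM rmorph_prod big1 => [|i _].
  rewrite mulr1; have : rho (Pg 0) ^ (- w) = 1 by rewrite Pg1 exp1rz.
  by rewrite -rmorphXz.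
by rewrite rmorph_prod big1 // => y _; rewrite (rho_horner_polar _ qp).
Qed.

(** Triangular decompositions multiply, and so do the values of polynomials. *)
Lemma symbolM (f : laurent F) (G H : {poly laurent F}) : f <> 0 -> G`_0 = 1 -> H`_0 = 1 ->
  symbol f (G * H) = symbol f G * symbol f H.
Proof.
move=> /(@witt_series_exists _ _) [w [P [a0 [alpha [-> ws]]]]] G0 H0.
have [q [Pg [T _]]] := triang_exists lamK eps_nil rho_ker n0 G0.
have [q' [Pg' [T' _]]] := triang_exists lamK eps_nil rho_ker n0 H0.
have TT := triangM T T'; rewrite -rmorphM addr0 in TT.
have [L1 H1] := contou_carrere_triang lamK eps_nil rho_ker w ws T.
have [L2 H2] := contou_carrere_triang lamK eps_nil rho_ker w ws T'.
have [L3 H3] := contou_carrere_triang lamK eps_nil rho_ker w ws TT.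
pose L := (L1 + L2 + L3)%N.
rewrite (H1 L) ?(H2 L) ?(H3 L) /L; try lia.
have [_ _ v _] := T; have [_ _ v' _] := T'.
have := lcoefM_lead v v'; rewrite addr0 => ->; rewrite root_productM mulrACA; congr (_ * _).
by have [_ _ _ u] := T; have [_ _ _ u'] := T'; apply: exprMz_comm => //; exact: mulrC.
Qed.

Lemma symbol1 (f : laurent F) : f <> 0 -> symbol f 1 = 1.
Proof.
move=> f0; have e : symbol f 1 * symbol f 1 = symbol f 1.
  by rewrite -symbolM ?coefC ?mulr1.
have u : symbol f 1 \is a GRing.unit.
  by rewrite (unit_rho lamK eps_nil rho_ker) rho_symbol ?coefC // oner_eq0.
by apply: (mulIr u); rewrite mul1r.
Qed.

(** A power series is its own triangular decomposition, with q = 1, and f has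
    winding number 0. *)
Lemma symbol_regular (f : laurent F) (G : {poly laurent F}) : vanish_below 0 f -> f 0 != 0 ->
  G`_0 = 1 -> (forall j, vanish_below 0 G`_j) -> symbol f G = 1.
Proof.
move=> f0 fn G0 Gr.
have fn0 : f <> 0 by move=> e; move: fn; rewrite e lcoef0 eqxx.
have [w [P [a0 [alpha [fE ws]]]]] := witt_series_exists fn0.
have [an P0 PE] := ws.
have w0 : w = 0.
  have Pn : P 0 != 0 by rewrite (PE 0%N 0%N) // coef0_witt_poly mulr1.
  case: (ltgtP w 0) => // wl.
    have : f w != 0 by rewrite fE lcoef_tpowM subrr.
    by rewrite f0 // eqxx.
  by move: fn; rewrite fE lcoef_tpowM P0 ?eqxx //; lia.
have T : triang rho (epoly lam eps G) 0 1 (epoly lam eps G).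
  split; [by rewrite tpow0 rmorph1 !mul1r|exact: polar1| |].
    rewrite /epoly /= /horner_eval horner_coef; apply: vanish_below_sum => j _.
    rewrite -rmorphXn mulrC; apply: vanish_below_cstM; rewrite coef_map; exact: vanish_below_map.
  rewrite (unit_rho lamK eps_nil rho_ker) -map_laurentE (map_rho_epoly lamK eps_nil) G0.
  by rewrite -monomial1E lcoef_monomialE oner_neq0.
have [L0 H] := contou_carrere_triang lamK eps_nil rho_ker w ws T.
rewrite fE (H L0 (leqnn _)) w0 oppr0 expr0z mul1r /root_product big1 // => i _.
by rewrite big1 // => y _; rewrite hornerC.
Qed.
End SymbolMorphism.

(** * Functions with prescribed poles *)

Section Poles.
Variables (F K : fieldType) (I : finType) (E : I -> {rmorphism K -> laurent F}).
Variable R : set K.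
Hypotheses (R1 : R 1) (RD : forall u v, R u -> R v -> R (u + v))
  (RM : forall u v, R u -> R v -> R (u * v)).

Lemma R_exp u k : R u -> R (u ^+ k).
Proof. by move=> Ru; elim: k => [|k IH]; rewrite ?expr0 // exprS; apply: RM. Qed.

Lemma ord_pole_power s h (M : nat) (x : K) : h != 0 -> ord (E s) h < 0 -> (`|ord (E s) x|%N < M)%N ->
  ord (E s) (h ^+ M) < ord (E s) x.
Proof. by move=> h0 hs M0; rewrite ordX //; move: (ord _ h) (ord _ x) hs M0 => a b; nia. Qed.

Lemma ord_bound (x : K) s : (`|ord (E s) x|%N < (\sum_t `|ord (E t) x|).+1)%N.
Proof. by rewrite ltnS (bigD1 s) //= leq_addr. Qed.

(** Adding a high power of h to y creates the poles of h and keeps the other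
    poles of y. *)
Lemma common_pole : (forall s, exists h, [/\ R h, h != 0 & ord (E s) h < 0]) ->
  exists y, [/\ R y, y != 0 & forall s, ord (E s) y < 0].
Proof.
move=> H; suff [y [Ry y0 ys]] : exists y, [/\ R y, y != 0 & forall s, s \in enum I -> ord (E s) y < 0].
  by exists y; split=> // s; apply: ys; rewrite mem_enum.
elim: (enum I) => [|s r [y [Ry y0 yr]]]; first by exists 1; split=> //; apply: oner_neq0.
have [ys|ys] := ltP (ord (E s) y) 0.
  by exists y; split=> // t; rewrite inE => /orP[/eqP->|/yr].
have [h [Rh h0 hs]] := H s; pose M := (\sum_t `|ord (E t) y|)%N.+1.
have hM : h ^+ M != 0 by rewrite expf_neq0.
have P t : ord (E t) h < 0 -> y + h ^+ M != 0 /\ ord (E t) (y + h ^+ M) < 0.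
  move=> ht; have lt := ord_pole_power h0 ht (ord_bound y t).
  have [] := ordD hM y0 lt; rewrite addrC => -> ->; split=> //.
  by rewrite ordX // -/M; move: ht; rewrite /M; move: (ord _ h) => a; nia.
exists (y + h ^+ M); split; [by apply: RD => //; apply: R_exp|by case: (P s hs)|].
move=> t tr; have [ht|ht] := ltP (ord (E t) h) 0; first by case: (P t ht).
move: tr; rewrite inE => /orP[/eqP ts|/yr yt]; first by move: ht; rewrite ts leNgt hs.
have lt : ord (E t) y < ord (E t) (h ^+ M).
  by rewrite ordX // -/M; apply: (lt_le_trans yt); rewrite mulrn_wge0.
by have [_ ->] := ordD y0 hM lt.
Qed.

Lemma pole_shift y x (s0 : I) : y != 0 -> (forall s, ord (E s) y < 0) -> exists M,
  [/\ y ^+ M != 0, forall s, ord (E s) (y ^+ M) < 0, y ^+ M - x != 0 & forall s, ord (E s) (y ^+ M - x) < 0].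
Proof.
move=> y0 ys; exists (\sum_t `|ord (E t) x|)%N.+1; set M := _.+1.
have yM : y ^+ M != 0 by rewrite expf_neq0.
have yMs s : ord (E s) (y ^+ M) < 0.
  by rewrite ordX // -/M; move: (ys s); rewrite /M; move: (ord _ y) => a; nia.
have [->|x0] := eqVneq x 0; first by rewrite subr0.
have nx : - x != 0 by rewrite oppr_eq0.
have N s : ord (E s) (- x) = ord (E s) x.
  by rewrite -mulN1r ordM ?oppr_eq0 ?oner_eq0 // -[RHS]add0r; congr (_ + _);
     apply: ord_eq; rewrite rmorphN rmorph1 ?lcoefN -monomial1E ?lcoef_monomialE ?oppr_eq0 ?oner_eq0 //;
     apply: vanish_belowN; exact: vanish_below_cst.
have lt s : ord (E s) (y ^+ M) < ord (E s) (- x) by rewrite N; apply: ord_pole_power => //; exact: ord_bound.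
split=> // [|s]; first by case: (ordD yM nx (lt s0)).
by have [_ ->] := ordD yM nx (lt s).
Qed.
End Poles.

(** * Reciprocity for general arguments *)

Section Reciprocity.
Variables (F : closedFieldType) (k : comUnitRingType) (lam : {rmorphism F -> k})
  (rho : {rmorphism k -> F}) (eps : k) (n : nat).
Hypotheses (lamK : cancel lam rho) (n0 : (0 < n)%N) (eps_nil : eps ^+ n = 0)
  (rho_ker : forall x, rho x = 0 -> exists y, x = eps * y).
Variables (K : fieldType) (iota : {rmorphism F -> K}) (m : nat)
  (E : 'I_m -> {rmorphism K -> laurent F}) (pi : 'I_m -> K).
Hypotheses (tr : trdeg1 iota) (E_cst : forall s a, E s (iota a) = lcst a)
  (E_pi : forall s, E s (pi s) = tpow F 1)
  (E_distinct : forall s t, s != t -> exists2 f, vanish_below 0 (E s f) & ~ vanish_below 0 (E t f)).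
Variable R : set K.
Hypotheses (RB : forall u v, R u -> R v -> R (u - v)) (RM : forall u v, R u -> R v -> R (u * v))
  (Rcst : forall a, R (iota a))
  (R_O : forall u, R u -> semilocal E u -> range iota u)
  (R_integral : forall x u, R x -> integralOver (hev iota x) u -> R u)
  (R_pole : forall s, exists h, [/\ R h, h != 0 & ord (E s) h < 0]).
Variables f f' : K.
Hypotheses (Rf : R f) (Rf' : R f') (ff : f * f' = 1).

Let R0 : R 0. Proof. by rewrite -(rmorph0 iota). Qed.
Let R1 : R 1. Proof. by rewrite -(rmorph1 iota). Qed.
Let RD u v : R u -> R v -> R (u + v).
Proof. by move=> Ru Rv; rewrite -[v]opprK -[- v]sub0r; apply: RB => //; apply: RB. Qed.

Definition coefs_in (G : {poly K}) := forall j, R G`_j.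
Lemma coefs_inB (G H : {poly K}) : coefs_in G -> coefs_in H -> coefs_in (G - H).
Proof. by move=> RG RH j; rewrite coefB; apply: RB. Qed.
Lemma coefs_inD (G H : {poly K}) : coefs_in G -> coefs_in H -> coefs_in (G + H).
Proof. by move=> RG RH j; rewrite coefD; apply: RD. Qed.
Lemma coefs_inM (G H : {poly K}) : coefs_in G -> coefs_in H -> coefs_in (G * H).
Proof. by move=> RG RH j; rewrite coefM; elim/big_rec: _ => // i u _; apply: RD; apply: RM. Qed.
Lemma coefs_inC u : R u -> coefs_in u%:P.
Proof. by move=> Ru j; rewrite coefC; case: ifP. Qed.
Lemma coefs_inXn j : coefs_in 'X^j.
Proof. by move=> i; rewrite coefXn; case: (_ == _). Qed.

Definition symbol s (G : {poly K}) :=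
  contou_carrere (map_laurent lam (E s f)) (epoly lam eps (map_poly (E s) G)).

Let Ef s : E s f <> 0.
Proof.
apply/eqP; rewrite fmorph_eq0; apply/eqP => f0.
by move: ff; rewrite f0 mul0r => /esym/eqP; rewrite oner_eq0.
Qed.

Lemma global_symbolM s (G H : {poly K}) : G`_0 = 1 -> H`_0 = 1 -> symbol s (G * H) = symbol s G * symbol s H.
Proof.
move=> G0 H0; rewrite /symbol rmorphM /=.
by apply: (symbolM lamK n0 eps_nil rho_ker) => //; rewrite coef_map /= ?G0 ?H0 rmorph1.
Qed.

Lemma global_symbol_trivial s (G H : {poly K}) : G = 1 + 'X^n * H -> symbol s G = 1.
Proof.
move=> ->; rewrite /symbol rmorphD rmorph1 rmorphM /= map_polyXn.
rewrite rmorphD rmorph1 rmorphM /= epolyXn eps_nil [lcst 0]rmorph0 mul0r addr0.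
have <- : epoly lam eps 1 = 1 by apply: rmorph1.
exact: (symbol1 lamK n0 eps_nil rho_ker).
Qed.

Lemma linear_reciprocity (s0 : 'I_m) (x : K) i : x != 0 -> (forall s, ord (E s) x < 0) -> R x ->
  (0 < i)%N -> \prod_s symbol s (1 - 'X^i * x%:P) = 1.
Proof.
move=> x0 xp Rx i0.
rewrite -[RHS](symbol_product lamK n0 eps_nil rho_ker tr E_cst E_pi E_distinct x0 xp s0 RB RM Rcst Rx R_O
  (fun u => @R_integral x u Rx) Rf Rf' ff i0).
apply: eq_bigr => s _; rewrite /symbol rmorphB rmorph1 rmorphM /= map_polyXn map_polyC.
by rewrite rmorphB rmorph1 rmorphM /= epolyXn epolyC.
Qed.

(** Descending induction on i, for A congruent to 1 modulo X^i. If x is the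
    coefficient of X^i in A, then up to X^(i+1) one has A (1 - y' X^i) = 1 - (y'
    - x) X^i, for any y' in R. A high power y' of a function with poles at all
    places makes symbol_product applicable to both linear factors, and the
    quotient of A (1 - y' X^i) by 1 - z X^i, for z = y' - x, is congruent to 1
    modulo X^(i+1). *)
Lemma reciprocity (G : {poly K}) : coefs_in G -> G`_0 = 1 -> \prod_s symbol s G = 1.
Proof.
case: (pickP 'I_m) => [s0 _|m0]; last by rewrite big_pred0.
have [y [Ry y0 ys]] := common_pole R1 RD RM R_pole.
move=> RG G0.
suff H d i (A B : {poly K}) : (i + d)%N = n -> (0 < i)%N -> coefs_in B -> A = 1 + 'X^i * B ->
    \prod_s symbol s A = 1.
  apply: (H n.-1 1%N G (drop_poly 1 G)) => //; first lia.
    by move=> j; rewrite coef_drop_poly.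
  by rewrite expr1 {1}(poly_head G) G0.
elim: d i A B => [|d IH] i A B idn i0 RB' AE.
  rewrite big1 // => s _; apply: (@global_symbol_trivial _ _ B).
  by rewrite AE -idn addn0.
have [M [yM yMs zM zMs]] := pole_shift B`_0 s0 y0 ys.
set y' := y ^+ M in yM yMs zM zMs; set z := y' - B`_0 in zM zMs.
have Ry' : R y' by apply: R_exp.
have Rz : R z by apply: RB.
have l1 := linear_reciprocity s0 yM yMs Ry' i0.
have l2 := linear_reciprocity s0 zM zMs Rz i0.
pose B1 := drop_poly 1 B.
have BE : B = (B`_0)%:P + 'X * B1 by exact: poly_head.
pose T := B1 - 'X^(i.-1) * y'%:P * B.
have iE : i = i.-1.+1 by rewrite prednK.
have AT : A * (1 - 'X^i * y'%:P) = 1 - 'X^i * z%:P + 'X^(i.+1) * T.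
  have h (x p b c a u : {poly K}) : b = a + x * c ->
      (1 + x * p * b) * (1 - x * p * u) = 1 - x * p * (u - a) + x * (x * p) * (c - p * u * b).
    move=> e; transitivity (1 + x * p * (a + x * c) - x * p * u - x * p * (x * p) * u * b); last by ring.
    by rewrite -e; ring.
  by rewrite AE /T /z rmorphB /= exprS {1 2 3 4}iE exprS; apply: h.
(* the inverse of 1 - z X^i modulo X^(i n), which is enough as i n >= n *)
pose inv := \sum_(j < n) ('X^i * z%:P) ^+ j.
have invE : (1 - 'X^i * z%:P) * inv = 1 - 'X^(i * n) * (z ^+ n)%:P.
  have := subrX1 ('X^i * z%:P) n; rewrite -/inv exprMn -exprM -polyC_exp => e.
  by rewrite -opprB mulNr -e opprB.
have n1 : (1 < n)%N by rewrite -idn; lia.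
have [dd inE] : exists dd, (i * n = i.+1 + dd)%N by exists (i * n - i.+1)%N; nia.
have Rinv : coefs_in inv.
  rewrite /inv; elim/big_rec: _ => [j|j u _ Ru]; first by rewrite coef0.
  apply: coefs_inD => //; rewrite exprMn -polyC_exp -exprM; apply: coefs_inM.
    exact: coefs_inXn.
  by apply: coefs_inC; apply: R_exp.
have AinvE : A * (1 - 'X^i * y'%:P) * inv = 1 + 'X^(i.+1) * (T * inv - 'X^dd * (z ^+ n)%:P).
  have h (p q w r t : {poly K}) : 1 - p * q * w + p * t * r = 1 + p * (t * r - q * w) by ring.
  by rewrite AT mulrDl invE inE exprD; exact: h.
have Ainv1 := IH i.+1 _ _ _ isT _ AinvE.
have h1 u : (1 - 'X^i * u%:P : {poly K})`_0 = 1 by rewrite coefB coefXnM i0 coefC subr0.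
have h2 (C : {poly K}) : (1 + 'X^(i.+1) * C)`_0 = 1 by rewrite coefD coefXnM coefC addr0.
have A0 : A`_0 = 1 by rewrite AE coefD coefXnM i0 coefC addr0.
have key s : symbol s (A * (1 - 'X^i * y'%:P) * inv) * symbol s (1 - 'X^i * z%:P) =
    symbol s A * symbol s (1 - 'X^i * y'%:P).
  rewrite -!global_symbolM ?AinvE ?h1 ?h2 // -AinvE.
  rewrite -(mulrA _ inv) (mulrC inv) invE global_symbolM.
  - have -> : symbol s (1 - 'X^(i * n) * (z ^+ n)%:P) = 1; last by rewrite mulr1.
    apply: (@global_symbol_trivial s _ (- ('X^(i * n - n) * (z ^+ n)%:P))).
    by rewrite mulrN mulrA -exprD subnKC ?leq_pmull.
  - by rewrite coef0M A0 h1 mulr1.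
  - by rewrite coefB coefXnM muln_gt0 i0 n0 coefC subr0.
have : \prod_s symbol s (A * (1 - 'X^i * y'%:P) * inv) * \prod_s symbol s (1 - 'X^i * z%:P) =
    \prod_s symbol s A * \prod_s symbol s (1 - 'X^i * y'%:P).
  by rewrite -!big_split; apply: eq_bigr => s _; exact: key.
rewrite l1 l2 Ainv1 ?mulr1 => [<-//||].
- by rewrite -idn addnS.
- apply: coefs_inB; last by apply: coefs_inM; [exact: coefs_inXn|apply: coefs_inC; apply: R_exp].
  apply: coefs_inM => //; apply: coefs_inB => [j|]; first by rewrite coef_drop_poly.
  by apply: coefs_inM => //; apply: coefs_inM; [exact: coefs_inXn|exact: coefs_inC].
Qed.
End Reciprocity.

(** * The truncated polynomial ring *)

Section TruncatedBase.
Variables (F : fieldType) (N : nat).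
Local Notation k := (trunc N F).
Local Notation lam := (qpolyC ('X^(N.+1) : {poly F})).

(** The residue map of F[eps]/(eps^(N+1)). *)
Definition trunc0 (u : k) : F := (polyn u)`_0.
Lemma trunc0_zmod : zmod_morphism trunc0.
Proof. by move=> u v; rewrite /trunc0 /= coefB. Qed.
Lemma trunc0_monoid : monoid_morphism trunc0.
Proof. by split; [exact: coef0_trunc1|move=> u v; exact: coef0_truncM]. Qed.
HB.instance Definition _ := GRing.isZmodMorphism.Build k F trunc0 trunc0_zmod.
HB.instance Definition _ := GRing.isMonoidMorphism.Build k F trunc0 trunc0_monoid.

Lemma qpolyC_trunc0 : cancel lam trunc0.
Proof. by move=> a; rewrite /trunc0 /= coefC. Qed.

Lemma qX_in_qpoly : 'qX = in_qpoly 'X^(N.+1) 'X :> k. Proof. by []. Qed.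

Lemma qX_nil : ('qX : k) ^+ N.+1 = 0.
Proof.
rewrite qX_in_qpoly -rmorphXn /=; apply: val_inj; apply: etrans (in_qpoly_take _ _) _.
by rewrite -[X in take_poly _ X]mul1r take_polyMXn_0.
Qed.

Lemma trunc0_ker (u : k) : trunc0 u = 0 -> exists v, u = 'qX * v.
Proof.
move=> u0; exists (in_qpoly 'X^(N.+1) (drop_poly 1 (polyn u))).
by rewrite qX_in_qpoly -rmorphM -[LHS]in_qpolyK /= {1}(poly_head (polyn u)) [(polyn u)`_0]u0 add0r.
Qed.
End TruncatedBase.

(** * Reciprocity on a curve *)

Section CurveReciprocity.
Variables (F : closedFieldType) (X : curve F).
Hypotheses (X_nonsingular : nonsingular X)
  (X_constants : regular_away (X := X) fset0 = range (constants X)).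
Local Notation K := (function_field X).
Local Notation iota := (constants X).
Variables (S : {fset X}) (pi : S -> K) (E : S -> {rmorphism K -> laurent F}).
Hypothesis E_place : forall s, is_place (val s) (pi s) (E s).
Variables (k : comUnitRingType) (lam : {rmorphism F -> k})
  (rho : {rmorphism k -> F}) (eps : k) (n : nat).
Hypotheses (lamK : cancel lam rho) (n0 : (0 < n)%N) (eps_nil : eps ^+ n = 0)
  (rho_ker : forall x, rho x = 0 -> exists y, x = eps * y).
Local Notation R := (regular_away S).

Lemma some_place (p : X) : exists pip Ep, is_place p pip Ep.
Proof.
have [pip u] := X_nonsingular p; have [Ep h] := curve_place u.
by exists pip, Ep.
Qed.
Lemma regular_cst a : R (iota a).
Proof.
move=> p _; have [pip [Ep [c _ l _]]] := some_place p.
by apply/l; rewrite c; exact: vanish_below_cst.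
Qed.
Lemma regularB u v : R u -> R v -> R (u - v).
Proof.
move=> Ru Rv p pS; have [pip [Ep [_ _ l _]]] := some_place p.
by apply/l; rewrite rmorphB; apply: vanish_belowB; apply/l; [apply: Ru|apply: Rv].
Qed.
Lemma regularM u v : R u -> R v -> R (u * v).
Proof.
move=> Ru Rv p pS; have [pip [Ep [_ _ l _]]] := some_place p.
by apply/l; rewrite rmorphM; apply: vanish_belowM0; apply/l; [apply: Ru|apply: Rv].
Qed.
Lemma regular_integral x u : R x -> integralOver (hev iota x) u -> R u.
Proof.
move=> Rx ux p pS; have [pip [Ep h]] := some_place p.
by apply: (place_integral h (Rx p pS) ux).
Qed.

(** The places of S at which some function of R has a pole satisfy the
    hypotheses of reciprocity, since a function of R that is regular there is
    regular on X, hence constant. At the other places all functions of R are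
    regular, so that f is a unit, and the symbol is 1. *)
Lemma curve_reciprocity (f f' : K) (G : {poly K}) : R f -> R f' -> f * f' = 1 ->
  coefs_in R G -> G`_0 = 1 ->
  \prod_s contou_carrere (map_laurent lam (E s f)) (epoly lam eps (map_poly (E s) G)) = 1.
Proof.
move=> Rf Rf' ff RG G0.
pose A := [pred s | `[< exists h, [/\ R h, h != 0 & ord (E s) h < 0] >]].
have regA s u : s \notin A -> R u -> vanish_below 0 (E s u).
  move=> /asboolPn sA Ru; have [->|u0] := eqVneq u 0; first by rewrite rmorph0; exact: vanish_below0.
  by apply/(ord_vanish _ _ u0); rewrite leNgt; apply/negP => us; apply: sA; exists u.
rewrite (bigID (mem A)) /= [X in _ * X]big1 ?mulr1 => [|s sA]; last first.
  apply: (symbol_regular lamK n0 eps_nil rho_ker).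
  - exact: regA.
  - have := lcoefM_lead (regA s f sA Rf) (regA s f' sA Rf') ; rewrite addr0 -rmorphM ff rmorph1.
    move=> e; apply/eqP => z; move: e; rewrite z mul0r -monomial1E lcoef_monomialE => /eqP.
    by rewrite oner_eq0.
  - by rewrite coef_map /= G0 rmorph1.
  - by move=> j; rewrite coef_map; apply: regA.
rewrite big_enum_val.
apply: (@reciprocity F k lam rho eps n lamK n0 eps_nil rho_ker K iota #|A| (fun i => E (enum_val i))
  (fun i => pi (enum_val i)) (curve_dim1 X) _ _ _ R regularB regularM regular_cst _ regular_integral _
  f f' Rf Rf' ff G RG G0).
- by move=> i a; case: (E_place (enum_val i)).
- by move=> i; case: (E_place (enum_val i)).
- move=> s t st.
  have [|u pu qu] := @place_distinct _ X X_nonsingular (val (enum_val s)) (val (enum_val t)).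
    by move=> /val_inj /enum_val_inj e; move: st; rewrite e eqxx.
  have [_ _ ls _] := E_place (enum_val s); have [_ _ lt _] := E_place (enum_val t).
  by exists u; [apply/ls|move=> /lt].
- move=> u Ru Ou; rewrite -X_constants => p _.
  case: (boolP (p \in S)) => pS; last exact: Ru.
  have [_ _ l _] := E_place [` pS]%fset; apply/l.
  case: (boolP ([` pS]%fset \in A)) => sA; last exact: regA.
  by have := Ou (enum_rank_in sA [` pS]%fset); rewrite enum_rankK_in.
- by move=> i; have := enum_valP i => /asboolP.
Qed.
End CurveReciprocity.

(** * Vanishing of the sum of residues *)

Lemma witt_exp_laurent_epoly (F : fieldType) N (x : witt N (laurent F)) :
  witt_exp_laurent x = epoly (qpolyC ('X^(N.+1) : {poly F})) 'qX (\prod_(i < N) (1 - x i *: 'X^(i.+1))).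
Proof.
rewrite rmorph_prod; apply: eq_bigr => i _.
by rewrite rmorphB rmorph1 -mul_polyC rmorphM /= epolyC epolyXn.
Qed.

Theorem mainTheorem3 (F : closedFieldType) (X : curve F)
  (X_nonsingular : nonsingular X) (X_complete : complete X)
  (* dim_F H^0(X, O_X) = 1 *)
  (X_constants : regular_away (X := X) fset0 = range (constants X))
  (S : {fset X}) (S_nonempty : S != fset0)
  (pi : S -> function_field X)
  (pi_uniformizer : forall s : S, uniformizer (val s) (pi s))
  (N : nat) (N_gt0 : (0 < N)%N)
  (f : S -> laurent F) (x : S -> witt N (laurent F))
  (f_unit : ring_units (laurent_image pi) f)
  (x_in : forall i : 'I_N, laurent_image pi (fun s => x s i)) :
  \sum_(s : S) witt_residue (f s) (x s) = 0.
Proof.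
have /choice [E EP] : forall s, exists E, is_place (val s) (pi s) E.
  by move=> s; exact: curve_place (pi_uniformizer s).
have [[phi Rphi phiE] [g [gam Rgam gamE] fg]] := f_unit.
have /choice [xi xiP] : forall i : 'I_N, exists xi, regular_away S xi /\
    forall s, laurent_expansion (val s) (pi s) xi (x s i).
  by move=> i; have [xi Rxi xiE] := x_in i; exists xi.
have exE s u a : laurent_expansion (val s) (pi s) u a -> E s u = a by have [_ _ _ h] := EP s; apply: h.
have phigam : phi * gam = 1.
  have /fset0Pn [p pS] := S_nonempty; apply: (fmorph_inj (E [` pS]%fset)).
  by rewrite rmorphM rmorph1 (exE _ _ _ (phiE _)) (exE _ _ _ (gamE _)) fg.
have RB := @regularB _ _ X_nonsingular S; have RM := @regularM _ _ X_nonsingular S.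
have Rc := @regular_cst _ _ X_nonsingular S.
pose G := \prod_(i < N) (1 - xi i *: 'X^(i.+1)).
have RG : coefs_in (regular_away S) G.
  rewrite /G; elim/big_rec: _ => [|i u _ Ru]; first by apply: (coefs_inC Rc); rewrite -(rmorph1 (constants X)).
  apply: (coefs_inM RB RM Rc) => //; rewrite -mul_polyC; apply: (coefs_inB RB).
    by apply: (coefs_inC Rc); rewrite -(rmorph1 (constants X)).
  apply: (coefs_inM RB RM Rc); last exact: (coefs_inXn Rc).
  by apply: (coefs_inC Rc); case: (xiP i).
have G0 : G`_0 = 1.
  rewrite -horner_coef0 horner_prod big1 // => i _.
  by rewrite horner_coef0 coefB coefZ coefXn mulr0 subr0 coefC.
have symE s : contou_carrere (laurent_lift N (f s)) (witt_exp_laurent (x s)) =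
    contou_carrere (map_laurent (qpolyC ('X^(N.+1) : {poly F})) (E s phi))
      (epoly (qpolyC 'X^(N.+1)) 'qX (map_poly (E s) G)).
  rewrite witt_exp_laurent_epoly (exE _ _ _ (phiE s)); congr (contou_carrere _ (epoly _ _ _)).
  rewrite rmorph_prod; apply: eq_bigr => i _; rewrite rmorphB rmorph1 /= map_polyZ.
  by rewrite map_polyXn (exE _ _ _ ((xiP i).2 s)).
have n0 : (0 < N.+1)%N by [].
have res s : witt_exp (witt_residue (f s) (x s)) =
    contou_carrere (laurent_lift N (f s)) (witt_exp_laurent (x s)).
  rewrite witt_logK // symE -/(trunc0 _).
  apply: (rho_symbol (@qpolyC_trunc0 F N) n0 (@qX_nil F N) (@trunc0_ker F N)).
    rewrite (exE _ _ _ (phiE s)) => f0; have := fg s; rewrite f0 mul0r => /esym/eqP.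
    by rewrite oner_eq0.
  by rewrite coef_map /= G0 rmorph1.
apply: witt_exp_inj; rewrite witt_exp0.
transitivity (\prod_s witt_exp (witt_residue (f s) (x s))).
  by apply: (big_morph _ (@witt_expD N F)); exact: witt_exp0.
rewrite -[RHS](curve_reciprocity X_nonsingular X_constants EP (@qpolyC_trunc0 F N) n0
  (@qX_nil F N) (@trunc0_ker F N) Rphi Rgam phigam RG G0).
by apply: eq_bigr => s _; rewrite res symE.
Qed.
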